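(* Let $a\in(0,1/2)$ and let $e(F,\rho)$ be the unique minimal-rate directed metric among those for which the geodesic from $(0,0)$ to $(0,1)$ passes through $(1,a)$; $F$ consists of the segment from $(0,0)$ to $(1,a)$, a segment from $(1,a)$ to a point $(x_B,t_B)$ with $t_B>a$, and $F(t)=x_B\frac{\sqrt t-t}{\sqrt{t_B}-t_B}$ on $[t_B,1]$. Then the minimal rate is $$I=\frac{8}{3a^2(3-2\sqrt{2a})^2},$$ and $x_B=\frac{4(1-\sqrt{2a})}{3-2\sqrt{2a}}$, $t_B=2a$. In particular, as $a\to0$, $x_B\to\frac43$ and $I=\frac{8}{27a^2}+o(a^{-2})$.
   Context: Spacetime points are written $(x,t)$ with $x$ spatial and $t$ time. A directed metric is a continuous $e:\{(x,s,y,t):s<t\}\to\mathbb R\cup\{-\infty\}$ with $e(x,s,y,t)+e(y,t,z,u)\le e(x,s,z,u)$. The Dirichlet metric is $d(x,s,y,t)=-\frac{(y-x)^2}{t-s}$. For a curve $\gamma$ and nonnegative density $\rho$, $e_{\gamma,\rho}(x_1,t_1,x_2,t_2)=\int_{t_1}^{t_2}(\rho-\gamma'^2)dt$ if $x_i=\gamma(t_i)$, else $-\infty$. Finite-rate metrics arise from planting densities $\rho_i$ along countably many curves $\gamma_i$ (smallest directed metric $\ge d$ and $\ge$ each $e_{\gamma_i,\rho_i}$), with rate $I=\sum_i\frac43\int\rho_i^{3/2}$; other metrics have infinite rate. $e(F,\rho)$ is the metric from planting $\rho$ along the single curve $t\mapsto(F(t),t)$. Geodesics are paths whose length (infimum over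 partitions of sums of $e$ along consecutive points) equals the $e$-distance between their endpoints. *)

(* Defs.v *)
From HB Require Import structures.
From mathcomp Require Import all_boot all_order all_algebra.
From mathcomp Require Import all_classical all_reals all_analysis.
Set Implicit Arguments. Unset Strict Implicit. Unset Printing Implicit Defensive.
Import Order.TTheory GRing.Theory Num.Theory.
Import numFieldNormedType.Exports.
Local Open Scope classical_set_scope.
Local Open Scope ring_scope.

Section Defs.
Variable R : realType.

(* A candidate metric: e x s y t is the "distance" from (x,s) to (y,t);
   only values with s < t matter. *)
Definition spacetime_fun := R -> R -> R -> R -> \bar R.

Definition directed_metric (e : spacetime_fun) : Prop :=
  {within [set p : R * R * R * R | p.1.1.2 < p.2],
     continuous (fun p : R * R * R * R => e p.1.1.1 p.1.1.2 p.1.2 p.2)} /\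
  (forall x s y t, s < t -> e x s y t != +oo%E) /\
  (forall x s y t z u, s < t -> t < u ->
     (e x s y t + e y t z u <= e x s z u)%E).

Definition ge_on (e1 e2 : spacetime_fun) : Prop :=
  forall x s y t, s < t -> (e2 x s y t <= e1 x s y t)%E.

Definition eq_on (e1 e2 : spacetime_fun) : Prop :=
  forall x s y t, s < t -> e1 x s y t = e2 x s y t.

Definition dirichlet : spacetime_fun :=
  fun x s y t => (- ((y - x) ^+ 2 / (t - s)))%:E.

Fixpoint nonoverlap (a : R) (l : seq (R * R)) : bool :=
  if l is (u, v) :: l' then (a <= u) && (u < v) && nonoverlap v l' else true.

Definition abs_cont (a b : R) (f : R -> R) : Prop :=
  forall eps : R, 0 < eps -> exists2 delta : R, 0 < delta &
    forall l : seq (R * R), nonoverlap a l -> all (fun p => p.2 <= b) l ->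
      \sum_(p <- l) (p.2 - p.1) < delta ->
      \sum_(p <- l) `|f p.2 - f p.1| < eps.

Definition energy (g : R -> R) (t1 t2 : R) : \bar R :=
  if `[< abs_cont t1 t2 g >] then
    (\int[lebesgue_measure]_(t in `[t1, t2]) ((derive1 g t) ^+ 2)%:E)%E
  else +oo%E.

Definition plant_metric (sg ta : R) (g rho : R -> R) : spacetime_fun :=
  fun x1 t1 x2 t2 =>
    if [&& sg <= t1, t2 <= ta, x1 == g t1 & x2 == g t2] then
      ((\int[lebesgue_measure]_(t in `[t1, t2]) (rho t)%:E) - energy g t1 t2)%E
    else -oo%E.

Definition smallest_above (e : spacetime_fun) (E : set spacetime_fun) : Prop :=
  [/\ directed_metric e, ge_on e dirichlet, (forall f, E f -> ge_on e f) &
      forall e', directed_metric e' -> ge_on e' dirichlet ->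
        (forall f, E f -> ge_on e' f) -> ge_on e' e].

Definition density (rho : R -> R) : Prop :=
  (forall t, 0 <= rho t) /\ measurable_fun [set: R] rho.

Definition plant_rate (sg ta : R) (rho : R -> R) : \bar R :=
  ((4 / 3)%:E * \int[lebesgue_measure]_(t in `[sg, ta]) ((rho t) `^ (3 / 2))%:E)%E.

(* rate of a metric: infimum over all representations as plantings along
   countably many curves (+oo if there is none) *)
Definition rate (e : spacetime_fun) : \bar R :=
  ereal_inf [set r | exists (lo hi : nat -> R) (g rho : nat -> R -> R),
    (forall i, density (rho i)) /\
    smallest_above e (range (fun i => plant_metric (lo i) (hi i) (g i) (rho i))) /\
    r = (\sum_(i <oo) plant_rate (lo i) (hi i) (rho i))%E].

Fixpoint psum (e : spacetime_fun) (pi : R -> R) (t0 : R) (ts : seq R) : \bar R :=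
  if ts is t1 :: ts' then (e (pi t0) t0 (pi t1) t1 + psum e pi t1 ts')%E
  else 0%E.

Definition partition (s t : R) (ts : seq R) : Prop :=
  path <%R s ts /\ last s ts = t.

Definition path_length (e : spacetime_fun) (pi : R -> R) (s t : R) : \bar R :=
  ereal_inf [set psum e pi s ts | ts in partition s t].

Definition geodesic (e : spacetime_fun) (pi : R -> R) (x s y t : R) : Prop :=
  [/\ s < t, pi s = x, pi t = y,
      {within [set u | s <= u <= t], continuous pi} &
      path_length e pi s t = e x s y t].

Definition admissible (a : R) (e : spacetime_fun) : Prop :=
  directed_metric e /\ exists pi, geodesic e pi 0 0 0 1 /\ pi a = 1.

Definition xB (a : R) : R :=
  4 * (1 - Num.sqrt (2 * a)) / (3 - 2 * Num.sqrt (2 * a)).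
Definition tB (a : R) : R := 2 * a.
Definition Imin (a : R) : R :=
  8 / (3 * a ^+ 2 * (3 - 2 * Num.sqrt (2 * a)) ^+ 2).

Definition Fcurve (a : R) (t : R) : R :=
  if t <= a then t / a
  else if t <= tB a then 1 + (xB a - 1) * (t - a) / (tB a - a)
  else xB a * (Num.sqrt t - t) / (Num.sqrt (tB a) - tB a).

End Defs.

(* Main.v *)
Require Import Defs.
From HB Require Import structures.
From mathcomp Require Import all_boot all_order all_algebra.
From mathcomp Require Import all_classical all_reals all_analysis measurable_realfun.
From mathcomp Require Import ring lra.
Set Implicit Arguments. Unset Strict Implicit. Unset Printing Implicit Defensive.
Import Order.TTheory GRing.Theory Num.Theory.
Import numFieldNormedType.Exports.
Local Open Scope classical_set_scope.
Local Open Scope ring_scope.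

(* A metric of finite rate is a supremum over trajectories: a trajectory has finite
   Dirichlet energy, at each time follows at most one of the planted curves and
   collects its density, and is worth the collected mass minus its energy.  Hence
   the metric is [optimal_gain] of any of its representations.

   Let a nearly optimal trajectory from (0,0) to (0,1) through (1,a) have speed v
   and collected density r.  Comparing with straight segments from the origin,
   the integral of r - v^2 over [0,t] is at least - (int_0^t v)^2 / t - eps.  Write
   v = F' + d, with F the claimed optimal curve, and let sigma be the square root
   of the claimed density.  As sigma is nonincreasing, these inequalities can be
   averaged over t against the measure sigma(1) delta_1 - sigma'(t) dt; after
   integrating by parts, all terms linear in d cancel, and there remains
     int sigma (r - sigma^2) >= sigma(1) int d^2 - eps sigma(0).
   Convexity of r^(3/2) turns this into the lower bound on the rate, with explicit
   control of d in L^2 and of r - sigma^2 in L^1.  For a metric of minimal rate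
   these errors and the mass off the trajectory can be made arbitrarily small, and
   shifting competitors by the difference between the trajectory and F squeezes the
   metric onto the one planted along F. *)

(** * Integrals over segments *)

(** The profile comes from complementary slackness. Write F for the curve and sigma for the root of
    its density. The comparison with the segment from the origin is tight exactly for t >= t_B:
    differentiating the tie gives sigma = F/t - F', stationarity gives sigma = F' + c, and together
    F = c (sqrt t - t). Before t_B the comparison is strict, so the averaging measure has no mass
    there and sigma is constant. The constraint at (1,a) lets F' jump at a; the tie and the
    continuity of sigma at t_B force F' + c = 3 sigma(0) before a, and t_B = 2a. Two obstacles shape
    the rest. The energy is defined with the pointwise derivative of an absolutely continuous
    function, so such functions must be shown to be primitives; trajectories then carry a measurable
    velocity of their own. And the infimum defining [rate] need not be attained, while different
    representations of one metric use different curves: uniqueness is proved for the metric itself,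
    through representations with arbitrarily small error. *)

Section SegmentIntegral.
Variable R : realType.
Notation mu := (@lebesgue_measure R).
Implicit Types (s t u w k : R) (f g h : R -> R).

Definition sint s t f : R := \int[mu]_(x in `[s, t]) f x.
Definition sintegrable s t f : Prop := mu.-integrable `[s, t] (EFin \o f).
Notation mfun f := (measurable_fun [set: R] f).

Lemma sintegrable_sub s t u w f :
  sintegrable s t f -> s <= u -> w <= t -> sintegrable u w f.
Proof.
move=> fi su wt; apply: integrableS fi => //.
by apply: subset_itvScc; rewrite bnd_simp.
Qed.

Lemma sintegrable_eq s t f g : sintegrable s t f ->
  (forall x, s < x < t -> f x = g x) -> sintegrable s t g.
Proof.
move=> fi fg.
have mf : measurable_fun `]s, t[ f.
  have /measurable_int/measurable_EFinP := fi.
  by apply: measurable_funS => //; exact: subset_itv_oo_cc.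
have mg : measurable_fun `[s, t] g.
  apply: (@measurable_fun_itv_cc _ _ _ false true).
  by apply: eq_measurable_fun mf => x; rewrite inE/= in_itv/= => /fg.
apply/integrableP; split; first exact/measurable_EFinP.
have /integrableP[_] := fi.
rewrite -(eq_integral_itv_bounded (f := (fun x => `|f x|)) (g := (fun x => `|g x|))) //.
- exact: measurableT_comp.
- by apply: measurableT_comp => //; apply: measurable_funS mg => //; exact: subset_itv_oo_cc.
- by move=> x /=; rewrite in_itv/= => /fg ->.
Qed.

Lemma sint_eq s t f g : sintegrable s t f ->
  (forall x, s < x < t -> f x = g x) -> sint s t f = sint s t g.
Proof.
move=> fi fg; have gi := sintegrable_eq fi fg.
rewrite /sint /Rintegral (eq_integral_itv_bounded (f := f) (g := g)) //.
- have /measurable_int/measurable_EFinP := fi.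
  by apply: measurable_funS => //; exact: subset_itv_oo_cc.
- have /measurable_int/measurable_EFinP := gi.
  by apply: measurable_funS => //; exact: subset_itv_oo_cc.
Qed.

Lemma sintE s t f : sintegrable s t f ->
  (\int[mu]_(x in `[s, t]) (f x)%:E)%E = (sint s t f)%:E.
Proof. by move=> fi; rewrite fineK//; exact: integrable_fin_num. Qed.

Lemma sintegrableD s t f g : sintegrable s t f -> sintegrable s t g ->
  sintegrable s t (fun x => f x + g x).
Proof. by move=> fi gi; exact: (integrableD _ fi gi). Qed.

Lemma sintegrableB s t f g : sintegrable s t f -> sintegrable s t g ->
  sintegrable s t (fun x => f x - g x).
Proof. by move=> fi gi; exact: (integrableB _ fi gi). Qed.

Lemma sintegrableZ s t k f : sintegrable s t f ->
  sintegrable s t (fun x => k * f x).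
Proof. by move=> fi; exact: (integrableZl _ k fi). Qed.

Lemma sintegrable_cst s t k : sintegrable s t (fun=> k).
Proof.
apply/integrableP; split; first exact/measurable_EFinP.
rewrite /= integral_cst//=; rewrite lebesgue_measure_itv/=.
by case: ifP => _; rewrite ?mule0 ?ltry// -EFinB -EFinM ltry.
Qed.

Lemma sintD s t f g : sintegrable s t f -> sintegrable s t g ->
  sint s t (fun x => f x + g x) = sint s t f + sint s t g.
Proof. by move=> fi gi; exact: RintegralD. Qed.

Lemma sintB s t f g : sintegrable s t f -> sintegrable s t g ->
  sint s t (fun x => f x - g x) = sint s t f - sint s t g.
Proof. by move=> fi gi; exact: RintegralB. Qed.

Lemma sintZ s t k f : sintegrable s t f ->
  sint s t (fun x => k * f x) = k * sint s t f.
Proof. by move=> fi; exact: RintegralZl. Qed.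

Lemma sint_cst s t k : s <= t -> sint s t (fun=> k) = k * (t - s).
Proof.
rewrite /sint Rintegral_cst//= lebesgue_measure_itv/= lte_fin.
by rewrite le_eqVlt => /predU1P[->|->] //=; rewrite ltxx subrr.
Qed.

Lemma sint_pt s f : sint s s f = 0.
Proof. by rewrite /sint set_itv1 Rintegral_set1. Qed.

Lemma sint_le s t f g : sintegrable s t f -> sintegrable s t g ->
  (forall x, s < x < t -> f x <= g x) -> sint s t f <= sint s t g.
Proof.
move=> fi gi fg.
pose f1 x := if (s < x) && (x < t) then f x else 0.
pose g1 x := if (s < x) && (x < t) then g x else 0.
have ff1 x : s < x < t -> f x = f1 x by rewrite /f1 => ->.
have gg1 x : s < x < t -> g x = g1 x by rewrite /g1 => ->.
rewrite (sint_eq fi ff1) (sint_eq gi gg1); apply: le_Rintegral => //.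
- exact: sintegrable_eq ff1.
- exact: sintegrable_eq gg1.
- by move=> x _; rewrite /f1 /g1; case: ifP => // /fg.
Qed.

Lemma sint_ge0 s t f : sintegrable s t f ->
  (forall x, s < x < t -> 0 <= f x) -> 0 <= sint s t f.
Proof.
move=> fi f0; rewrite -[leLHS](mul0r (sint s t f)) -sintZ //.
by apply: sint_le => // [|x /f0]; [exact: sintegrableZ|rewrite mul0r].
Qed.

Lemma sint_cat s u t f : sintegrable s t f -> s <= u -> u <= t ->
  sint s t f = sint s u f + sint u t f.
Proof.
move=> fi su ut.
have := @Rintegral_itvB R f (BLeft s) (BRight t) u fi.
rewrite !bnd_simp => /(_ su ut) e.
apply/eqP; rewrite addrC -subr_eq; apply/eqP; rewrite /sint e.
apply: Rintegral_itv_obnd_cbnd; apply: integrableS fi => //.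
by apply: subset_itv; rewrite bnd_simp.
Qed.

Lemma sintegrable_le s t f g : mfun f -> sintegrable s t g ->
  (forall x, s <= x <= t -> `|f x| <= g x) -> sintegrable s t f.
Proof.
move=> mf gi fg; apply: (le_integrable _ _ _ gi) => //.
  by apply/measurable_EFinP; exact: measurable_funS mf.
move=> x; rewrite /= in_itv/= => /fg h; rewrite lee_fin.
exact: le_trans (ler_norm _).
Qed.

Lemma sintegrable_cat s u t f : mfun f -> sintegrable s u f ->
  sintegrable u t f -> s <= u -> u <= t -> sintegrable s t f.
Proof.
move=> mf fi1 fi2 su ut.
have mf' : measurable_fun `[s, t] (EFin \o f).
  by apply/measurable_EFinP; exact: measurable_funS mf.
have mf2 : measurable_fun (`[s, u] `|` `]u, t]) (fun x => `|f x|).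
  by apply: measurableT_comp => //; exact: measurable_funS mf.
apply/integrableP; split => //.
rewrite (@itv_bndbnd_setU _ _ _ (BRight u)) ?bnd_simp//.
rewrite ge0_integral_setU//=.
- apply: lte_add_pinfty; first by have /integrableP[] := fi1.
  have /integrableP[_] : mu.-integrable `]u, t] (EFin \o f).
    by apply: integrableS fi2 => //; apply: subset_itv; rewrite bnd_simp.
  by [].
- exact/measurable_EFinP.
- apply/disj_setPS => y [/=]; rewrite 2!in_itv/= => /andP[_ yx] /andP[].
  by rewrite ltNge yx.
Qed.

Lemma sint_sqr_le s t f : s < t -> sintegrable s t f ->
  sintegrable s t (fun x => f x ^+ 2) ->
  sint s t f ^+ 2 <= (t - s) * sint s t (fun x => f x ^+ 2).
Proof.
move=> st fi f2i; set A := sint s t f; have d0 : 0 < t - s by rewrite subr_gt0.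
set m := A / (t - s).
have : sint s t (fun x => (2 * m) * f x - m ^+ 2) <= sint s t (fun x => f x ^+ 2).
  apply: sint_le => // [|x _].
    by apply: sintegrableB; [exact: sintegrableZ|exact: sintegrable_cst].
  by have := sqr_ge0 (f x - m); nra.
rewrite sintB; [|exact: sintegrableZ|exact: sintegrable_cst].
rewrite sintZ; last exact: fi.
rewrite sint_cst -?/A => [h|]; last exact: ltW.
have Am : A = m * (t - s) by rewrite /m divfK// gt_eqF.
apply: le_trans (ler_wpM2l (ltW d0) h); rewrite le_eqVlt; apply/orP; left.
by clearbody m; rewrite Am; apply/eqP; ring.
Qed.

Lemma sint_sqr_div_le s t f : s < t -> sintegrable s t f ->
  sintegrable s t (fun x => f x ^+ 2) ->
  sint s t f ^+ 2 / (t - s) <= sint s t (fun x => f x ^+ 2).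
Proof.
move=> st fi f2i; rewrite ler_pdivrMr ?subr_gt0// mulrC.
exact: sint_sqr_le.
Qed.

Lemma sintegrable_of_sqr s t f : mfun f ->
  sintegrable s t (fun x => f x ^+ 2) -> sintegrable s t f.
Proof.
move=> mf f2.
apply: (@sintegrable_le s t f (fun x => 1 + f x ^+ 2)) => //.
  by apply: sintegrableD => //; exact: sintegrable_cst.
move=> x _; rewrite -(real_normK (num_real (f x))).
by have := sqr_ge0 (`|f x| - 1); have := normr_ge0 (f x); nra.
Qed.

(** The nodes form an unsorted list with arbitrary members. Removing the head either cuts the
    interval there or leaves the interval free of it, so subdivision arguments need neither sorting
    nor a partition. *)
Lemma interval_property_of_nodes (Q : R -> R -> Prop) s t (l : seq R) :
  (forall u r w, s <= u -> u < r -> r < w -> w <= t -> Q u r -> Q r w -> Q u w) ->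
  (forall u w, s <= u -> u < w -> w <= t -> (forall r, r \in l -> ~~ (u < r < w)) ->
     Q u w) ->
  forall u w, s <= u -> u < w -> w <= t -> Q u w.
Proof.
move=> cat; elim: l => [|r l ih] base u w su uw wt; first exact: base.
apply: ih => // {su uw wt u w} u w su uw wt H.
have [urw|nurw] := boolP (u < r < w).
  have /andP[ur rw] := urw.
  apply: (cat _ r) => //.
    apply: base => // [|x]; first exact: le_trans (ltW rw) wt.
    rewrite inE => /predU1P[->|/H]; first by rewrite ltxx andbF.
    by apply: contraNN => /andP[-> xr]; rewrite (lt_trans xr).
  apply: base => // [|x]; first exact: le_trans su (ltW ur).
  rewrite inE => /predU1P[->|/H]; first by rewrite ltxx.
  by apply: contraNN => /andP[rx ->]; rewrite (lt_trans ur).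
apply: base => // x; rewrite inE => /predU1P[->//|/H//].
Qed.

End SegmentIntegral.

(** * Absolutely continuous functions *)

Section AbsolutelyContinuousMonotone.
Variable R : realType.
Notation mu := (@lebesgue_measure R).

Lemma nonoverlap_grid (x : nat -> R) (P : pred nat) m j (y : R) :
  (forall k, x k < x k.+1) -> y <= x j ->
  nonoverlap y [seq (x k, x k.+1) | k <- iota j m & P k].
Proof.
move=> xS; elim: m j y => //= m ih j y yx.
case: ifP => _ /=; last by apply: ih; exact: le_trans yx (ltW (xS j)).
by rewrite yx xS /=; exact: ih.
Qed.

(** Cut []a, b]] into n+1 equal half-open cells and keep those contained in U. Their total length is
    below delta, so the increments of W over them sum to less than eps. Every point of U in []a, b]]
    lies in a kept cell for all large n, and continuity of nu from below finishes. *)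
Lemma open_abs_cont_bound (nu : {measure set (measurableTypeR R) -> \bar R})
    (W : R -> R) (a b eps delta : R) (U : set R) : a < b ->
  (forall s t, a <= s -> s <= t -> t <= b -> nu `]s, t]%classic = (W t - W s)%:E) ->
  {in `[a, b] &, {homo W : s t / s <= t}} ->
  (forall l : seq (R * R), nonoverlap a l -> all (fun p => p.2 <= b) l ->
      \sum_(p <- l) (p.2 - p.1) < delta ->
      \sum_(p <- l) `|W p.2 - W p.1| < eps) ->
  open U -> (mu U < delta%:E)%E -> (nu (U `&` `]a, b]%classic) <= eps%:E)%E.
Proof.
move=> ab nuE ndW ac oU muU.
have ba0 : 0 < b - a by rewrite subr_gt0.
pose x n k : R := a + (b - a) * (k%:R / n.+1%:R).
have n0 n : 0 < n.+1%:R :> R by [].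
have xS n k : x n k < x n k.+1.
  by rewrite /x ltrD2l ltr_pM2l// ltr_pM2r ?invr_gt0// ltr_nat.
have xSd n k : x n k.+1 - x n k = (b - a) / n.+1%:R.
  by rewrite /x -natr1; field; rewrite addrC natr1; case: n.
have x0 n : x n 0 = a by rewrite /x mulr0n mul0r mulr0 addr0.
have xb n : x n n.+1 = b by rewrite /x divff// mulr1 addrC subrK.
have xmono n : {homo x n : i j / (i <= j)%N >-> i <= j}.
  by apply: homo_leq => // [? ? ?|i]; [exact: le_trans|exact: ltW].
have xa n k : a <= x n k by rewrite -(x0 n); exact: xmono.
have xlb n k : (k <= n.+1)%N -> x n k <= b by move=> kn; rewrite -(xb n); exact: xmono.
pose C n k : set R := `]x n k, x n k.+1]%classic.
pose G n k : bool := `[< C n k `<=` U >].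
pose B n m : set R := \big[setU/set0]_(0 <= k < m | G n k) C n k.
have mC n k : measurable (C n k : set (measurableTypeR R)) by exact: measurable_itv.
have mB n m : measurable (B n m : set (measurableTypeR R)) by apply: bigsetU_measurable.
have mU : measurable (U : set (measurableTypeR R)) by exact: open_measurable.
have nuB n m : (m <= n.+1)%N ->
    (nu (B n m) <= (\sum_(0 <= k < m | G n k) (W (x n k.+1) - W (x n k)))%:E)%E.
  elim: m => [|m ih] mn; first by rewrite /B !big_nil measure0.
  have -> : B n m.+1 = B n m `|` (if G n m then C n m else set0).
    by rewrite /B big_mkcond/= big_nat_recr//= -big_mkcond.
  rewrite big_mkcond big_nat_recr//= -big_mkcond/= EFinD.
  apply: le_trans (measureU2 _ _ _) _ => //; first by case: ifP.
  apply: leeD; first by apply: ih; exact: ltnW.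
  case: ifP => _; last by rewrite measure0.
  rewrite le_eqVlt; apply/orP; left; apply/eqP.
  by apply: (nuE (x n m) (x n m.+1)); rewrite ?xlb//; exact: ltW.
have lenB n m : (m <= n.+1)%N ->
    ((\sum_(0 <= k < m | G n k) (x n k.+1 - x n k))%:E <=
       mu (U `&` `]a, x n m]%classic))%E.
  elim: m => [|m ih] mn; first by rewrite big_nil measure_ge0.
  rewrite big_mkcond big_nat_recr//= -big_mkcond/= EFinD.
  have -> : U `&` `]a, x n m.+1]%classic =
     (U `&` `]a, x n m]%classic) `|` (U `&` C n m).
    rewrite -setIUr; congr (_ `&` _).
    by rewrite -itv_bndbnd_setU ?bnd_simp// ltW.
  rewrite measureU; [|exact: measurableI|exact: measurableI|]; last first.
    rewrite setIACA setIid [X in _ `&` X](_ : _ = set0) ?setI0//.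
    rewrite -subset0 => z []; rewrite /C /= !in_itv/= => /andP[_ h] /andP[].
    by rewrite ltNge h.
  apply: leeD; first by apply: ih; exact: ltnW.
  case: ifPn => [/asboolP CU|_]; last by rewrite measure_ge0.
  rewrite setIidr//.
  have e : mu (C n m) = (x n m.+1 - x n m)%:E.
    by rewrite /C lebesgue_measure_itv/= lte_fin xS.
  by rewrite le_eqVlt; apply/orP; left; apply/eqP; exact: esym e.
have nuBe n : (nu (B n n.+1) <= eps%:E)%E.
  apply: le_trans (nuB _ _ (leqnn _)) _; rewrite lee_fin.
  pose l := [seq (x n k, x n k.+1) | k <- index_iota 0 n.+1 & G n k].
  have lD (f : R * R -> R) :
      \sum_(p <- l) f p = \sum_(0 <= k < n.+1 | G n k) f (x n k, x n k.+1).
    by rewrite big_map big_filter.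
  have := ac l; rewrite !lD => /(_ _ _ _)/ltW H.
  apply: le_trans (H _ _ _).
  - apply: ler_sum => k _; exact: ler_norm.
  - by apply: nonoverlap_grid => //; rewrite x0.
  - apply/allP => p /mapP[k]; rewrite mem_filter mem_index_iota => /andP[_ kn] ->.
    exact: xlb.
  - rewrite -lte_fin; apply: le_lt_trans (lenB _ _ (leqnn _)) _.
    apply: le_lt_trans muU; apply: le_measure; rewrite ?inE//; exact: measurableI.
(* The grids are not nested, so [B n n.+1] need not be monotone in n; the points kept by every grid
   from n on do form a nondecreasing sequence. *)
pose A n : set R := \bigcap_(m in [set m | (n <= m)%N]) B m m.+1.
have mA n : measurable (A n : set (measurableTypeR R)).
  by apply: bigcap_measurable => //; exists n => /=.
have UA : U `&` `]a, b]%classic `<=` \bigcup_n A n.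
  move=> z [Uz]; rewrite /= in_itv/= => /andP[az zb].
  have [r /= r0 rU] : exists2 r : R, 0 < r & ball z r `<=` U.
    by have /(_ _ Uz) := oU; rewrite -nbhs_ballE => -[r r0 h]; exists r.
  have [N hN] : exists N : nat, (b - a) / r < N%:R.
    by exists (Num.truncn ((b - a) / r)).+1; exact: truncnS_gt.
  exists N => // n /= Nn.
  have cellr : (b - a) / n.+1%:R < r.
    rewrite ltr_pdivrMr// mulrC -ltr_pdivrMr//; apply: lt_le_trans hN _.
    by rewrite ler_nat (leq_trans Nn).
  have ex : exists k, z <= x n k.+1 by exists n; rewrite xb.
  have kz := ex_minnP ex; case: kz => k zk kmin.
  have kn : (k < n.+1)%N by rewrite ltnS; apply: kmin; rewrite xb.
  have xkz : x n k < z.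
    case: k zk kmin {kn} => [|k] zk kmin; first by rewrite x0.
    by rewrite ltNge; apply/negP => /kmin; rewrite ltnn.
  rewrite /B -bigcup_seq_cond; exists k; last by rewrite /C/= in_itv/= xkz.
  rewrite /= mem_index_iota kn; apply/asboolP => y; rewrite /C /= in_itv/= => /andP[xy yx].
  apply: rU; rewrite /ball/= ltr_norml.
  have := xSd n k; move: cellr xkz zk xy yx.
  move: (x n k) (x n k.+1) (_ / _) => p q d; lra.
have ndA : {homo A : n m / (n <= m)%N >-> (n <= m)%O}.
  move=> n m nm; apply/subsetPset => z Az k /= mk; apply: Az => /=.
  exact: leq_trans mk.
have nuA : (nu (\bigcup_n A n) <= eps%:E)%E.
  have mAU : measurable (\bigcup_n A n : set (measurableTypeR R)) by exact: bigcupT_measurable.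
  have cv := nondecreasing_cvg_mu (mu := nu) mA mAU ndA.
  rewrite -(cvg_lim _ cv)//; apply: lime_le; first by apply/cvg_ex; eexists; exact: cv.
  apply: nearW => n /=; apply: le_trans (nuBe n).
  by apply: le_measure; rewrite ?inE//; apply: bigcap_inf => /=.
apply: le_trans nuA; apply: le_measure; rewrite ?inE//; first exact: measurableI.
exact: bigcupT_measurable.
Qed.

(** Precomposing with the clamp, which is 1-Lipschitz, extends W from [a, b] to the whole line, as
    the construction of a Stieltjes measure requires. *)
Lemma abs_cont_clamp_continuous (a b : R) (W : R -> R) : a <= b ->
  abs_cont a b W -> continuous (fun t => W (Num.max a (Num.min b t))).
Proof.
move=> ab ac; set cl := fun t => Num.max a (Num.min b t).
have cla t : a <= cl t by rewrite /cl le_max lexx.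
have clb t : cl t <= b by rewrite /cl ge_max ab ge_min lexx.
have cl_le s t : s <= t -> cl s <= cl t.
  move=> st; rewrite /cl ge_max !le_max lexx /=; apply/orP; right.
  by rewrite le_min !ge_min lexx /= st orbT.
have cl1 s t : s <= t -> cl t - cl s <= t - s.
  move=> st; rewrite /cl; case: (leP b s) => bs; case: (leP b t) => bt;
    case: (leP a b) => ?; case: (leP a s) => ?; case: (leP a t) => ?; lra.
move=> x; apply/cvgrPdist_lt => e e0.
have [d d0 H] := ac _ e0.
have dist s t : s <= t -> t - s < d -> `|W (cl t) - W (cl s)| < e.
  move=> st std; have := cl_le _ _ st; rewrite le_eqVlt => /predU1P[->|clst].
    by rewrite subrr normr0.
  have := H [:: (cl s, cl t)]; rewrite /= !big_cons !big_nil /= !addr0; apply => //.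
  - by rewrite cla clst.
  - by rewrite clb.
  - exact: le_lt_trans (cl1 _ _ st) std.
near=> y.
have : `|x - y| < d by near: y; exact: (nbhsx_ballx x d d0).
move=> xy; have [h|h] := leP x y.
  by rewrite distrC; apply: dist => //; move: xy; rewrite ltr_norml => /andP[]; lra.
by apply: dist (ltW h) _; move: xy; rewrite ltr_norml => /andP[]; lra.
Unshelve. all: by end_near. Qed.

(** Radon-Nikodym for the Stieltjes measure of W: outer regularity covers a null set by an open set
    of small length, and the bound on open sets makes its Stieltjes measure small. *)
Lemma nondecreasing_abs_cont_density (W : R -> R) (a b : R) : a < b ->
  {in `[a, b] &, {homo W : s t / s <= t}} -> abs_cont a b W ->
  exists h : R -> R, mu.-integrable [set: R] (EFin \o h) /\
    forall t, a <= t <= b -> W t - W a = sint a t h.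
Proof.
move=> ab ndW ac.
pose cl t := Num.max a (Num.min b t).
pose W' t := W (cl t).
have cla t : a <= cl t by rewrite /cl le_max lexx.
have clb t : cl t <= b by rewrite /cl ge_max (ltW ab) ge_min lexx.
have cl_le s t : s <= t -> cl s <= cl t.
  move=> st; rewrite /cl ge_max !le_max lexx /=; apply/orP; right.
  by rewrite le_min !ge_min lexx /= st orbT.
have clE t : a <= t -> t <= b -> cl t = t.
  by move=> at_ tb; rewrite /cl min_r// max_r.
have nd : nondecreasing W'.
  by move=> s t st; apply: ndW; rewrite ?in_itv/= ?cla ?clb//; exact: cl_le.
have rc : forall x, W' @ at_right x --> W' x.
  by apply: right_continuousW; exact: (abs_cont_clamp_continuous (ltW ab)).
pose c : cumulative R R := HB.pack W' (@isCumulative.Build R _ R W' nd rc).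
pose nu := lebesgue_stieltjes_measure c.
have nuE' s t : s <= t -> nu `]s, t]%classic = (W' t - W' s)%:E.
  move=> st; rewrite /nu /lebesgue_stieltjes_measure /measure_extension.
  rewrite measurable_mu_extE/=; last exact: is_ocitv.
  by rewrite wlength_itv_bnd.
have nuE s t : a <= s -> s <= t -> t <= b -> nu `]s, t]%classic = (W t - W s)%:E.
  move=> as_ st tb; rewrite nuE'// /W' !clE//.
  - exact: le_trans tb.
  - exact: le_trans st.
have mD : measurable (`]a, b]%classic : set (measurableTypeR R)) by exact: measurable_itv.
have nuD : (nu `]a, b]%classic < +oo)%E by rewrite nuE ?ltry// ltW.
pose nu0 : {finite_measure set (measurableTypeR R) -> \bar R} := mfrestr mD nuD.
have dom : nu0 `<< mu.
  apply/null_content_dominatesP => A mA muA.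
  suff : (nu0 A <= 0)%E by move=> h; apply/eqP; rewrite eq_le h measure_ge0.
  apply/lee_addgt0Pr => e e0; rewrite add0e.
  have [d d0 H] := ac _ e0.
  have [|U [oU AU muUA]] := @lebesgue_regularity_outer R A d mA _ d0.
    by rewrite [X in (X < _)%E](_ : _ = 0%E)// ltry.
  have mU : measurable (U : set (measurableTypeR R)) by exact: open_measurable.
  have muU : (mu U < d%:E)%E.
    apply: le_lt_trans muUA.
    rewrite -{1}(setDUK AU).
    apply: le_trans (measureU2 _ _ _) _ => //; first exact: measurableD.
    by rewrite [X in (X + _)%E](_ : _ = 0%E)// add0e.
  apply: le_trans (open_abs_cont_bound (nu := nu) ab nuE ndW H oU muU).
  by rewrite /nu0 /= /mfrestr /mrestr; apply: le_measure; rewrite ?inE;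
    (exact: measurableI || exact: setSI).
have [f [f0 ffin fi fE]] := radon_nikodym_sigma_finite dom.
exists (fine \o f).
have fh : EFin \o (fine \o f) = f.
  by apply/funext => x /=; rewrite fineK.
split; first by rewrite fh.
move=> t /andP[at_ tb]; apply: EFin_inj.
have fia : sintegrable a t (fine \o f).
  by rewrite /sintegrable fh; exact: integrableS fi.
rewrite -sintE// -(@integral_itv_obnd_cbnd _ a (BRight t)); last first.
  have /measurable_int := fia; apply: measurable_funS => //.
  exact: subset_itv_oc_cc.
under eq_integral do rewrite /= fineK//.
rewrite -fE// -nuE//.
rewrite /nu0 /= /mfrestr /mrestr; congr (nu _).
by rewrite setIidl//; apply: subset_itv; rewrite bnd_simp.
Qed.

End AbsolutelyContinuousMonotone.

Section AbsolutelyContinuous.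
Variable R : realType.
Notation mu := (@lebesgue_measure R).
Notation TV := (@total_variation R).
Implicit Types (a b : R) (g : R -> R).

Lemma nonoverlap_le (u v : R) l : u <= v -> nonoverlap v l -> nonoverlap u l.
Proof. by case: l => //= -[p q] l uv /andP[/andP[vp ->] ->]; rewrite (le_trans uv vp). Qed.

Lemma nonoverlap_partition (u : R) (s : seq R) l : path <%R u s ->
  nonoverlap (last u s) l -> nonoverlap u (zip (u :: s) s ++ l).
Proof. by elim: s u => //= v s ih u /andP[-> vs] h /=; rewrite lexx ih. Qed.

Lemma partition_bound (u b : R) (s : seq R) : path <%R u s -> last u s <= b ->
  all (fun p => p.2 <= b) (zip (u :: s) s).
Proof.
elim: s u => //= v s ih u /andP[uv vs] h; rewrite ih// andbT.
apply: le_trans h; have : itv_partition v (last v s) s by split.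
exact: itv_partition_le.
Qed.

Lemma partition_length (u : R) (s : seq R) :
  \sum_(p <- zip (u :: s) s) (p.2 - p.1) = last u s - u.
Proof.
by elim: s u => [u|v s ih u] /=; rewrite ?big_nil ?subrr// big_cons ih /=; ring.
Qed.

Lemma variation_partition g a b (s : seq R) : itv_partition a b s ->
  variation a b g s = \sum_(p <- zip (a :: s) s) `|g p.2 - g p.1|.
Proof.
move=> abs; rewrite variation_zip// {abs b}; elim: s a => [a|v s ih a].
  by rewrite !big_nil.
by rewrite /= !big_cons ih.
Qed.

Lemma abs_cont_sub a b s t g : abs_cont a b g -> a <= s -> t <= b -> abs_cont s t g.
Proof.
move=> ac as_ tb e e0; have [d d0 H] := ac _ e0; exists d => // l nl lb.
apply: H; first exact: nonoverlap_le nl.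
by apply: sub_all lb => p /= h; exact: le_trans tb.
Qed.

(** An interval shorter than the delta that belongs to eps = 1 has variation at most 1, and finitely
    many steps of length delta / 2 reach b. *)
Lemma abs_cont_bounded_variation a b g : a <= b -> abs_cont a b g ->
  bounded_variation a b g.
Proof.
move=> ab ac; have [d d0 H] := ac _ ltr01.
have short s t : a <= s -> s <= t -> t <= b -> t - s < d -> (TV s t g < +oo)%E.
  move=> as_ st tb std; apply: (@le_lt_trans _ _ 1%E); last exact: ltry.
  apply: ge_ereal_sup => _ [_ [l pl <-] <-]; rewrite lee_fin variation_partition//.
  have [pa /eqP la] := pl.
  apply: ltW; apply: H.
  - apply: nonoverlap_le as_ _; rewrite -[zip _ _]cats0.
    by apply: nonoverlap_partition.
  - by apply: partition_bound; rewrite // la.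
  - by rewrite partition_length la.
have [N hN] : exists N : nat, (b - a) / (d / 2) < N%:R.
  by exists (Num.truncn ((b - a) / (d / 2))).+1; exact: truncnS_gt.
have d20 : 0 < d / 2 by rewrite divr_gt0.
have P k t : a <= t -> t <= b -> t - a <= k%:R * (d / 2) -> (TV a t g < +oo)%E.
  elim: k t => [|k ih] t at_ tb tk.
    have -> : t = a by move: tk; rewrite mul0r; lra.
    by rewrite total_variationxx ltry.
  have [h|h] := leP (t - a) (k%:R * (d / 2)); first exact: ih.
  set s := Num.max a (t - d / 2).
  have as_ : a <= s by rewrite le_max lexx.
  have st : s <= t by rewrite ge_max at_ /=; lra.
  have sk : s - a <= k%:R * (d / 2).
    have k0 : 0 <= k%:R * (d / 2) by rewrite mulr_ge0// ltW.
    move: tk; rewrite -natr1 mulrDl mul1r /s; case: (leP a (t - d / 2)); lra.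
  have ts : t - s < d by rewrite /s; case: (leP a (t - d / 2)) => ?; lra.
  rewrite (total_variationD _ as_ st); apply: lte_add_pinfty.
    by apply: ih => //; exact: le_trans tb.
  exact: short.
apply/bounded_variationP => //; rewrite ge0_fin_numE ?total_variation_ge0//.
apply: (P N) => //; rewrite -ler_pdivrMr//; exact: ltW.
Qed.

Section VariationDensity.
Variables (a b : R) (g : R -> R).
Hypotheses (ab : a < b) (ac : abs_cont a b g).

Let bv : bounded_variation a b g := abs_cont_bounded_variation (ltW ab) ac.

Let V t := fine (TV a t g).

Let TVfin s t : a <= s -> s <= t -> t <= b -> TV s t g \is a fin_num.
Proof.
move=> as_ st tb; apply/bounded_variationP => //.
apply: (@bounded_variationr _ a) => //.
apply: (@bounded_variationl _ a _ b) => //; exact: le_trans st.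
Qed.

Let VB s t : a <= s -> s <= t -> t <= b -> V t - V s = fine (TV s t g).
Proof.
move=> as_ st tb; rewrite /V (total_variationD _ as_ st) fineD ?TVfin//.
  by rewrite addrC addKr.
exact: le_trans tb.
Qed.

Let dist_le s t : a <= s -> s <= t -> t <= b -> `|g t - g s| <= V t - V s.
Proof.
by move=> as_ st tb; rewrite VB// -lee_fin fineK ?TVfin// total_variation_ge.
Qed.

(** Replacing each interval by a fine partition of it keeps the total length, so the delta of g also
    serves for its variation function. The tolerance eta is halved at each element of the list. *)
Let refine l u eta : 0 < eta -> a <= u -> nonoverlap u l ->
  all (fun p => p.2 <= b) l ->
  exists l', [/\ nonoverlap u l', all (fun p => p.2 <= b) l',
    \sum_(p <- l') (p.2 - p.1) = \sum_(p <- l) (p.2 - p.1) &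
    \sum_(p <- l) (V p.2 - V p.1) <= \sum_(p <- l') `|g p.2 - g p.1| + eta].
Proof.
elim: l u eta => [|[p q] l ih] u eta eta0 au.
  by exists [::]; rewrite !big_nil add0r; split => //; exact: ltW.
move=> /= /andP[/andP[up pq] nl] /andP[qb lb].
have eta2 : 0 < eta / 2 by rewrite divr_gt0.
have ap : a <= p by exact: le_trans up.
have [l' [nl' lb' len var]] := ih q _ eta2 (le_trans ap (ltW pq)) nl lb.
have fin := TVfin ap (ltW pq) qb.
have [_ [_ [s ps <-] <-]] := ub_ereal_sup_adherent eta2 fin.
rewrite -/(TV p q g) => sv.
have [pa /eqP la] := ps.
exists (zip (p :: s) s ++ l'); split.
- by apply: nonoverlap_le up _; apply: nonoverlap_partition; rewrite // la.
- by rewrite all_cat lb' andbT; apply: partition_bound; rewrite // la.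
- by rewrite big_cat big_cons /= len partition_length la.
- rewrite big_cat big_cons /= VB// ?ltW//.
  move: sv; rewrite variation_partition// -(fineK fin) -EFinB lte_fin.
  by move: var; lra.
Qed.

Let abs_contV : abs_cont a b V.
Proof.
move=> e e0; have e2 : 0 < e / 2 by rewrite divr_gt0.
have [d d0 H] := ac e2; exists d => // l nl lb ld.
have [l' [nl' lb' len var]] := refine e2 (lexx a) nl lb.
have := H l' nl' lb'; rewrite len => /(_ ld) h.
have gen k u : a <= u -> nonoverlap u k -> all (fun p => p.2 <= b) k ->
    \sum_(p <- k) `|V p.2 - V p.1| = \sum_(p <- k) (V p.2 - V p.1).
  elim: k u => [|[p q] k ihk] u au; first by rewrite !big_nil.
  move=> /= /andP[/andP[up pq] nk] /andP[qb kb]; rewrite !big_cons /=.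
  have ap : a <= p by exact: le_trans up.
  rewrite (ihk q)//; last exact: le_trans (ltW pq).
  by rewrite ger0_norm// (le_trans _ (dist_le ap (ltW pq) qb)).
rewrite (gen _ a)//.
lra.
Qed.

(** Jordan decomposition g = V - (V - g): both terms are nondecreasing and absolutely continuous,
    which reduces the claim to monotone functions. *)
Lemma abs_cont_density_global : exists h : R -> R,
  mu.-integrable [set: R] (EFin \o h) /\
    forall t, a <= t <= b -> g t - g a = sint a t h.
Proof.
have ndV : {in `[a, b] &, {homo V : s t / s <= t}}.
  move=> s t; rewrite !in_itv/= => /andP[as_ sb] /andP[at_ tb] st.
  by rewrite -subr_ge0 (le_trans _ (dist_le as_ st tb)).
have ndW : {in `[a, b] &, {homo (fun t => V t - g t) : s t / s <= t}}.
  move=> s t; rewrite !in_itv/= => /andP[as_ sb] /andP[at_ tb] st.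
  by have := dist_le as_ st tb; rewrite ler_norml => /andP[]; lra.
have acW : abs_cont a b (fun t => V t - g t).
  move=> e e0; have e2 : 0 < e / 2 by rewrite divr_gt0.
  have [d d0 H] := ac e2; have [d' d'0 H'] := abs_contV e2.
  exists (Num.min d d'); first by rewrite lt_min d0.
  move=> l nl lb; rewrite lt_min => /andP[ld ld'].
  have := H l nl lb ld; have := H' l nl lb ld'.
  suff : \sum_(p <- l) `|V p.2 - g p.2 - (V p.1 - g p.1)| <=
      \sum_(p <- l) `|V p.2 - V p.1| + \sum_(p <- l) `|g p.2 - g p.1| by lra.
  rewrite -big_split /=; apply: ler_sum => p _.
  have -> : V p.2 - g p.2 - (V p.1 - g p.1) = (V p.2 - V p.1) - (g p.2 - g p.1) by ring.
  exact: ler_normB.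
have [h [hi hE]] := nondecreasing_abs_cont_density ab ndV abs_contV.
have [k [ki kE]] := nondecreasing_abs_cont_density ab ndW acW.
exists (fun x => h x - k x); split; first exact: (integrableB _ hi ki).
move=> t abt; rewrite sintB; [|exact: integrableS hi|exact: integrableS ki].
by rewrite -hE// -kE//; ring.
Qed.

End VariationDensity.
Import HBNNSimple.

(* [derive1 g] is not assumed measurable: only simple functions below it matter. *)
Lemma integral_ae_eq_nonmeasurable (D : set R) (f h : R -> R) (N : set R) :
  measurable (D : set (measurableTypeR R)) ->
  measurable (N : set (measurableTypeR R)) -> mu N = 0%E ->
  (forall x, 0 <= f x) -> (forall x, 0 <= h x) -> measurable_fun [set: R] h ->
  (forall x, D x -> ~ N x -> f x = h x) ->
  (\int[mu]_(x in D) (f x)%:E = \int[mu]_(x in D) (h x)%:E)%E.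
Proof.
move=> mD mN muN f0 h0 mh fh.
have mh' (A : set R) : measurable_fun (A : set (measurableTypeR R)) (EFin \o h).
  by apply/measurable_EFinP; exact: measurable_funS mh.
rewrite [RHS](ge0_negligible_integral mN)//; last by move=> x _; rewrite /= lee_fin.
rewrite [LHS]integral_mkcond [RHS]integral_mkcond.
rewrite [LHS]ge0_integralTE; last by move=> x; apply: erestrict_ge0 => // y _; rewrite /= lee_fin.
rewrite [RHS]ge0_integralTE; last by move=> x; apply: erestrict_ge0 => // y _; rewrite /= lee_fin.
apply/eqP; rewrite eq_le; apply/andP; split; last first.
  apply: ereal_sup_le => _ [p /= ph <-]; exists p => //= x; apply: le_trans (ph x) _.
  rewrite !patchE; case: ifPn => [|_]; last first.
    by case: ifP => _; rewrite ?lee_fin.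
  by rewrite inE => -[Dx Nx]; rewrite mem_set// fh.
apply: ge_ereal_sup => _ [p /= pf <-].
rewrite -integralT_nnsfun.
have mp := @measurable_funPT _ _ _ _ p.
rewrite (ge0_negligible_integral mN)//; last 2 first.
- exact/measurable_EFinP.
- by move=> x _; rewrite /= lee_fin.
rewrite -ge0_integralTE; last by move=> x; apply: erestrict_ge0 => // y _; rewrite /= lee_fin.
have mDN : measurable (D `\` N : set (measurableTypeR R)) by exact: measurableD.
have mr : measurable_fun [set: measurableTypeR R] ((EFin \o h) \_ (D `\` N)).
  exact: (iffLR (measurable_restrictT _ mDN) (mh' _)).
apply: (@le_trans _ _ (\int[mu]_(x in [set: R] `\` N) ((EFin \o h) \_ (D `\` N)) x)%E).
  apply: ge0_le_integral => //.
  - exact: measurableD.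
  - by move=> x _; rewrite /= lee_fin.
  - by apply/measurable_EFinP; exact: measurable_funS mp.
  - exact: measurable_funS mr.
  - move=> x [_ Nx]; apply: le_trans (pf x) _; rewrite !patchE.
    have [|Dx] := boolP (x \in D).
      by rewrite inE => Dx; rewrite mem_set//= fh.
    by case: ifP => //= _; rewrite lee_fin.
apply: ge0_subset_integral => //; first exact: measurableD.
by move=> x _; apply: erestrict_ge0 => y _; rewrite /= lee_fin.
Qed.

Lemma derive1_near_shift (g G : R -> R) (k x : R) :
  (\forall y \near x, G y = g y - k) -> derive1 g x = derive1 G x.
Proof.
move=> gG; rewrite !derive1E.
have -> : 'D_1 G x = 'D_1 (fun y => g y - k) x by apply: near_eq_derive.
rewrite /derive.
suff -> : (fun h => h^-1 *: (((fun y => g y - k) \o shift x) (h *: 1) - (g x - k)))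
    = (fun h => h^-1 *: ((g \o shift x) (h *: 1) - g x)) by [].
by apply/funext => h /=; congr (_ *: _); ring.
Qed.

(** [energy] integrates the pointwise derivative, while h is only a density. Lebesgue
    differentiation identifies the two outside a null set, to which a and b are added because
    [derive1] also sees the values of g outside [a, b]. *)
Lemma abs_cont_density a b g : a < b -> abs_cont a b g ->
  exists h : R -> R, [/\ measurable_fun [set: R] h,
    sintegrable a b h,
    forall s t, a <= s -> s <= t -> t <= b -> g t - g s = sint s t h &
    forall s t, a <= s -> s <= t -> t <= b ->
     energy g s t = (\int[mu]_(x in `[s, t]) (h x ^+ 2)%:E)%E].
Proof.
move=> ab ac; have [h [hi hE]] := abs_cont_density_global ab ac.
have mh : measurable_fun [set: R] h.
  by have /measurable_int/measurable_EFinP := hi.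
have hab s t : sintegrable s t h by exact: integrableS hi.
have gE s t : a <= s -> s <= t -> t <= b -> g t - g s = sint s t h.
  move=> as_ st tb.
  have e1 := hE t; have e2 := hE s.
  rewrite (sint_cat (u := s)) // in e1.
  have := e1 (introT andP (conj (le_trans as_ st) tb)).
  have := e2 (introT andP (conj as_ (le_trans st tb))).
  lra.
exists h; split => // s t as_ st tb.
rewrite /energy asboolT; last exact: abs_cont_sub as_ tb.
have lh : locally_integrable [set: R] h.
  by apply: open_integrable_locally => //; exact: openT.
have := @FTC1 R h (BLeft a) (fun y => hab a y) lh.
move=> [N [mN muN subN]].
have mN' : measurable (N `|` [set a; b] : set (measurableTypeR R)).
  by apply: measurableU => //; exact: measurableU.
apply: (integral_ae_eq_nonmeasurable (N := N `|` [set a; b])) => //.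
- apply/eqP; rewrite eq_le measure_ge0 andbT.
  apply: le_trans (measureU2 _ _ _) _ => //; first exact: measurableU.
  rewrite [X in (X + _)%E](_ : _ = 0%E)// add0e.
  apply: le_trans (measureU2 _ _ _) _ => //.
  rewrite [X in (X + _)%E](_ : _ = 0%E); last exact: lebesgue_measure_set1.
  by rewrite [X in (_ + X)%E](_ : _ = 0%E) ?adde0//; exact: lebesgue_measure_set1.
- by move=> x; exact: sqr_ge0.
- by move=> x; exact: sqr_ge0.
- exact: measurable_funX.
move=> x /=; rewrite in_itv/= => /andP[sx xt] Nx.
congr (_ ^+ 2).
have ax : a < x.
  rewrite lt_neqAle (le_trans as_ sx) andbT; apply/eqP => e; apply: Nx.
  by right; left.
have xb : x < b.
  rewrite lt_neqAle (le_trans xt tb) andbT; apply/eqP => e; apply: Nx.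
  by right; right.
have [dF FE] : derivable (fun x => sint a x h) x 1 /\ derive1 (fun x => sint a x h) x = h x.
  apply: contrapT => H; apply: Nx; left; apply: subN => /= H'; apply: H; apply: H'.
  by rewrite lte_fin.
rewrite -FE.
rewrite (derive1_near_shift (G := fun y => sint a y h) (k := g a)) //.
near=> y; rewrite gE//.
- by apply: ltW; near: y; exact: (lt_nbhsr ax).
- by near: y; exact: (lt_le_nbhsl xb).
Unshelve. all: by end_near. Qed.

End AbsolutelyContinuous.

(** * Integration by parts through Fubini *)

Section IntegrationByParts.
Variable R : realType.
Notation mu := (@lebesgue_measure R).
Notation mfun f := (measurable_fun [set: R] f).
Local Notation M := (measurableTypeR R).

(** Both sides are the integral of f(t) k(u) over the triangle a <= t <= u <= b. The bound on k
    supplies the absolute integrability that Fubini asks for. *)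
Lemma sint_mul_tail (a b C : R) (f k : R -> R) : a <= b -> mfun f -> mfun k ->
  sintegrable a b f -> (forall x, `|k x| <= C) ->
  sintegrable a b (fun t => f t * sint t b k) /\
  sintegrable a b (fun u => k u * sint a u f) /\
  sint a b (fun t => f t * sint t b k) = sint a b (fun u => k u * sint a u f).
Proof.
move=> ab mf mk fi kC.
have C0 : 0 <= C by exact: le_trans (normr_ge0 _) (kC 0).
have ki s t : sintegrable s t k.
  by apply: (sintegrable_le mk (sintegrable_cst s t C)) => x _.
pose A : set (M * M) := [set p | (a <= p.1 <= p.2) && (p.2 <= b)].
pose F (p : M * M) : \bar R := if (a <= p.1 <= p.2) && (p.2 <= b)
  then (f p.1 * k p.2)%:E else 0%E.
have m1 : measurable_fun [set: M * M] (fun p : M * M => p.1 : R) by exact: measurable_fst.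
have m2 : measurable_fun [set: M * M] (fun p : M * M => p.2 : R) by exact: measurable_snd.
have mF : measurable_fun [set: M * M] F.
  apply: measurable_fun_ifT.
  - apply: measurable_and; first apply: measurable_and.
    + exact: (measurable_fun_ler (measurable_cst a) m1).
    + exact: (measurable_fun_ler m1 m2).
    + exact: (measurable_fun_ler m2 (measurable_cst b)).
  - apply/measurable_EFinP; apply: measurable_funM.
    + exact: (measurableT_comp mf m1).
    + exact: (measurableT_comp mk m2).
  - exact: measurable_cst.
have in1 t : (\int[mu]_u F (t, u))%E =
    (((fun t => (f t * sint t b k)%:E) : R -> \bar R) \_ `[a, b]) t.
  rewrite patchE; case: ifPn => [|nt].
    rewrite inE/= in_itv/= => /andP[at_ tb].
    rewrite -sintZ// -sintE; last exact: sintegrableZ.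
    rewrite [RHS]integral_mkcond; apply: eq_integral => u _.
    rewrite /F /= patchE at_ /=; case: ifPn => [h|h].
      by rewrite mem_set//= in_itv.
    by rewrite memNset//= in_itv/=; exact/negP.
  rewrite integral0_eq// => u _; rewrite /F /=; case: ifP => // /andP[/andP[at_ tu] ub].
  by move: nt; rewrite notin_setE/= in_itv/= at_ (le_trans tu ub).
have in2 u : (\int[mu]_t F (t, u))%E =
    (((fun u => (k u * sint a u f)%:E) : R -> \bar R) \_ `[a, b]) u.
  rewrite patchE; case: ifPn => [|nt].
    rewrite inE/= in_itv/= => /andP[au ub].
    have fia : sintegrable a u f by exact: sintegrable_sub fi _ _.
    rewrite -sintZ// -sintE; last exact: sintegrableZ.
    rewrite [RHS]integral_mkcond; apply: eq_integral => t _.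
    rewrite /F /= patchE ub andbT mulrC; case: ifPn => [h|h].
      by rewrite mem_set//= in_itv.
    by rewrite memNset//= in_itv/=; exact/negP.
  rewrite integral0_eq// => t _; rewrite /F /=; case: ifP => // /andP[/andP[at_ tu] ub].
  by move: nt; rewrite notin_setE/= in_itv/= ub (le_trans at_ tu).
have Fi : (mu \x mu)%E.-integrable [set: M * M] F.
  apply/integrable12ltyP => //.
  have gi : mu.-integrable `[a, b] (EFin \o (fun t => (C * (b - a)) * `|f t|)).
    apply: sintegrableZ; exact: integrable_norm fi.
  apply: (@le_lt_trans _ _ (\int[mu]_(t in `[a, b]) ((C * (b - a)) * `|f t|)%:E)%E); last first.
    by rewrite (sintE gi) ltry.
  rewrite [leRHS]integral_mkcond; apply: ge0_le_integral => //.
  - by move=> t _; exact: integral_ge0.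
  - apply: (measurable_fun_fubini_tonelli_F (m2 := mu) (fun p => `|F p|%E)) => //.
    exact: measurableT_comp.
  - apply/(measurable_restrictT _ _).1 => //; exact: (measurable_int mu).
  - move=> t _; rewrite patchE; case: ifPn => [|nt].
      rewrite inE/= in_itv/= => /andP[at_ tb].
      apply: (@le_trans _ _ (\int[mu]_(u in `[a, b]) (C * `|f t|)%:E)%E).
        rewrite [leRHS]integral_mkcond; apply: ge0_le_integral => //.
        - apply: measurableT_comp => //; apply: (measurableT_comp mF).
          exact: measurable_pair1.
        - apply/(measurable_restrictT _ _).1 => //.
        - move=> u _; rewrite patchE /F /=; case: ifP => [/andP[/andP[h1 h2] h3]|_].
            rewrite mem_set /=; last by rewrite in_itv/= (le_trans h1 h2).
            by rewrite lee_fin normrM mulrC ler_wpM2r.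
          by rewrite abse0; case: ifP => //= _; rewrite lee_fin mulr_ge0.
      rewrite (sintE (sintegrable_cst a b _)) lee_fin sint_cst//; lra.
    rewrite integral0_eq// => u _; rewrite /F /=; case: ifP; last by rewrite abse0.
    move=> /andP[/andP[at_ tu] ub].
    by move: nt; rewrite notin_setE/= in_itv/= at_ (le_trans tu ub).
have i1 : mu.-integrable `[a, b] (fun t => (f t * sint t b k)%:E).
  have : mu.-integrable [set: M] (fun t => \int[mu]_u F (t, u))%E by exact: integrable_fubini_F Fi.
  rewrite (funext in1) => h.
  by rewrite -(setTI `[a, b]%classic); apply/integrable_restrict.
have i2 : mu.-integrable `[a, b] (fun u => (k u * sint a u f)%:E).
  have : measurable_fun [set: M] (fun u => \int[mu]_t F (t, u))%E by exact: measurable_fubini_G Fi.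
  rewrite (funext in2) => h.
  have nfi : sintegrable a b (fun x => `|f x|) by exact: integrable_norm fi.
  apply: (le_integrable _ _ _ (sintegrable_cst a b (C * sint a b (fun x => `|f x|)))) => //.
    exact: (iffRL (measurable_restrictT _ _) h).
  move=> u; rewrite /= in_itv/= => /andP[au ub].
  rewrite lee_fin normrM (le_trans _ (ler_norm _))// ler_pM//.
  apply: le_trans (le_normr_Rintegral _ _) _ => //; first exact: sintegrable_sub fi _ _.
  rewrite [leRHS](sint_cat (u := u))// lerDl; apply: sint_ge0 => //.
  exact: sintegrable_sub nfi _ _.
split=> //; split=> //; apply: EFin_inj.
rewrite -(sintE i1) -(sintE i2) integral_mkcond [RHS]integral_mkcond.
by under eq_integral do rewrite -in1; under [RHS]eq_integral do rewrite -in2; exact: Fubini.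
Qed.

End IntegrationByParts.

(** * Trajectories and collected mass *)

Section PowerThreeHalves.
Variable R : realType.

Lemma powR32E (r : R) : 0 <= r -> r `^ (3 / 2) = Num.sqrt r ^+ 3.
Proof.
move=> r0; rewrite -powR12_sqrt// -powR_mulrn ?powR_ge0// -powRrM.
by congr (_ `^ _); lra.
Qed.

(** If r > m, then r = r^(3/2) / sqrt r <= r^(3/2) / sqrt m. A finite 3/2-mass thus controls plain
    integrals, and for large m its own contribution becomes arbitrarily small. *)
Lemma le_powR32 (m r : R) : 0 < m -> 0 <= r -> r <= m + r `^ (3 / 2) / Num.sqrt m.
Proof.
move=> m0 r0; have sm : 0 < Num.sqrt m by rewrite sqrtr_gt0.
rewrite powR32E// -{1}(sqr_sqrtr r0) -{1}(sqr_sqrtr (ltW m0)).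
have := sqrtr_ge0 r; move: sm; move: (Num.sqrt m) (Num.sqrt r) => p q p0 q0.
rewrite -(ler_pM2r p0) mulrDl divfK ?gt_eqF//.
have [qp|pq] := leP q p.
  have : q ^+ 2 * p <= p ^+ 2 * p.
    by rewrite ler_pM2r// ler_sqr// nnegrE; exact: ltW.
  have : 0 <= q ^+ 3 by rewrite exprn_ge0.
  lra.
have : q ^+ 2 * p <= q ^+ 3.
  by rewrite [leRHS]exprS mulrC ler_wpM2r ?sqr_ge0//; exact: ltW.
have : 0 <= p ^+ 2 * p by rewrite mulr_ge0 ?sqr_ge0//; exact: ltW.
lra.
Qed.

End PowerThreeHalves.

Section Trajectories.
Variable R : realType.
Notation mfun f := (measurable_fun [set: R] f).
Variables (lo hi : nat -> R) (g rho : nat -> R -> R).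

(* A label [i.+1] at time [x] means that the mass of the [i]-th planted curve is
   collected at that time; the label [0] means that no mass is collected. *)
Definition label_density (lab : R -> nat) (x : R) : R :=
  if lab x is i.+1 then rho i x else 0.

(** The velocity v is a chosen square-integrable density of c, not its derivative. On a planted
    piece its energy is tied to [energy (g i)], the quantity in [plant_metric]. Labels are
    prescribed only in the open interval, so that pieces can meet. *)
Definition piece (u w : R) (c v : R -> R) (lab : R -> nat) : Prop :=
  [/\ sintegrable u w (fun x => v x ^+ 2), c w - c u = sint u w v &
      (forall x, u < x < w -> lab x = 0%N) \/
      exists i, [/\ lo i <= u, w <= hi i, forall x, u <= x <= w -> c x = g i x,
        forall x, u < x < w -> lab x = i.+1 &
        energy (g i) u w = (sint u w (fun x => v x ^+ 2))%:E]].

Definition nodefree (l : seq R) (u w : R) := forall r, r \in l -> ~~ (u < r < w).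

(** The domain condition on labels holds at all times, also outside [s, t], so that a label can be
    integrated over the whole line against the total mass. Finitely many nodes are enough, the
    metric being a supremum that need not be attained. *)
Record traj (s t : R) (c v : R -> R) (lab : R -> nat) : Prop := Traj {
  traj_lt : s < t;
  traj_mv : mfun v;
  traj_mlab : forall i, measurable (lab @^-1` [set i]);
  traj_dom : forall x i, lab x = i.+1 -> lo i <= x <= hi i;
  traj_nodes : exists l, forall u w, s <= u -> u < w -> w <= t ->
    nodefree l u w -> piece u w c v lab }.

Definition gain (s t : R) (v : R -> R) (lab : R -> nat) : R :=
  sint s t (label_density lab) - sint s t (fun x => v x ^+ 2).

Hypothesis rhoD : forall i, density (rho i).

Lemma label_density_ge0 lab x : 0 <= label_density lab x.
Proof. by rewrite /label_density; case: (lab x) => // i; case: (rhoD i). Qed.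

Lemma measurable_label_density lab : (forall i, measurable (lab @^-1` [set i])) ->
  mfun (label_density lab).
Proof.
move=> ml _ Y mY; rewrite setTI.
rewrite (_ : _ @^-1` _ = \bigcup_i (lab @^-1` [set i] `&`
    (if i is j.+1 then rho j else fun=> 0) @^-1` Y)).
  apply: bigcupT_measurable => i; apply: measurableI => //.
  case: i => [|i]; first by rewrite -[X in measurable X]setTI; exact: measurable_cst.
  by rewrite -[X in measurable X]setTI; have [_] := rhoD i; exact.
apply/seteqP; split => x /=.
  by rewrite /label_density => H; exists (lab x) => //; split=> //=; case: (lab x) H.
by move=> [i _ /= [/= xi]]; rewrite /label_density xi; case: i xi.
Qed.

Lemma sqr_measurable (v : R -> R) : mfun v -> mfun (fun x => v x ^+ 2).
Proof. exact: measurable_funX. Qed.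

Lemma measurable_powR32 (f : R -> R) : mfun f -> mfun (fun x => f x `^ (3 / 2)).
Proof. by move=> mf; exact: (measurableT_comp (@measurable_powR R (3 / 2)) mf). Qed.

Lemma traj_sint s t c v lab : traj s t c v lab ->
  forall u w, s <= u -> u < w -> w <= t ->
  sintegrable u w (fun x => v x ^+ 2) /\ c w - c u = sint u w v.
Proof.
case=> st mv _ _ [l pl] u w su uw wt; have mv2 := sqr_measurable mv.
apply: (@interval_property_of_nodes R (fun u w => sintegrable u w (fun x => v x ^+ 2) /\
   c w - c u = sint u w v) s t l) => //.
  move=> {su uw wt u w} u r w su ur rw wt [i1 e1] [i2 e2].
  have i12 := sintegrable_cat mv2 i1 i2 (ltW ur) (ltW rw).
  split=> //; rewrite (sint_cat (u := r)) ?ltW//; first by rewrite -e1 -e2; ring.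
  exact: sintegrable_of_sqr.
by move=> {su uw wt u w} u w su uw wt nl; have [] := pl _ _ su uw wt nl.
Qed.

Lemma traj_sqr s t c v lab : traj s t c v lab -> sintegrable s t (fun x => v x ^+ 2).
Proof. by move=> T; have [] := traj_sint T (lexx s) (traj_lt T) (lexx t). Qed.

Lemma traj_v s t c v lab : traj s t c v lab -> sintegrable s t v.
Proof. by move=> T; apply: sintegrable_of_sqr (traj_sqr T); exact: traj_mv T. Qed.

Lemma traj_c s t c v lab : traj s t c v lab ->
  forall u w, s <= u -> u <= w -> w <= t -> c w - c u = sint u w v.
Proof.
move=> T u w su; rewrite le_eqVlt => /predU1P[<- _|uw wt].
  by rewrite subrr sint_pt.
by have [] := traj_sint T su uw wt.
Qed.

Lemma traj_dist s t c v lab : traj s t c v lab ->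
  (c t - c s) ^+ 2 / (t - s) <= sint s t (fun x => v x ^+ 2).
Proof.
move=> T; rewrite (traj_c T (lexx s) (ltW (traj_lt T)) (lexx t)).
by apply: sint_sqr_div_le; [exact: traj_lt T|exact: traj_v T|exact: traj_sqr T].
Qed.

Lemma traj_sub s t u w c v lab : traj s t c v lab -> s <= u -> u < w -> w <= t ->
  traj u w c v lab.
Proof.
case=> st mv ml dl [l pl] su uw wt; split => //; exists l => p q up pq qw.
by apply: pl => //; [exact: le_trans up|exact: le_trans wt].
Qed.

Lemma piece_eq u w c v lab c' v' lab' :
  (forall x, u <= x <= w -> c x = c' x) ->
  (forall x, u < x < w -> v x = v' x) -> (forall x, u < x < w -> lab x = lab' x) ->
  u < w -> mfun v -> piece u w c v lab -> piece u w c' v' lab'.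
Proof.
move=> cc vv ll uw mv [i1 e1 H].
have i2 : sintegrable u w v by exact: sintegrable_of_sqr.
have vv2 x : u < x < w -> v x ^+ 2 = v' x ^+ 2 by move=> /vv ->.
split.
- exact: sintegrable_eq vv2.
- by rewrite -!cc ?lexx ?ltW// (sint_eq i2 vv) in e1 *.
- case: H => [H|[i [h1 h2 h3 h4 h5]]]; [left|right; exists i; split] => //.
  + by move=> x ux; rewrite -ll// H.
  + by move=> x ux; rewrite -cc// h3.
  + by move=> x ux; rewrite -ll// h4.
  + by rewrite h5 (sint_eq i1 vv2).
Qed.

Definition glue (T : Type) (r : R) (f1 f2 : R -> T) (x : R) : T :=
  if x <= r then f1 x else f2 x.

Lemma traj_cat s r t c1 v1 lab1 c2 v2 lab2 :
  traj s r c1 v1 lab1 -> traj r t c2 v2 lab2 -> c1 r = c2 r ->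
  traj s t (glue r c1 c2) (glue r v1 v2) (glue r lab1 lab2).
Proof.
move=> T1 T2 cr; have [sr mv1 ml1 dl1 [l1 pl1]] := T1.
have [rt mv2 ml2 dl2 [l2 pl2]] := T2.
have mle : measurable_fun [set: R] (fun x => x <= r).
  by apply: measurable_fun_ler => //; exact: measurable_id.
split; first exact: lt_trans rt.
- exact: measurable_fun_ifT.
- move=> i; rewrite (_ : _ @^-1` _ = (`]-oo, r] `&` lab1 @^-1` [set i]) `|`
      (`]r, +oo[ `&` lab2 @^-1` [set i])).
    by apply: measurableU; exact: measurableI.
  apply/seteqP; split => x /=; rewrite /glue !in_itv/= andbT.
    by case: leP => h ->; [left|right].
  by case=> -[]; case: leP.
- by move=> x i; rewrite /glue; case: ifP => _; [exact: dl1|exact: dl2].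
(* The gluing time is itself a node, so no piece straddles it. *)
exists (r :: l1 ++ l2) => u w su uw wt nf.
have nr : ~~ (u < r < w) by apply: nf; rewrite inE eqxx.
have nf1 : nodefree l1 u w by move=> x xl; apply: nf; rewrite inE mem_cat xl orbT.
have nf2 : nodefree l2 u w by move=> x xl; apply: nf; rewrite inE mem_cat xl !orbT.
have [wr|rw] := leP w r.
  apply: piece_eq (pl1 _ _ su uw wr nf1) => // x /andP[ux xw]; rewrite /glue ifT//.
  - exact: le_trans wr.
  - exact: le_trans (ltW xw) wr.
  - exact: le_trans (ltW xw) wr.
have ru : r <= u by move: nr; rewrite rw andbT -leNgt.
apply: piece_eq (pl2 _ _ ru uw wt nf2) => // x /andP[ux xw]; rewrite /glue.
- case: ifP => // xr; have -> : x = r by apply/eqP; rewrite eq_le xr (le_trans ru).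
  by rewrite cr.
- by rewrite ifF//; apply/negbTE; rewrite -ltNge (le_lt_trans ru).
- by rewrite ifF//; apply/negbTE; rewrite -ltNge (le_lt_trans ru).
Qed.

Lemma traj_line s t x y : s < t -> exists c v lab,
  [/\ traj s t c v lab, c s = x, c t = y & gain s t v lab = - ((y - x) ^+ 2 / (t - s))].
Proof.
move=> st; pose k := (y - x) / (t - s).
have ts : t - s != 0 by rewrite subr_eq0 gt_eqF.
exists (fun z => x + k * (z - s)), (fun=> k), (fun=> 0%N); split.
- split => //.
  + by move=> i; rewrite preimage_cst; case: ifP.
  + exists [::] => u w su uw wt _; split.
    * exact: sintegrable_cst.
    * by rewrite sint_cst ?ltW//; ring.
    * by left.
- by rewrite subrr mulr0 addr0.
- by rewrite /k divfK// addrC subrK.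
- rewrite /gain (_ : label_density _ = fun=> 0)//.
  rewrite !sint_cst ?ltW// mul0r sub0r; congr (- _); rewrite /k; field.
  exact: ts.
Qed.

End Trajectories.

(** * Bounds on the mass that labels can collect *)

Section Mass.
Variable R : realType.
Notation mu := (@lebesgue_measure R).
Notation mfun f := (measurable_fun [set: R] f).

Section Series.
Local Open Scope ereal_scope.

Lemma nneseries_ge1 (F : nat -> \bar R) i : (forall k, 0 <= F k) -> F i <= \sum_(k <oo) F k.
Proof.
move=> F0; apply: le_trans (nneseries_lim_ge i.+1 _) => //.
by rewrite big_mkord (bigD1 (@ord_max i))//= leeDl// sume_ge0.
Qed.

Lemma nneseries_ge2 (F : nat -> \bar R) i j : (forall k, 0 <= F k) -> i != j ->
  F i + F j <= \sum_(k <oo) F k.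
Proof.
move=> F0 ij; apply: le_trans (nneseries_lim_ge (maxn i j).+1 _) => //.
have li : (i < (maxn i j).+1)%N by rewrite ltnS leq_maxl.
have lj : (j < (maxn i j).+1)%N by rewrite ltnS leq_maxr.
rewrite big_mkord (bigD1 (Ordinal li))//= leeD2l//.
rewrite (bigD1 (Ordinal lj))//= ?leeDl ?sume_ge0//.
by rewrite -val_eqE /= eq_sym.
Qed.

End Series.

Variables (lo hi : nat -> R) (g rho : nat -> R -> R).
Hypothesis rhoD : forall i, density (rho i).
Let dens := label_density rho.
Definition mass_density (lab : R -> nat) (x : R) : R := label_density rho lab x `^ (3 / 2).
Local Open Scope ereal_scope.

Definition mass : \bar R :=
  \sum_(i <oo) \int[mu]_(x in `[lo i, hi i]) ((rho i x `^ (3 / 2))%R)%:E.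

Variable K : R.
Hypothesis massK : mass <= K%:E.

Let mp32 lab : (forall i, measurable (lab @^-1` [set i])) ->
  mfun (fun x => mass_density lab x).
Proof. by move=> ml; exact: measurable_powR32 (measurable_label_density rhoD ml). Qed.

(** At each time the two labels name distinct curves present at that time, so their densities are
    different terms of the series; sum and integral are exchanged by monotone convergence. The
    second label will stand for what a competitor takes from curves that the first trajectory leaves
    alone. *)
Lemma mass_bound2 (lab lab' : R -> nat) :
  (forall i, measurable (lab @^-1` [set i])) ->
  (forall i, measurable (lab' @^-1` [set i])) ->
  (forall x i, lab x = i.+1 -> (lo i <= x <= hi i)%R) ->
  (forall x i, lab' x = i.+1 -> (lo i <= x <= hi i)%R) ->
  (forall x i, lab x = i.+1 -> lab' x <> i.+1) ->
  \int[mu]_x (mass_density lab x + mass_density lab' x)%:E <= mass.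
Proof.
move=> ml ml' dl dl' dis.
pose F i x : \bar R := (((fun x => ((rho i x `^ (3 / 2))%R)%:E) : R -> \bar R) \_ `[lo i, hi i]) x.
have F0 i x : 0 <= F i x by apply: erestrict_ge0 => y _; rewrite lee_fin powR_ge0.
have mF i : measurable_fun [set: measurableTypeR R] (F i).
  apply/(measurable_restrictT _ _).1 => //; apply/measurable_EFinP.
  by apply: measurable_funS (measurable_powR32 (rhoD i).2).
rewrite /mass; under eq_eseriesr do rewrite integral_mkcond.
rewrite -(integral_nneseries _ measurableT mF)//; apply: ge0_le_integral => //.
- by move=> x _; rewrite lee_fin addr_ge0// powR_ge0.
- by apply/measurable_EFinP/measurable_funD; exact: mp32.
- exact: ge0_emeasurable_sum.
move=> x _; rewrite EFinD.
have FE i : (lo i <= x <= hi i)%R -> ((rho i x `^ (3 / 2))%R)%:E = F i x.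
  by move=> h; rewrite /F patchE mem_set//= in_itv.
have p0 : (0 `^ (3 / 2) = 0 :> R)%R by rewrite powR0// gt_eqF//; lra.
have z : 0 <= \sum_(i <oo) F i x by exact: nneseries_ge0.
rewrite /mass_density /label_density; case E : (lab x) => [|i]; case E' : (lab' x) => [|j].
- by rewrite p0 adde0.
- by rewrite p0 add0e FE ?dl'//; exact: (nneseries_ge1 (F := F ^~ x)).
- by rewrite p0 adde0 FE ?dl//; exact: (nneseries_ge1 (F := F ^~ x)).
- rewrite (FE i (dl _ _ E)) (FE j (dl' _ _ E')); apply: (nneseries_ge2 (F := F ^~ x)) => //.
  by apply/eqP => ij; apply: (dis x i E); rewrite E' ij.
Qed.

Lemma mass_integrable2 lab lab' s t s' t' :
  (forall i, measurable (lab @^-1` [set i])) ->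
  (forall i, measurable (lab' @^-1` [set i])) ->
  (forall x i, lab x = i.+1 -> (lo i <= x <= hi i)%R) ->
  (forall x i, lab' x = i.+1 -> (lo i <= x <= hi i)%R) ->
  (forall x i, lab x = i.+1 -> lab' x <> i.+1) ->
  [/\ sintegrable s t (fun x => mass_density lab x)%R,
      sintegrable s' t' (fun x => mass_density lab' x)%R &
      (sint s t (fun x => mass_density lab x) +
       sint s' t' (fun x => mass_density lab' x) <= K)%R].
Proof.
move=> ml ml' dl dl' dis; have bound := le_trans (mass_bound2 ml ml' dl dl' dis) massK.
move: bound; under eq_integral do rewrite EFinD.
have m1 : measurable_fun [set: measurableTypeR R] (fun x => (mass_density lab x)%:E).
  by apply/measurable_EFinP; exact: mp32.
have m2 : measurable_fun [set: measurableTypeR R] (fun x => (mass_density lab' x)%:E).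
  by apply/measurable_EFinP; exact: mp32.
rewrite ge0_integralD//; [|by move=> x _; rewrite lee_fin powR_ge0..].
have sub l p q : measurable_fun [set: measurableTypeR R] (fun x => (mass_density l x)%:E) ->
    \int[mu]_(x in `[p, q]) (mass_density l x)%:E <= \int[mu]_x (mass_density l x)%:E.
  by move=> m; apply: ge0_subset_integral => // x _; rewrite lee_fin powR_ge0.
move=> bound; have b1 := le_trans (leeD (sub lab s t m1) (sub lab' s' t' m2)) bound.
have nn l p q : 0 <= \int[mu]_(x in `[p, q]) (mass_density l x)%:E.
  by apply: integral_ge0 => x _; rewrite lee_fin powR_ge0.
have fin l p q : measurable_fun [set: measurableTypeR R] (fun x => (mass_density l x)%:E) ->
    \int[mu]_(x in `[p, q]) (mass_density l x)%:E <= K%:E ->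
    sintegrable p q (fun x => mass_density l x).
  move=> m h; apply/integrableP; split; first exact: measurable_funS m.
  apply: le_lt_trans (ltry K); apply: le_trans h.
  rewrite le_eqVlt; apply/orP; left; apply/eqP; apply: eq_integral => x _ /=.
  by rewrite ger0_norm// powR_ge0.
have i1 : sintegrable s t (fun x => mass_density lab x).
  by apply: fin => //; apply: le_trans b1; rewrite leeDl.
have i2 : sintegrable s' t' (fun x => mass_density lab' x).
  by apply: fin => //; apply: le_trans b1; rewrite leeDr.
by split => //; rewrite -lee_fin EFinD -(sintE i1) -(sintE i2).
Qed.

Lemma mass_integrable lab s t :
  (forall i, measurable (lab @^-1` [set i])) ->
  (forall x i, lab x = i.+1 -> (lo i <= x <= hi i)%R) ->
  sintegrable s t (fun x => mass_density lab x) /\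
  (sint s t (fun x => mass_density lab x) <= K)%R.
Proof.
move=> ml dl.
have ml0 i : measurable ((fun=> 0%N) @^-1` [set i] : set R).
  by rewrite preimage_cst; case: ifP.
have [//|//|h _ b] := @mass_integrable2 lab (fun=> 0%N) s t s s ml ml0 dl.
by split=> //; move: b; rewrite sint_pt addr0.
Qed.

Lemma label_density_integrable lab s t :
  (forall i, measurable (lab @^-1` [set i])) ->
  (forall x i, lab x = i.+1 -> (lo i <= x <= hi i)%R) ->
  sintegrable s t (dens lab).
Proof.
move=> ml dl; have [h _] := mass_integrable s t ml dl.
apply: (@sintegrable_le R s t _ (fun x => 1 + mass_density lab x)%R).
- exact: measurable_label_density.
- by apply: sintegrableD => //; exact: sintegrable_cst.
- move=> x _; have d0 := label_density_ge0 rhoD lab x.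
  by rewrite ger0_norm// (le_trans (le_powR32 ltr01 d0))// sqrtr1 divr1.
Qed.

Lemma label_density_bound lab s t m : (0 < m)%R -> (s <= t)%R ->
  (forall i, measurable (lab @^-1` [set i])) ->
  (forall x i, lab x = i.+1 -> (lo i <= x <= hi i)%R) ->
  (sint s t (dens lab) <= m * (t - s) +
     sint s t (fun x => mass_density lab x) / Num.sqrt m)%R.
Proof.
move=> m0 st ml dl; have [h _] := mass_integrable s t ml dl.
rewrite [X in (_ + X)%R]mulrC -sintZ// -(sint_cst m st) -sintD//; last exact: sintegrableZ.
  apply: sint_le => [||x _].
  - exact: label_density_integrable.
  - by apply: sintegrableD; [exact: sintegrable_cst|exact: sintegrableZ].
  - by rewrite [X in (_ <= _ + X)%R]mulrC; exact: le_powR32 m0 (label_density_ge0 rhoD lab x).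
exact: sintegrable_cst.
Qed.

End Mass.

(** * The metric of optimal gains *)

Section MetricContinuity.
Variable R : realType.
Variable E : R -> R -> R -> R -> R.

Definition jointly_continuous : Prop := forall x s y t eps, s < t -> 0 < eps ->
  exists2 eta : R, 0 < eta & forall x' s' y' t',
    `|x' - x| < eta -> `|s' - s| < eta -> `|y' - y| < eta -> `|t' - t| < eta ->
    `|E x' s' y' t' - E x s y t| < eps.

Lemma directed_metric_EFin : jointly_continuous ->
  (forall x s y t z u, s < t -> t < u -> E x s y t + E y t z u <= E x s z u) ->
  directed_metric (fun x s y t => (E x s y t)%:E).
Proof.
move=> cE tE; split; last by split => // x s y t z u st tu; rewrite -EFinD lee_fin tE.
apply: continuous_in_subspaceT => -[[[x s] y] t]; rewrite inE /= => st.
suff H : E p.1.1.1 p.1.1.2 p.1.2 p.2 @[p --> (x, s, y, t)] --> E x s y t.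
  by apply: cvg_EFin => //; exact: nearW.
apply/cvgrPdist_lt => e e0; have [eta eta0 H] := cE x s y t e st e0.
have hb : nbhs ((x, s, y, t) : R * R * R * R) (ball ((x, s, y, t) : R * R * R * R) eta).
  exact: (nbhsx_ballx _ _ eta0).
apply: (filterS _ hb) => -[[[x' s'] y'] t'] [[[xp sp] yp] tp] /=.
by rewrite distrC; apply: H; rewrite distrC.
Qed.

(** Young's inequality with weight l = 4 eta / delta expands (A + d)^2, and the same l satisfies h1
    <= (1 + l) h2; then (1 + l)^2 <= 1 + 3 l because l <= 1. It measures the effect of moving one
    end of a straight leg. *)
Lemma sqr_div_perturb (A d h1 h2 C delta eta : R) : 0 < eta -> 4 * eta <= delta ->
  `|d| <= 2 * eta -> `|h1 - h2| <= 2 * eta -> delta / 2 <= h1 -> delta / 2 <= h2 ->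
  A ^+ 2 / h1 <= C -> (A + d) ^+ 2 / h2 <= A ^+ 2 / h1 + (12 * C * eta / delta + 4 * eta).
Proof.
move=> eta0 ed dd hh h1d h2d AC.
have delta0 : 0 < delta by lra.
have h10 : 0 < h1 by lra.
have h20 : 0 < h2 by lra.
set q := A ^+ 2 / h1 in AC *.
have q0 : 0 <= q by rewrite divr_ge0 ?sqr_ge0//; lra.
have Aq : A ^+ 2 = q * h1 by rewrite /q divfK// gt_eqF.
pose l := 4 * eta / delta.
have ld : l * delta = 4 * eta by rewrite /l divfK// gt_eqF.
have l0 : 0 < l by rewrite /l divr_gt0//; lra.
have l1 : l <= 1 by rewrite /l ler_pdivrMr//; lra.
have lE : l = 4 * eta / delta by [].
clearbody l.
have d2 : d ^+ 2 <= 4 * eta ^+ 2.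
  rewrite -(real_normK (num_real d)).
  by have := normr_ge0 d; nra.
have Ad : l * (A + d) ^+ 2 <= l * ((1 + l) * A ^+ 2) + (1 + l) * d ^+ 2.
  have := sqr_ge0 (l * A - d); nra.
have Ad' : (A + d) ^+ 2 <= (1 + l) * (q * h1) + 2 * eta * delta.
  rewrite -Aq -(ler_pM2l l0) mulrDr.
  have : (1 + l) * d ^+ 2 <= l * (2 * eta * delta).
    have -> : l * (2 * eta * delta) = 2 * (4 * eta ^+ 2).
      have -> : l * (2 * eta * delta) = 2 * eta * (l * delta) by ring.
      by rewrite ld; ring.
    by have := sqr_ge0 d; nra.
  lra.
have h12 : h1 <= (1 + l) * h2.
  have : l * (delta / 2) <= l * h2 by rewrite ler_pM2l.
  move: hh; rewrite ler_norml => /andP[]; lra.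
have -> : 12 * C * eta / delta = 3 * l * C by rewrite lE; ring.
rewrite ler_pdivrMr//; apply: le_trans Ad' _.
have : (1 + l) * (q * h1) <= (1 + l) * (q * ((1 + l) * h2)).
  by rewrite ler_pM2l; [exact: ler_wpM2l|lra].
have : 2 * eta * delta <= 4 * eta * h2 by nra.
have : (1 + l) * (q * ((1 + l) * h2)) <= (q + 3 * l * C) * h2.
  rewrite (_ : _ * (q * _) = ((1 + l) ^+ 2 * q) * h2); last by ring.
  rewrite ler_pM2r//.
  have : l * q <= l * C by rewrite ler_pM2l.
  have : l ^+ 2 * q <= l * q by rewrite expr2 -mulrA ler_piMl// mulr_ge0// ltW.
  lra.
lra.
Qed.

Lemma interior_times (s t s1 t1 delta eta : R) : 0 < eta -> 4 * eta <= delta ->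
  delta <= (t - s) / 8 -> `|s1 - s| <= eta -> `|t1 - t| <= eta ->
  [/\ [/\ s1 < s + delta, s + delta < t - delta & t - delta < t1],
      delta / 2 <= s + delta - s1 <= 2 * delta, delta / 2 <= t1 - (t - delta) <= 2 * delta
    & t - s <= 2 * (t1 - s1) /\ eta + eta <= t - s].
Proof.
move=> eta0 ed dts; rewrite !ler_norml => /andP[sa sb] /andP[ta tb].
by split; [split; lra|apply/andP; split; lra|apply/andP; split; lra|split; lra].
Qed.

Lemma norm_sub_le_double (x x1 x2 eta : R) : `|x1 - x| <= eta -> `|x2 - x| <= eta ->
  `|x1 - x2| <= 2 * eta.
Proof. by rewrite !ler_norml => /andP[? ?] /andP[? ?]; apply/andP; split; lra. Qed.

Hypothesis triangle : forall x s y t z u, s < t -> t < u ->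
  E x s y t + E y t z u <= E x s z u.
Hypothesis ge_dirichlet : forall x s y t, s < t -> - ((y - x) ^+ 2 / (t - s)) <= E x s y t.
Hypothesis split : forall x s y t r eps, s < r -> r < t -> 0 < eps ->
  exists z, E x s y t <= E x s z r + E z r y t + eps.
Variable K : R.
Hypothesis K0 : 0 <= K.
Hypothesis upper : forall x s y t m, s < t -> 0 < m ->
  E x s y t <= - ((y - x) ^+ 2 / (t - s)) + m * (t - s) + K / Num.sqrt m.

(** Cut an almost optimal path at times s + delta and t - delta and keep its middle. On the short
    end legs the metric is almost the Dirichlet one, so they can be replaced by segments to the
    displaced endpoints. *)
Lemma locally_le_shifted x s y t eps : s < t -> 0 < eps ->
  exists2 eta, 0 < eta & forall x1 s1 y1 t1 x2 s2 y2 t2,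
    [/\ `|x1 - x| <= eta, `|s1 - s| <= eta, `|y1 - y| <= eta & `|t1 - t| <= eta] ->
    [/\ `|x2 - x| <= eta, `|s2 - s| <= eta, `|y2 - y| <= eta & `|t2 - t| <= eta] ->
    E x1 s1 y1 t1 <= E x2 s2 y2 t2 + eps.
Proof.
move=> st eps0; have K_ge0 := K0.
(* First m makes K / sqrt m small, then delta makes 2 delta m small: together they bound the
   advantage over Dirichlet on a leg of duration at most 2 delta. *)
have [m m0 Km] : exists2 m : R, 0 < m & K / Num.sqrt m <= eps / 16.
  exists ((16 * (K + 1) / eps) ^+ 2).
    by rewrite exprn_gt0// divr_gt0//; lra.
  rewrite sqrtr_sqr ger0_norm; last by rewrite divr_ge0//; lra.
  rewrite invf_div mulrA ler_pdivrMr; last by lra.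
  nra.
pose delta := Num.min ((t - s) / 8) (eps / (32 * m)).
have delta0 : 0 < delta by rewrite lt_min !divr_gt0//; lra.
have delta1 : delta <= (t - s) / 8 by rewrite ge_min lexx.
have delta2 : 2 * delta * m <= eps / 16.
  have : delta <= eps / (32 * m) by rewrite ge_min lexx orbT.
  rewrite ler_pdivlMr; last by lra.
  nra.
(* C bounds the Dirichlet cost of both end legs: the whole path is worth at least minus the first
   term of C, and its middle at most t - s + K. *)
pose C := 2 * (`|y - x| + (t - s)) ^+ 2 / (t - s) + 2 * (t - s) + K + eps.
have ts0 : 0 < t - s by lra.
have C0 : 0 <= C.
  have : 0 <= 2 * (`|y - x| + (t - s)) ^+ 2 / (t - s).
    by rewrite divr_ge0//; [rewrite mulr_ge0// sqr_ge0|lra].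
  rewrite /C; lra.
pose eta := Num.min (delta / 4) (eps / (8 * (12 * C / delta + 4))).
have den0 : 0 < 12 * C / delta + 4.
  have : 0 <= 12 * C / delta by rewrite divr_ge0//; [lra|exact: ltW].
  lra.
have eta0 : 0 < eta by rewrite lt_min !divr_gt0//; lra.
have eta1 : 4 * eta <= delta.
  have : eta <= delta / 4 by rewrite ge_min lexx.
  lra.
have eta2 : 12 * C * eta / delta + 4 * eta <= eps / 8.
  have : eta <= eps / (8 * (12 * C / delta + 4)) by rewrite ge_min lexx orbT.
  rewrite ler_pdivlMr; last by lra.
  rewrite (_ : 12 * C * eta / delta = 12 * C / delta * eta); last by ring.
  move: (12 * C / delta) => z; lra.
have CE : C = 2 * (`|y - x| + (t - s)) ^+ 2 / (t - s) + 2 * (t - s) + K + eps by [].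
clearbody eta; clearbody delta C.
exists eta => // x1 s1 y1 t1 x2 s2 y2 t2.
move=> [hx1 hs1 hy1 ht1] [hx2 hs2 hy2 ht2].
have [[s1r r12 rt1] /andP[d1a d1b] /andP[d2a d2b] [ts1 ets]] := interior_times eta0 eta1 delta1 hs1 ht1.
have [[s2r _ rt2] /andP[d3a d3b] /andP[d4a d4b] _] := interior_times eta0 eta1 delta1 hs2 ht2.
have dsE : `|s + delta - s1 - (s + delta - s2)| <= 2 * eta.
  by rewrite (_ : _ - _ - _ = s2 - s1); [exact: norm_sub_le_double hs2 hs1|ring].
have dtE : `|t1 - (t - delta) - (t2 - (t - delta))| <= 2 * eta.
  by rewrite (_ : _ - _ - (t2 - _) = t1 - t2); [exact: norm_sub_le_double ht1 ht2|ring].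
have dx := norm_sub_le_double hx1 hx2; have dy := norm_sub_le_double hy2 hy1.
have dyx : `|y1 - x1| <= `|y - x| + (t - s).
  rewrite (_ : y1 - x1 = (y - x) + ((y1 - y) - (x1 - x))); last by ring.
  apply: le_trans (ler_normD _ _) _; rewrite lerD2l.
  by apply: le_trans (ler_normB _ _) _; apply: le_trans (lerD hy1 hx1) _.
have e8 : 0 < eps / 8 by rewrite divr_gt0.
have r12' : 0 <= t - delta - (s + delta) by rewrite subr_ge0 ltW.
have r12l : t - delta - (s + delta) <= t - s by rewrite opprD addrACA gerDl -opprD oppr_le0 addr_ge0// ltW.
clear hx1 hs1 hy1 ht1 hx2 hs2 hy2 ht2 delta1 den0 ets d3b d4b.
have [r1 r1E] : exists r1, r1 = s + delta by exists (s + delta).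
have [r2 r2E] : exists r2, r2 = t - delta by exists (t - delta).
rewrite -?r1E -?r2E in s1r r12 rt1 d1a d1b d2a d2b s2r rt2 d3a d4a dsE dtE r12' r12l.
clear r1E r2E.
have [z hz] := split x1 y1 s1r (lt_trans r12 rt1) e8.
have [w hw] := split z y1 r12 rt1 e8.
have small p u q v : u < v -> v - u <= 2 * delta ->
    E p u q v <= - ((q - p) ^+ 2 / (v - u)) + eps / 8.
  move=> uv vu; have := upper p q uv m0.
  have : m * (v - u) <= m * (2 * delta) by rewrite ler_pM2l.
  lra.
have uz := small x1 s1 z r1 s1r d1b; have uw := small w r2 y1 t1 rt1 d2b.
have um : E z r1 w r2 <= (t - s) + K.
  have := upper z w r12 ltr01; rewrite sqrtr1 divr1 mul1r.
  have : 0 <= (w - z) ^+ 2 / (r2 - r1) by rewrite divr_ge0 ?sqr_ge0.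
  move: r12l; move: (_ / _) (E _ _ _ _) => *; lra.
have lz : - ((z - x2) ^+ 2 / (r1 - s2)) <= E x2 s2 z r1.
  exact: ge_dirichlet.
have lw : - ((y2 - w) ^+ 2 / (t2 - r2)) <= E w r2 y2 t2.
  exact: ge_dirichlet.
have tr1 : E x2 s2 z r1 + E z r1 y2 t2 <= E x2 s2 y2 t2.
  by apply: triangle => //; exact: lt_trans rt2.
have tr2 : E z r1 w r2 + E w r2 y2 t2 <= E z r1 y2 t2.
  exact: triangle.
have low : - (2 * (`|y - x| + (t - s)) ^+ 2 / (t - s)) <= E x1 s1 y1 t1.
  have st1 := lt_trans s1r (lt_trans r12 rt1); have ts1' : 0 < t1 - s1 by rewrite subr_gt0.
  apply: le_trans (ge_dirichlet x1 y1 st1).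
  rewrite lerN2 ler_pdivrMr// -[leRHS]mulrA [_^-1 * _]mulrC mulrA ler_pdivlMr//.
  have h : (y1 - x1) ^+ 2 <= (`|y - x| + (t - s)) ^+ 2.
    by rewrite -(real_normK (num_real (y1 - x1))) ler_sqr ?nnegrE// addr_ge0// ltW.
  by rewrite -[leRHS]mulrA [leRHS]mulrCA; exact: ler_pM (sqr_ge0 _) (ltW ts0) h ts1.
have qz0 : 0 <= (z - x1) ^+ 2 / (r1 - s1) by rewrite divr_ge0 ?sqr_ge0// subr_ge0 ltW.
have qw0 : 0 <= (y1 - w) ^+ 2 / (t1 - r2) by rewrite divr_ge0 ?sqr_ge0// subr_ge0 ltW.
have [Cz Cw] : (z - x1) ^+ 2 / (r1 - s1) <= C /\ (y1 - w) ^+ 2 / (t1 - r2) <= C.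
  move: qz0 qw0 low um uw uz hw hz; rewrite CE.
  move: ((z - x1) ^+ 2 / _) ((y1 - w) ^+ 2 / _) (_ / (t - s)) => X1 X2 X3.
  move: (E x1 s1 y1 t1) (E z r1 w r2) (E w r2 y1 t1) (E x1 s1 z r1) (E z r1 y1 t1) => *; lra.
have bz : (z - x2) ^+ 2 / (r1 - s2) <= (z - x1) ^+ 2 / (r1 - s1) + eps / 8.
  rewrite (_ : z - x2 = z - x1 + (x1 - x2)); last by ring.
  apply: le_trans (sqr_div_perturb eta0 eta1 dx dsE d1a d3a Cz) _; by rewrite lerD2l.
have bw : (y2 - w) ^+ 2 / (t2 - r2) <= (y1 - w) ^+ 2 / (t1 - r2) + eps / 8.
  rewrite (_ : y2 - w = y1 - w + (y2 - y1)); last by ring.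
  apply: le_trans (sqr_div_perturb eta0 eta1 dy dtE d2a d4a Cw) _; by rewrite lerD2l.
move: hz hw uz uw lz lw tr1 tr2 bz bw.
move: (_ / (r1 - s1)) (_ / (r1 - s2)) (_ / (t1 - r2)) (_ / (t2 - r2)) (E x1 s1 y1 t1) (E x2 s2 y2 t2) (E z r1 w r2) (E w r2 y1 t1) (E x1 s1 z r1) (E z r1 y1 t1) (E x2 s2 z r1) (E w r2 y2 t2) (E z r1 y2 t2) => *; lra.
Qed.

Lemma metric_jointly_continuous : jointly_continuous.
Proof.
move=> x s y t eps st eps0.
have e2 : 0 < eps / 2 by lra.
have [eta eta0 H] := locally_le_shifted x y st e2.
exists eta => // x' s' y' t' hx hs hy ht.
have z0 : `|0 : R| <= eta by rewrite normr0 ltW.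
have P : [/\ `|x - x| <= eta, `|s - s| <= eta, `|y - y| <= eta & `|t - t| <= eta].
  by rewrite !subrr.
have Q : [/\ `|x' - x| <= eta, `|s' - s| <= eta, `|y' - y| <= eta & `|t' - t| <= eta].
  by split; exact: ltW.
have := H _ _ _ _ _ _ _ _ P Q; have := H _ _ _ _ _ _ _ _ Q P.
rewrite ltr_norml; lra.
Qed.

End MetricContinuity.

(** * The supremum of gains is the smallest metric *)

Section OptimalGain.
Variable R : realType.
Notation mu := (@lebesgue_measure R).
Variables (lo hi : nat -> R) (g rho : nat -> R -> R).
Hypothesis rhoD : forall i, density (rho i).
Variable K : R.
Hypothesis massK : (mass lo hi rho <= K%:E)%E.

Notation tr := (traj lo hi g).
Notation dens := (label_density rho).
Notation gn := (gain rho).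

(** The label is cut off outside [s, t] because the domain condition of [traj] is global. *)
Lemma plant_label i s t : lo i <= s -> t <= hi i ->
  let lab := fun z : R => if s <= z <= t then i.+1 else 0%N in
  [/\ forall j, measurable (lab @^-1` [set j]),
      forall z j, lab z = j.+1 -> lo j <= z <= hi j &
      forall z, s < z < t -> lab z = i.+1].
Proof.
move=> ls th lab; split.
- move=> j.
  rewrite (_ : _ @^-1` _ = (`[s, t] `&` [set _ | i.+1 = j]) `|` (~` `[s, t] `&` [set _ | 0%N = j])).
    have mP (P : Prop) : measurable ([set _ | P] : set R).
      have [p|np] := pselect P.
        by rewrite (_ : mkset _ = setT)//; apply/seteqP; split.
      by rewrite (_ : mkset _ = set0)//; apply/seteqP; split.
    by apply: measurableU; apply: measurableI => //; exact: measurableC.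
  apply/seteqP; split => z /=; rewrite /lab in_itv/=; first by case: ifP => H; [left|right].
  by case=> -[H <-]; [rewrite H|case: ifP H].
- move=> z j; rewrite /lab; case: ifP => // /andP[sz zt] [<-].
  by rewrite (le_trans ls sz) (le_trans zt th).
- by move=> z /andP[sz zt]; rewrite /lab !ltW.
Qed.

Lemma rho_integrable i s t : lo i <= s -> t <= hi i -> sintegrable s t (rho i).
Proof.
move=> ls th; have [ml dl lE] := plant_label ls th.
apply: sintegrable_eq (label_density_integrable rhoD massK s t ml dl) _ => z /lE.
by rewrite /label_density => ->.
Qed.

(** A finite value excludes curves that are not absolutely continuous or have infinite energy, since
    both give -oo. What is left is a one-piece trajectory whose velocity is the density of the
    curve. *)
Lemma traj_plant i x s y t V : s < t ->
  plant_metric (lo i) (hi i) (g i) (rho i) x s y t = V%:E ->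
  exists c v lab, [/\ tr s t c v lab, c s = x, c t = y & gn s t v lab = V].
Proof.
move=> st; rewrite /plant_metric; case: ifP => // /and4P[ls th /eqP -> /eqP ->].
have [ac|nac] := pselect (abs_cont s t (g i)); last first.
  by rewrite /energy asboolF//=; case: (\int[_]_(_ in _) _)%E.
have [h [mh hi_ hE enE]] := abs_cont_density st ac.
have [ml dl lE] := plant_label ls th.
set lab := (fun z => _) in ml dl lE.
have ri := rho_integrable ls th.
rewrite (enE s t)// ?lexx ?ltW// (sintE ri).
have h2ge : (0 <= \int[mu]_(x0 in `[s, t]) (h x0 ^+ 2)%:E)%E.
  by apply: integral_ge0 => z _; rewrite lee_fin sqr_ge0.
have [h2fin|] := boolP (\int[mu]_(x0 in `[s, t]) (h x0 ^+ 2)%:E < +oo)%E; last first.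
  by rewrite -leNgt leye_eq => /eqP ->.
have h2i : sintegrable s t (fun z => h z ^+ 2).
  apply/integrableP; split.
    by apply/measurable_EFinP; apply: measurable_funS (sqr_measurable mh).
  apply: le_lt_trans h2fin; rewrite le_eqVlt; apply/orP; left; apply/eqP.
  by apply: eq_integral => z _ /=; rewrite ger0_norm// sqr_ge0.
rewrite (sintE h2i) -EFinB => -[VE].
exists (g i), h, lab; split => //; last first.
  rewrite /gain -VE; congr (_ - _); apply: sint_eq.
    by apply: sintegrable_eq ri _ => z /lE lz; rewrite /label_density /lab lz.
  by move=> z /lE lz; rewrite /label_density /lab lz.
split => //; exists [::] => u w su uw wt _; split.
- exact: sintegrable_sub h2i su wt.
- by rewrite hE// ltW.
- right; exists i; split => //; first exact: le_trans su.
  + exact: le_trans th.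
  + by move=> z /andP[uz zw]; apply: lE; apply/andP; split; [exact: le_lt_trans uz|exact: lt_le_trans wt].
  + by rewrite (enE u w su (ltW uw) wt) (sintE (sintegrable_sub h2i su wt)).
Qed.

Lemma traj_dens s t c v lab : tr s t c v lab -> forall u w, sintegrable u w (dens lab).
Proof.
case=> _ _ ml dl _ u w; exact (label_density_integrable rhoD massK u w ml dl).
Qed.

Lemma gain_split s r t c v lab : tr s t c v lab -> s <= r -> r <= t ->
  gn s t v lab = gn s r v lab + gn r t v lab.
Proof.
move=> T sr rt; rewrite /gain.
rewrite (sint_cat (traj_dens T s t) sr rt) (sint_cat (traj_sqr T) sr rt); ring.
Qed.

Lemma gain_glue s r t c1 v1 lab1 c2 v2 lab2 : tr s r c1 v1 lab1 ->
  tr r t c2 v2 lab2 -> c1 r = c2 r ->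
  gn s t (glue r v1 v2) (glue r lab1 lab2) = gn s r v1 lab1 + gn r t v2 lab2.
Proof.
move=> T1 T2 cr; have T := traj_cat T1 T2 cr.
have sr := ltW (traj_lt T1); have rt := ltW (traj_lt T2).
rewrite (gain_split T sr rt) /gain.
have i1 := traj_sqr (traj_sub T (lexx s) (traj_lt T1) rt).
have i2 := traj_sqr (traj_sub T sr (traj_lt T2) (lexx t)).
have g1 z : s < z < r -> glue r v1 v2 z = v1 z.
  by move=> /andP[_ zr]; rewrite /glue ltW.
have g2 z : r < z < t -> glue r v1 v2 z = v2 z.
  by move=> /andP[rz _]; rewrite /glue leNgt rz.
rewrite (sint_eq (traj_dens T s r) (g := dens lab1)); last first.
  by move=> z /andP[_ zr]; rewrite /label_density /glue ltW.
rewrite (sint_eq (traj_dens T r t) (g := dens lab2)); last first.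
  by move=> z /andP[rz _]; rewrite /label_density /glue leNgt rz.
rewrite (sint_eq i1 (g := fun x => v1 x ^+ 2)); last by move=> z /g1 ->.
by rewrite (sint_eq i2 (g := fun x => v2 x ^+ 2)) => // z /g2 ->.
Qed.

Lemma gain_upper s t c v lab m : tr s t c v lab -> 0 < m ->
  gn s t v lab <= - ((c t - c s) ^+ 2 / (t - s)) + m * (t - s) + K / Num.sqrt m.
Proof.
move=> T m0; have st := traj_lt T.
have := traj_dist T; rewrite /gain.
have := label_density_bound rhoD massK m0 (ltW st) (traj_mlab T) (@traj_dom _ _ _ _ _ _ _ _ _ T).
have [_ b] := mass_integrable rhoD massK s t (traj_mlab T) (@traj_dom _ _ _ _ _ _ _ _ _ T).
have : sint s t (mass_density rho lab) / Num.sqrt m <= K / Num.sqrt m.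
  by rewrite ler_pM2r// invr_gt0 sqrtr_gt0.
lra.
Qed.

(** Superadditivity of e reduces the bound to single pieces, where Dirichlet or one planted curve
    applies. This is the minimality half of [optimal_gain_smallest]. *)
Lemma gain_le_metric (e : spacetime_fun R) s t c v lab :
  directed_metric e -> ge_on e (@dirichlet R) ->
  (forall i, ge_on e (plant_metric (lo i) (hi i) (g i) (rho i))) ->
  tr s t c v lab -> ((gn s t v lab)%:E <= e (c s) s (c t) t)%E.
Proof.
move=> [_ [_ tri]] eD eP T; have [l pl] := traj_nodes T.
apply: (@interval_property_of_nodes R (fun u w => (gn u w v lab)%:E <= e (c u) u (c w) w)%E s t l);
  rewrite ?lexx//; last exact: traj_lt T.
  move=> u r w su ur rw wt h1 h2; apply: le_trans (tri (c u) u (c r) r (c w) w ur rw).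
  have T' := traj_sub T su (lt_trans ur rw) wt.
  by rewrite (gain_split T' (ltW ur) (ltW rw)) EFinD; exact: leeD.
move=> u w su uw wt nf; have T' := traj_sub T su uw wt.
have [i1 e1 [z|[i [l1 l2 ci li en]]]] := pl _ _ su uw wt nf.
  apply: le_trans (eD (c u) u (c w) w uw); rewrite lee_fin /gain.
  rewrite (sint_eq (traj_dens T u w) (g := fun=> 0)); last first.
    by move=> x /z; rewrite /label_density => ->.
  by rewrite (sint_cst _ (ltW uw)) mul0r sub0r lerN2; exact: traj_dist T'.
apply: le_trans (eP i (c u) u (c w) w uw); rewrite /plant_metric l1 l2 (ci u) ?lexx ?(ltW uw)// (ci w) ?lexx ?(ltW uw)// !eqxx /=.
rewrite en.
have rE x : u < x < w -> dens lab x = rho i x by move=> /li; rewrite /label_density => ->.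
rewrite (sintE (sintegrable_eq (traj_dens T u w) rE)) -EFinB lee_fin /gain.
by rewrite (sint_eq (traj_dens T u w) rE).
Qed.

Definition gains x s y t : set R :=
  [set r | exists c v lab, [/\ tr s t c v lab, c s = x, c t = y & r = gn s t v lab]].

Definition optimal_gain x s y t : R := sup (gains x s y t).

Let K0 : 0 <= K.
Proof.
rewrite -lee_fin; apply: le_trans massK; apply: nneseries_ge0 => i _ _.
by apply: integral_ge0 => x _; rewrite lee_fin powR_ge0.
Qed.

Lemma gains_sup x s y t : s < t -> has_sup (gains x s y t).
Proof.
move=> st; split.
  have [c [v [lab [T cs ct _]]]] := traj_line lo hi g rho x y st.
  by exists (gn s t v lab), c, v, lab.
exists (- ((y - x) ^+ 2 / (t - s)) + 1 * (t - s) + K / Num.sqrt 1).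
by move=> _ [c [v [lab [T <- <- ->]]]]; exact: gain_upper.
Qed.

Lemma gain_le_optimal s t c v lab : tr s t c v lab ->
  gn s t v lab <= optimal_gain (c s) s (c t) t.
Proof.
move=> T; apply: sup_upper_bound; first exact: gains_sup (traj_lt T).
by exists c, v, lab.
Qed.

Lemma optimal_gain_approx x s y t eps : s < t -> 0 < eps ->
  exists c v lab, [/\ tr s t c v lab, c s = x, c t = y &
    optimal_gain x s y t - eps < gn s t v lab].
Proof.
move=> st e0; have [_ [c [v [lab [T cs ct ->]]]] h] := sup_adherent e0 (gains_sup x y st).
by exists c, v, lab.
Qed.

Lemma optimal_gain_le x s y t b : s < t ->
  (forall c v lab, tr s t c v lab -> c s = x -> c t = y -> gn s t v lab <= b) ->
  optimal_gain x s y t <= b.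
Proof.
move=> st H; apply: ge_sup; first by have [] := gains_sup x y st.
by move=> _ [c [v [lab [T cs ct ->]]]]; exact (H c v lab T cs ct).
Qed.

Lemma optimal_gain_upper x s y t m : s < t -> 0 < m ->
  optimal_gain x s y t <= - ((y - x) ^+ 2 / (t - s)) + m * (t - s) + K / Num.sqrt m.
Proof.
by move=> st m0; apply: optimal_gain_le => // c v lab T <- <-; exact: gain_upper.
Qed.

Lemma optimal_gain_dirichlet x s y t : s < t ->
  - ((y - x) ^+ 2 / (t - s)) <= optimal_gain x s y t.
Proof.
move=> st; have [c [v [lab [T <- <- <-]]]] := traj_line lo hi g rho x y st.
exact: gain_le_optimal.
Qed.

Lemma optimal_gain_triangle x s y t z u : s < t -> t < u ->
  optimal_gain x s y t + optimal_gain y t z u <= optimal_gain x s z u.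
Proof.
move=> st tu; apply/ler_addgt0Pr => e e0; have e2 : 0 < e / 2 by lra.
have [c1 [v1 [lab1 [T1 c1s c1t h1]]]] := optimal_gain_approx x y st e2.
have [c2 [v2 [lab2 [T2 c2t c2u h2]]]] := optimal_gain_approx y z tu e2.
have c12 : c1 t = c2 t by rewrite c1t c2t.
have := gain_le_optimal (traj_cat T1 T2 c12); rewrite (gain_glue T1 T2 c12).
have -> : glue t c1 c2 s = x by rewrite /glue (ltW st).
have -> : glue t c1 c2 u = z by rewrite /glue leNgt tu.
move: h1 h2; move: (gn s t v1 lab1) (gn t u v2 lab2).
move: (optimal_gain x s y t) (optimal_gain y t z u) (optimal_gain x s z u).
by move=> p1 p2 p3 q1 q2; lra.
Qed.

Lemma optimal_gain_split x s y t r eps : s < r -> r < t -> 0 < eps ->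
  exists z, optimal_gain x s y t <= optimal_gain x s z r + optimal_gain z r y t + eps.
Proof.
move=> sr rt e0.
have [c [v [lab [T cs ct h]]]] := optimal_gain_approx x y (lt_trans sr rt) e0.
exists (c r); have := gain_le_optimal (traj_sub T (lexx s) sr (ltW rt)).
have := gain_le_optimal (traj_sub T (ltW sr) rt (lexx t)).
rewrite cs ct; move: h; rewrite (gain_split T (ltW sr) (ltW rt)).
move: (gn s r v lab) (gn r t v lab).
move: (optimal_gain x s y t) (optimal_gain x s _ r) (optimal_gain _ r y t).
by move=> p1 p2 p3 q1 q2; lra.
Qed.

Lemma optimal_gain_continuous : jointly_continuous optimal_gain.
Proof.
exact: (metric_jointly_continuous optimal_gain_triangle optimal_gain_dirichlet
  optimal_gain_split K0 optimal_gain_upper).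
Qed.

Lemma optimal_gain_smallest : smallest_above
  (fun x s y t => (optimal_gain x s y t)%:E)
  (range (fun i => plant_metric (lo i) (hi i) (g i) (rho i))).
Proof.
split.
- apply: directed_metric_EFin; first exact: optimal_gain_continuous.
  exact: optimal_gain_triangle.
- by move=> x s y t st; rewrite lee_fin; exact: optimal_gain_dirichlet.
- move=> _ [i _ <-] x s y t st.
  case E : (plant_metric _ _ _ _ _ _ _ _) => [V| |]; last by rewrite leNye.
    have [c [v [lab [T <- <- <-]]]] := traj_plant st E.
    by rewrite lee_fin; exact: gain_le_optimal.
  (* The value +oo cannot occur: finite total mass makes every planted density integrable. *)
  move: E; rewrite /plant_metric; case: ifP => // /and4P[ls th _ _].
  rewrite (sintE (rho_integrable ls th)) /energy; case: asboolP => // ac.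
  have : (0 <= \int[mu]_(x0 in `[s, t]) (derive1 (g i) x0 ^+ 2)%:E)%E.
    by apply: integral_ge0 => z _; rewrite lee_fin sqr_ge0.
  by case: (\int[_]_(_ in _) _)%E.
- move=> e eM eD eP x s y t st.
  have eP' i : ge_on e (plant_metric (lo i) (hi i) (g i) (rho i)).
    by apply: eP; exists i.
  apply/lee_addgt0Pr => eps eps0.
  have [c [v [lab [T <- <- h]]]] := optimal_gain_approx x y st eps0.
  apply: le_trans (leeD2r eps%:E (gain_le_metric eM eD eP' T)).
  by rewrite -EFinD lee_fin -lerBlDr; exact: ltW.
Qed.

Lemma smallest_above_optimal_gain e :
  smallest_above e (range (fun i => plant_metric (lo i) (hi i) (g i) (rho i))) ->
  forall x s y t, s < t -> e x s y t = (optimal_gain x s y t)%:E.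
Proof.
move=> [eM eD eP eS] x s y t st; have [oM oD oP oS] := optimal_gain_smallest.
apply/eqP; rewrite eq_le; apply/andP; split.
  exact: (eS _ oM oD oP x s y t st).
exact: (oS _ eM eD eP x s y t st).
Qed.

End OptimalGain.

(** * The optimal curve and density *)

Section OptimalProfile.
Variable R : realType.
Notation mfun f := (measurable_fun [set: R] f).

Lemma sint_derive (f F : R -> R) (u w : R) : u < w ->
  (forall x, u <= x <= w -> is_derive x 1 F (f x)) ->
  (forall x, u <= x <= w -> {for x, continuous f}) ->
  sintegrable u w f /\ sint u w f = F w - F u.
Proof.
move=> uw dF cf.
have cfw : {within `[u, w], continuous f}.
  apply: continuous_in_subspaceT => x; rewrite inE /= in_itv /= => ux.
  exact: cf.
have cF x : u <= x <= w -> {for x, continuous F}.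
  move=> ux; apply/differentiable_continuous; rewrite -derivable1_diffP.
  by have [] := dF x ux.
split; first by apply: continuous_compact_integrable => //; exact: segment_compact.
rewrite /sint /Rintegral (continuous_FTC2 (F := F) uw cfw) //.
- split.
  + move=> x; rewrite in_itv/= => /andP[ux xw].
    by have [] := dF x (introT andP (conj (ltW ux) (ltW xw))).
  + by apply: cvg_at_right_filter; apply: cF; rewrite lexx ltW.
  + by apply: cvg_at_left_filter; apply: cF; rewrite lexx ltW.
- move=> x; rewrite in_itv/= => /andP[ux xw].
  by rewrite derive1E; have [_ ->] := dF x (introT andP (conj (ltW ux) (ltW xw))).
Qed.

Variable a : R.
Hypothesis a0 : 0 < a.
Hypothesis a1 : a < 1 / 2.

(* [psigma] is the square root of the optimal density, [pkappa] minus its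
   derivative, and [pvel] the velocity of the optimal curve in the frame moving at
   speed [- pc], where the curve is [3 * ps0 * t], then [ps0 * (t + 2 * a)], then
   [pc * sqrt t]. *)
Definition pq : R := Num.sqrt (2 * a).
Definition ps0 : R := 2 / (3 - 2 * pq) / (2 * a).
Definition pc : R := 2 * pq * ps0.
Definition psigma (t : R) : R := pc / (2 * Num.sqrt (Num.max t (2 * a))).
Definition pkappa (t : R) : R :=
  if t <= 2 * a then 0 else pc / (4 * Num.max t (2 * a) * Num.sqrt (Num.max t (2 * a))).
Definition pvel (t : R) : R := if t <= a then 3 * ps0 else psigma t.

Lemma pq_gt0 : 0 < pq. Proof. by rewrite sqrtr_gt0 mulr_gt0. Qed.
Lemma pq2 : pq ^+ 2 = 2 * a. Proof. by rewrite sqr_sqrtr// mulr_ge0// ltW. Qed.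
Lemma pq_lt1 : pq < 1.
Proof.
have := pq2; have := pq_gt0; have h := a1.
by move=> q0 q2; rewrite ltNge; apply/negP => q1; nra.
Qed.
Lemma pden_gt0 : 0 < 3 - 2 * pq. Proof. have := pq_lt1; lra. Qed.
Lemma ps0_gt0 : 0 < ps0.
Proof. by rewrite /ps0 !divr_gt0// ?pden_gt0// mulr_gt0. Qed.
(** This encodes the passage through (1, a): the sheared curve has slope [3 * ps0] up to a, undoing
    the shear subtracts [pc * a], and [pc = 2 * pq * ps0]. *)
Lemma ps0E : ps0 * (3 - 2 * pq) * a = 1.
Proof.
have d0 := pden_gt0; have h := a0; rewrite /ps0; field.
by rewrite !gt_eqF.
Qed.
Lemma pc_gt0 : 0 < pc.
Proof. by rewrite /pc mulr_gt0 ?ps0_gt0// mulr_gt0// pq_gt0. Qed.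

Lemma psigma_le t : t <= 2 * a -> psigma t = ps0.
Proof.
move=> ta; rewrite /psigma max_r// /pc -/pq; have := pq_gt0; move: pq => q q0.
by field; rewrite gt_eqF.
Qed.

Lemma psigma_ge t : 2 * a <= t -> psigma t = pc / (2 * Num.sqrt t).
Proof. by move=> ta; rewrite /psigma max_l. Qed.

Let max_gt0 (t : R) : 0 < Num.max t (2 * a).
Proof. by rewrite lt_max mulr_gt0// orbT. Qed.

Let sqrt_max_gt0 (t : R) : 0 < Num.sqrt (Num.max t (2 * a)).
Proof. by rewrite sqrtr_gt0. Qed.

Lemma psigma_gt0 t : 0 < psigma t.
Proof. by rewrite /psigma divr_gt0 ?pc_gt0// mulr_gt0. Qed.

Lemma pkappa_ge0 t : 0 <= pkappa t.
Proof.
rewrite /pkappa; case: ifP => // _; have := pc_gt0.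
by move=> h; rewrite divr_ge0 ?ltW// mulr_gt0// mulr_gt0.
Qed.

Let max_continuous : continuous (fun t : R => Num.max t (2 * a)).
Proof.
move=> t; rewrite (_ : (fun t : R => _) = fun t : R => (t + 2 * a + `|t - 2 * a|) / 2).
  apply: cvgM; last exact: cvg_cst.
  apply: cvgD; first by apply: cvgD; [exact: cvg_id|exact: cvg_cst].
  by apply: cvg_norm; apply: cvgB; [exact: cvg_id|exact: cvg_cst].
by apply/funext => z; rewrite maxr_absE.
Qed.

Let sqrt_max_continuous : continuous (fun t : R => Num.sqrt (Num.max t (2 * a))).
Proof.
move=> t; apply: continuous_cvg; first exact: sqrt_continuous.
exact: max_continuous.
Qed.

Lemma psigma_continuous : continuous psigma.
Proof.
move=> t; apply: cvgM; first exact: cvg_cst.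
apply: cvgV; first by rewrite gt_eqF// mulr_gt0.
by apply: cvgM; [exact: cvg_cst|exact: sqrt_max_continuous].
Qed.

Lemma measurable_psigma : mfun psigma.
Proof. exact: continuous_measurable_fun psigma_continuous. Qed.

Lemma measurable_pkappa : mfun pkappa.
Proof.
apply: measurable_fun_ifT => //.
  by apply: measurable_fun_ler => //; exact: measurable_id.
apply: continuous_measurable_fun => t; apply: cvgM; first exact: cvg_cst.
apply: cvgV; first by rewrite gt_eqF// mulr_gt0// mulr_gt0.
apply: cvgM; last exact: sqrt_max_continuous.
by apply: cvgM; [exact: cvg_cst|exact: max_continuous].
Qed.

Lemma measurable_pvel : mfun pvel.
Proof.
apply: measurable_fun_ifT => //; last exact: measurable_psigma.
by apply: measurable_fun_ler => //; exact: measurable_id.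
Qed.

Lemma psigma_anti s t : s <= t -> psigma t <= psigma s.
Proof.
move=> st; rewrite /psigma ler_pM2l ?pc_gt0// lef_pV2 ?posrE ?mulr_gt0//.
rewrite ler_pM2l// ler_sqrt ?max_gt0//; last exact: ltW.
by rewrite ge_max le_max st /= le_max lexx orbT.
Qed.

Lemma psigma_le_s0 t : psigma t <= ps0.
Proof.
have [ta|ta] := leP t (2 * a); first by rewrite psigma_le.
by rewrite -(psigma_le (lexx (2 * a))); apply: psigma_anti; exact: ltW.
Qed.

Lemma pkappa_le t : pkappa t <= pc / (4 * (2 * a) * pq).
Proof.
rewrite /pkappa; case: ifP => _.
  by apply: ltW; rewrite divr_gt0 ?pc_gt0// mulr_gt0 ?pq_gt0// mulr_gt0// mulr_gt0.
rewrite ler_pM2l ?pc_gt0// lef_pV2 ?posrE; last 2 first.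
- by rewrite mulr_gt0// mulr_gt0.
- by rewrite mulr_gt0 ?pq_gt0// mulr_gt0// mulr_gt0.
have m2 : 2 * a <= Num.max t (2 * a) by rewrite le_max lexx orbT.
apply: ler_pM => //.
- by rewrite mulr_ge0// mulr_ge0// ltW.
- exact: ltW pq_gt0.
- by rewrite ler_pM2l.
- by rewrite /pq ler_sqrt//; exact: ltW.
Qed.

Lemma pvel_bound t : `|pvel t| <= 3 * ps0.
Proof.
have := ps0_gt0; rewrite /pvel; case: ifP => _ s0.
  by rewrite ger0_norm// mulr_ge0// ltW.
rewrite gtr0_norm ?psigma_gt0// (le_trans (psigma_le_s0 t))//; lra.
Qed.

Lemma pvel_integrable s t : sintegrable s t pvel.
Proof.
by apply: (sintegrable_le measurable_pvel (sintegrable_cst s t (3 * ps0))) => x _; exact: pvel_bound.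
Qed.

Lemma pkappa_integrable s t : sintegrable s t pkappa.
Proof.
apply: (sintegrable_le measurable_pkappa (sintegrable_cst s t (pc / (4 * (2 * a) * pq)))) => x _.
by rewrite ger0_norm ?pkappa_ge0// pkappa_le.
Qed.

Lemma sint_pkappa u w : u <= w -> sint u w pkappa = psigma u - psigma w.
Proof.
rewrite le_eqVlt => /predU1P[->|uw]; first by rewrite sint_pt subrr.
pose Q (u w : R) := sint u w pkappa = psigma u - psigma w.
apply: (@interval_property_of_nodes R Q u w [:: 2 * a]); rewrite ?lexx//.
  move=> p r s up pr rs sw; rewrite /Q => h1 h2.
  by rewrite (sint_cat (pkappa_integrable p s) (ltW pr) (ltW rs)) h1 h2; ring.
move=> p s up ps sw nf; have nf1 : ~~ (p < 2 * a < s) by apply: nf; rewrite inE.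
have [sa|as_] := leP s (2 * a).
  rewrite /Q !psigma_le//; last exact: le_trans (ltW ps) sa.
  rewrite (sint_eq (pkappa_integrable p s) (g := fun=> 0)); last first.
    by move=> x /andP[_ xs]; rewrite /pkappa (le_trans (ltW xs) sa).
  by rewrite (sint_cst _ (ltW ps)) mul0r subrr.
have ap : 2 * a <= p by move: nf1; rewrite as_ andbT -leNgt.
have p0 : 0 < p by apply: lt_le_trans ap; rewrite mulr_gt0.
rewrite /Q !psigma_ge//; last exact: ltW.
rewrite (sint_eq (pkappa_integrable p s) (g := fun x => pc / (4 * x * Num.sqrt x))); last first.
  move=> x /andP[px xs]; have ax : 2 * a < x by exact: le_lt_trans px.
  by rewrite /pkappa leNgt ax /= max_l// ltW.
have dF x : p <= x <= s ->
    is_derive x 1 (fun x : R => - (pc * (2 * Num.sqrt x)^-1)) (pc / (4 * x * Num.sqrt x)).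
  move=> /andP[px _]; have x0 : 0 < x by exact: lt_le_trans px.
  have sx : 0 < Num.sqrt x by rewrite sqrtr_gt0.
  have e : - (pc * (- (2 * Num.sqrt x) ^- 2 * (2 * (2 * Num.sqrt x)^-1)))
     = pc / (4 * x * Num.sqrt x).
    rewrite -[in RHS](sqr_sqrtr (ltW x0)); move: sx; move: (Num.sqrt x) => y y0.
    have [->|z0] := eqVneq (Num.sqrt (y ^+ 2)) y; first by field; rewrite gt_eqF.
    by move: z0; rewrite sqrtr_sqr gtr0_norm// eqxx.
  have D1 : is_derive x 1 (fun y : R => 2 * Num.sqrt y) (2 * (2 * Num.sqrt x)^-1).
    exact: (is_deriveZ 2 (is_derive1_sqrt x0)).
  have nz : 2 * Num.sqrt x != 0 by rewrite gt_eqF// mulr_gt0.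
  by rewrite -e; exact: (is_deriveN (is_deriveZ pc (is_deriveV (f := fun y => 2 * Num.sqrt y) nz D1))).
have cf x : p <= x <= s -> {for x, continuous (fun x : R => pc / (4 * x * Num.sqrt x))}.
  move=> /andP[px _]; have x0 : 0 < x by exact: lt_le_trans px.
  have sx : 0 < Num.sqrt x by rewrite sqrtr_gt0.
  apply: cvgM; first exact: cvg_cst.
  apply: cvgV; first by rewrite gt_eqF// mulr_gt0// mulr_gt0.
  apply: cvgM; last exact: sqrt_continuous.
  by apply: cvgM; [exact: cvg_cst|exact: cvg_id].
by have [_ ->] := sint_derive ps dF cf; ring.
Qed.

(** A shear of space-time changes Dirichlet costs only by a term in the endpoints. The slope [pc] is
    the one for which the velocity after time a is [psigma] itself. *)
Definition sheared (t : R) : R := Fcurve a t + pc * t.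

Lemma sheared_left t : t <= a -> sheared t = 3 * ps0 * t.
Proof.
move=> ta; rewrite /sheared /Fcurve ta /pc.
have := ps0E; have h := a0 => e.
have an : a != 0 by rewrite gt_eqF.
have -> : a^-1 = ps0 * (3 - 2 * pq) by apply: (mulIf an); rewrite mulVf.
ring.
Qed.

Let xBE : xB a = 4 * ps0 * a * (1 - pq).
Proof.
have d := pden_gt0; have h := a0; rewrite /xB /ps0 -/pq.
by field; rewrite !gt_eqF.
Qed.

Lemma sheared_mid t : a <= t -> t <= 2 * a -> sheared t = ps0 * (t + 2 * a).
Proof.
rewrite le_eqVlt => /predU1P[<- _|at_ ta]; first by rewrite sheared_left//; ring.
rewrite /sheared /Fcurve leNgt at_ /= /tB ta xBE /pc.
have h := a0; have e := ps0E.
have ia : a^-1 = ps0 * (3 - 2 * pq).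
  have an : a != 0 by rewrite gt_eqF.
  by apply: (mulIf an); rewrite mulVf.
have -> : 2 * a - a = a by ring.
rewrite ia.
have -> : (4 * ps0 * a * (1 - pq) - 1) * (t - a) * (ps0 * (3 - 2 * pq)) =
  4 * ps0 * (1 - pq) * (t - a) * (ps0 * (3 - 2 * pq) * a) - (t - a) * (ps0 * (3 - 2 * pq)).
  by ring.
by rewrite e; move: e; lra.
Qed.

Lemma sheared_right t : 2 * a <= t -> sheared t = pc * Num.sqrt t.
Proof.
rewrite le_eqVlt => /predU1P[<-|at_].
  rewrite sheared_mid//; last by have h := a0; lra.
  by rewrite -/pq /pc; have := pq2; move=> <-; ring.
have h := a0; have at' : a < t by lra.
rewrite /sheared /Fcurve leNgt at' /= leNgt at_ /= xBE /pc /tB -/pq.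
have := pq_gt0; have := pq_lt1; have := pq2 => q2 q1 q0.
rewrite -q2 (_ : 4 * ps0 * a = 2 * ps0 * pq ^+ 2); last by rewrite q2; ring.
by field; rewrite gt_eqF//; nra.
Qed.

Lemma sint_pvel u w : u <= w -> sint u w pvel = sheared w - sheared u.
Proof.
rewrite le_eqVlt => /predU1P[->|uw]; first by rewrite sint_pt subrr.
pose Q (u w : R) := sint u w pvel = sheared w - sheared u.
apply: (@interval_property_of_nodes R Q u w [:: a; 2 * a]); rewrite ?lexx//.
  move=> p r s up pr rs sw; rewrite /Q => h1 h2.
  by rewrite (sint_cat (pvel_integrable p s) (ltW pr) (ltW rs)) h1 h2; ring.
move=> p s up ps sw nf; have nf1 : ~~ (p < a < s) by apply: nf; rewrite !inE eqxx.
have nf2 : ~~ (p < 2 * a < s) by apply: nf; rewrite !inE eqxx orbT.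
have h := a0; have [sa|as_] := leP s a.
  rewrite /Q !sheared_left//; last exact: le_trans (ltW ps) sa.
  rewrite (sint_eq (pvel_integrable p s) (g := fun=> 3 * ps0)); last first.
    by move=> x /andP[_ xs]; rewrite /pvel (le_trans (ltW xs) sa).
  by rewrite (sint_cst _ (ltW ps)); ring.
have ap : a <= p by move: nf1; rewrite as_ andbT -leNgt.
have velE x : p < x < s -> pvel x = psigma x.
  by move=> /andP[px _]; rewrite /pvel leNgt (le_lt_trans ap px).
have [sa|as2] := leP s (2 * a).
  rewrite /Q (sheared_mid (ltW as_) sa) (sheared_mid ap (le_trans (ltW ps) sa)).
  rewrite (sint_eq (pvel_integrable p s) (g := fun=> ps0)); last first.
    move=> x px; rewrite velE// psigma_le//; move: px => /andP[_ xs].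
    exact: le_trans (ltW xs) sa.
  by rewrite (sint_cst _ (ltW ps)); ring.
have ap2 : 2 * a <= p by move: nf2; rewrite as2 andbT -leNgt.
have p0 : 0 < p by lra.
rewrite /Q !sheared_right//; last exact: ltW.
rewrite (sint_eq (pvel_integrable p s) (g := fun x => pc * (2 * Num.sqrt x)^-1)); last first.
  by move=> x /[dup] px /andP[h1 _]; rewrite velE// psigma_ge//; lra.
have dF x : p <= x <= s -> is_derive x 1 (fun x : R => pc * Num.sqrt x) (pc * (2 * Num.sqrt x)^-1).
  move=> /andP[px _]; have x0 : 0 < x by exact: lt_le_trans px.
  exact: (is_deriveZ pc (is_derive1_sqrt x0)).
have cf x : p <= x <= s -> {for x, continuous (fun x : R => pc * (2 * Num.sqrt x)^-1)}.
  move=> /andP[px _]; have x0 : 0 < x by exact: lt_le_trans px.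
  apply: cvgM; first exact: cvg_cst.
  apply: cvgV; first by rewrite gt_eqF// mulr_gt0// sqrtr_gt0.
  by apply: cvgM; [exact: cvg_cst|exact: sqrt_continuous].
by have [_ ->] := sint_derive ps dF cf.
Qed.

End OptimalProfile.

(** * Mass and energy of the optimal curve *)

Section OptimalCurve.
Variable R : realType.
Notation mu := (@lebesgue_measure R).
Notation mfun f := (measurable_fun [set: R] f).
Variable a : R.
Hypothesis a0 : 0 < a.
Hypothesis a1 : a < 1 / 2.

Notation F := (Fcurve a).
Notation Fh := (sheared a).
Notation s0 := (ps0 a).
Notation cc := (pc a).
Notation sg := (psigma a).
Notation ka := (pkappa a).
Notation B := (pvel a).

Lemma Imin_s0 : Imin a = 8 / 3 * s0 ^+ 2.
Proof.
have e := ps0E a0 a1; have d := pden_gt0 a0 a1; have h := a0.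
rewrite /Imin /ps0 -/(pq a); field; rewrite !gt_eqF//.
Qed.

Lemma pc2 : cc ^+ 2 = 8 * a * s0 ^+ 2.
Proof. by rewrite /pc !exprMn (pq2 a0); ring. Qed.

Lemma psigma1 : sg 1 = cc / 2.
Proof. by rewrite psigma_ge ?sqrtr1 ?mulr1//; have h := a1; lra. Qed.

Definition prho (t : R) : R := sg t ^+ 2.

Lemma prho_density : density prho.
Proof. by split=> [t|]; [exact: sqr_ge0|exact: sqr_measurable (measurable_psigma a0)]. Qed.

Lemma bounded_integrable (f : R -> R) C s t : mfun f -> (forall x, `|f x| <= C) ->
  sintegrable s t f.
Proof. by move=> mf fC; apply: (sintegrable_le mf (sintegrable_cst s t C)) => x _. Qed.

Lemma prho_le t : prho t <= s0 ^+ 2.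
Proof.
have h := psigma_gt0 a0 a1 t; have h2 := psigma_le_s0 a0 a1 t; have h3 := ps0_gt0 a0 a1.
by rewrite ler_sqr ?nnegrE// ltW.
Qed.

Lemma prho_integrable s t : sintegrable s t prho.
Proof.
apply: (@bounded_integrable _ (s0 ^+ 2)); first by have [] := prho_density.
by move=> x; rewrite ger0_norm ?sqr_ge0// prho_le.
Qed.

Lemma prho32 t : prho t `^ (3 / 2) = sg t ^+ 3.
Proof. by rewrite powR32E ?sqr_ge0// sqrtr_sqr gtr0_norm// psigma_gt0. Qed.

Lemma psigma3_integrable s t : sintegrable s t (fun x => sg x ^+ 3).
Proof.
apply: (@bounded_integrable _ (s0 ^+ 3)); first by apply: measurable_funX; exact: measurable_psigma.
move=> x; have h := psigma_gt0 a0 a1 x; have h2 := psigma_le_s0 a0 a1 x.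
rewrite ger0_norm; last by apply: exprn_ge0; exact: ltW.
by apply: lerXn2r => //; rewrite nnegrE ltW//; exact: ps0_gt0.
Qed.

(** Beyond 2a the cube of [psigma] is pc^2 / 2 times [pkappa], whose integral telescopes; [ps0E]
    then collapses the sum. Multiplied by 4/3 this is [Imin a]. *)
Lemma sint_psigma3 : sint 0 1 (fun x => sg x ^+ 3) = 2 * s0 ^+ 2.
Proof.
have h := a0; have h1 := a1; have a2 : 0 <= 2 * a by lra.
rewrite (sint_cat (psigma3_integrable 0 1) a2); last by lra.
rewrite (sint_eq (psigma3_integrable 0 (2 * a)) (g := fun=> s0 ^+ 3)); last first.
  by move=> x /andP[_ xa]; rewrite psigma_le// ltW.
rewrite (sint_eq (psigma3_integrable (2 * a) 1) (g := fun x => cc ^+ 2 / 2 * ka x)); last first.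
  move=> x /andP[ax _]; rewrite /pkappa leNgt ax /= psigma_ge ?ltW// max_l ?ltW//.
  have x0 : 0 < x by lra.
  have sx : 0 < Num.sqrt x by rewrite sqrtr_gt0.
  rewrite -[X in 4 * X](sqr_sqrtr (ltW x0)); move: sx; move: (Num.sqrt x) => y y0.
  by field; rewrite gt_eqF.
rewrite sintZ; last exact: pkappa_integrable.
rewrite sint_cst// sint_pkappa//; last by lra.
rewrite psigma_le// psigma1 subr0.
have := ps0E a0 a1; rewrite /pc => e.
have -> : s0 ^+ 3 * (2 * a) + (2 * pq a * s0) ^+ 2 / 2 * (s0 - 2 * pq a * s0 / 2)
   = s0 ^+ 3 * (2 * a) + 2 * (pq a) ^+ 2 * s0 ^+ 3 * (1 - pq a) by field.
rewrite (pq2 a0).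
have -> : s0 ^+ 3 * (2 * a) + 2 * (2 * a) * s0 ^+ 3 * (1 - pq a)
  = 2 * s0 ^+ 2 * (s0 * (3 - 2 * pq a) * a) by ring.
by rewrite e mulr1.
Qed.

Let vel_bound x : `|B x - cc| <= 3 * s0 + cc.
Proof.
have h := pc_gt0 a0 a1.
by rewrite (le_trans (ler_normB _ _))// lerD ?pvel_bound// gtr0_norm.
Qed.

Let mvel : mfun (fun x => B x - cc).
Proof. by apply: measurable_funB => //; exact: measurable_pvel. Qed.

Lemma vel_integrable s t : sintegrable s t (fun x => B x - cc).
Proof. exact: bounded_integrable mvel vel_bound. Qed.

Lemma vel2_integrable s t : sintegrable s t (fun x => (B x - cc) ^+ 2).
Proof.
apply: (@bounded_integrable _ ((3 * s0 + cc) ^+ 2)); first exact: sqr_measurable.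
move=> x; rewrite ger0_norm ?sqr_ge0// -(real_normK (num_real (B x - cc))).
have h := pc_gt0 a0 a1; have h' := ps0_gt0 a0 a1.
by rewrite ler_sqr ?nnegrE// addr_ge0//; [rewrite mulr_ge0// ltW|exact: ltW].
Qed.

Lemma Fcurve_sheared t : F t = Fh t - cc * t.
Proof. by rewrite /sheared addrK. Qed.

Lemma Fcurve_sint s t : s <= t -> F t - F s = sint s t (fun x => B x - cc).
Proof.
move=> st; rewrite sintB; [|exact: pvel_integrable|exact: sintegrable_cst].
rewrite (sint_cst _ st) (sint_pvel a0 a1 st) !Fcurve_sheared; ring.
Qed.

Lemma Fcurve_lipschitz s t : s <= t -> `|F t - F s| <= (3 * s0 + cc) * (t - s).
Proof.
move=> st; rewrite (Fcurve_sint st) -(sint_cst _ st) ler_norml; apply/andP; split.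
- rewrite -mulN1r -sintZ; last exact: sintegrable_cst.
  apply: sint_le; [by apply: sintegrableZ; exact: sintegrable_cst|exact: vel_integrable|].
  by move=> x _; have := vel_bound x; rewrite ler_norml => /andP[]; lra.
- apply: sint_le; [exact: vel_integrable|exact: sintegrable_cst|].
  by move=> x _; have := vel_bound x; rewrite ler_norml => /andP[].
Qed.

Lemma Fcurve_continuous : continuous F.
Proof.
move=> x; apply/cvgrPdist_lt => e e0.
have L0 : 0 < 3 * s0 + cc by have := pc_gt0 a0 a1; have := ps0_gt0 a0 a1; lra.
have d0 : 0 < e / (3 * s0 + cc) by rewrite divr_gt0.
apply: (filterS _ (nbhsx_ballx x _ d0)) => y; rewrite /ball /= => xy.
have [h|h] := leP x y.
  rewrite distrC; apply: le_lt_trans (Fcurve_lipschitz h) _.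
  by rewrite mulrC -ltr_pdivlMr//; move: xy; rewrite ltr_norml => /andP[]; lra.
apply: le_lt_trans (Fcurve_lipschitz (ltW h)) _.
by rewrite mulrC -ltr_pdivlMr//; move: xy; rewrite ltr_norml => /andP[]; lra.
Qed.

Lemma Fcurve_abs_cont s t : abs_cont s t F.
Proof.
move=> e e0.
have L0 : 0 < 3 * s0 + cc by have := pc_gt0 a0 a1; have := ps0_gt0 a0 a1; lra.
exists (e / (3 * s0 + cc)); first by rewrite divr_gt0.
move=> l nl _ ld; apply: (@le_lt_trans _ _ ((3 * s0 + cc) * \sum_(p <- l) (p.2 - p.1))).
  rewrite mulr_sumr {ld}; elim: l s nl => [|[p q] l ih] u; first by rewrite !big_nil.
  move=> /= /andP[/andP[_ pq] nl]; rewrite !big_cons lerD//.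
    by apply: Fcurve_lipschitz; exact: ltW.
  exact: ih nl.
by rewrite mulrC -ltr_pdivlMr.
Qed.

(** The velocity is continuous except for its jump at a, so the primitive is differentiable there
    with the expected value. The points s, t and a form the null set on which [derive1] is left
    aside. *)
Lemma Fcurve_energy s t : 0 <= s -> s <= t ->
  energy F s t = (sint s t (fun x => (B x - cc) ^+ 2))%:E.
Proof.
move=> s_0 st; rewrite /energy asboolT; last exact: Fcurve_abs_cont.
rewrite -(sintE (vel2_integrable s t)).
have m2 (x y : R) : measurable ([set x; y] : set (measurableTypeR R)).
  by apply: measurableU.
have mN : measurable ([set s; t] `|` [set a; a] : set (measurableTypeR R)).
  by apply: measurableU; exact: m2.
apply: (integral_ae_eq_nonmeasurable (N := [set s; t] `|` [set a; a])) => //.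
- have z (x : R) : (mu [set x] <= 0)%E.
    by rewrite le_eqVlt; apply/orP; left; apply/eqP; exact: lebesgue_measure_set1.
  have z2 (x y : R) : (mu [set x; y] <= 0)%E.
    apply: le_trans (measureU2 _ _ _) _ => //.
    by rewrite -[X in (_ <= X)%E]adde0; exact: (leeD (z x) (z y)).
  apply/eqP; rewrite eq_le measure_ge0 andbT.
  apply: le_trans (measureU2 _ _ _) _; [exact: m2|exact: m2|].
  by rewrite -[X in (_ <= X)%E]adde0; exact: (leeD (z2 _ _) (z2 _ _)).
- by move=> x; exact: sqr_ge0.
- by move=> x; exact: sqr_ge0.
- exact: sqr_measurable.
move=> x /=; rewrite in_itv/= => /andP[sx xt] Nx; congr (_ ^+ 2).
have sx' : s < x by rewrite lt_neqAle sx andbT; apply/eqP => e; apply: Nx; left; left.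
have xa : x != a by apply/eqP => e; apply: Nx; right; left.
have cont : {for x, continuous (fun x => B x - cc)}.
  apply: cvgB; last exact: cvg_cst.
  have [h|h] := ltP x a.
    rewrite /prop_for /continuous_at (_ : B x = 3 * s0); last by rewrite /pvel ltW.
    apply: cvg_near_cst; near=> y; rewrite /pvel ifT//.
    by near: y; exact: (lt_le_nbhsl h).
  have h' : a < x by rewrite lt_neqAle eq_sym xa.
  rewrite /prop_for /continuous_at (_ : B x = sg x); last by rewrite /pvel leNgt h'.
  apply: cvg_trans; last exact: (psigma_continuous a0).
  apply: near_eq_cvg; near=> y; rewrite /pvel ifF//.
  by apply/negbTE; rewrite -ltNge; near: y; exact: (lt_nbhsr h').
have x1 : x < x + 1 by rewrite ltrDl.
have [_ <-] := continuous_FTC1_closed x1 (vel_integrable s (x + 1)) sx' cont.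
apply: (derive1_near_shift (k := F s)); near=> y.
rewrite -[LHS]/(sint s y (fun x => B x - cc)) -Fcurve_sint//.
by apply: ltW; near: y; exact: (lt_nbhsr sx').
Unshelve. all: by end_near. Qed.

End OptimalCurve.

Lemma sqr_div_convex (R : realType) (x y p q : R) : 0 < p -> 0 < q ->
  - (x ^+ 2 / p) - y ^+ 2 / q <= - ((x + y) ^+ 2 / (p + q)).
Proof.
move=> p0 q0; have pq0 : 0 < p + q by exact: addr_gt0.
rewrite -subr_ge0.
suff -> : - ((x + y) ^+ 2 / (p + q)) - (- (x ^+ 2 / p) - y ^+ 2 / q)
  = (q * x - p * y) ^+ 2 / (p * q * (p + q)).
  by rewrite divr_ge0 ?sqr_ge0// ltW// !mulr_gt0.
by field; rewrite !gt_eqF.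
Qed.

Lemma smallest_above_eq_bounds (R : realType) (e : spacetime_fun R) E E' :
  (forall e', directed_metric e' -> (forall f, E f -> ge_on e' f) <-> (forall f, E' f -> ge_on e' f)) ->
  smallest_above e E -> smallest_above e E'.
Proof.
move=> H [de eD eE m]; split => //; first exact/H.
by move=> e' d' D' E'e'; apply: m => //; exact/H.
Qed.

(** * The metric planted along the optimal curve *)

Section OptimalMetric.
Variable R : realType.
Notation mfun f := (measurable_fun [set: R] f).
Variable a : R.
Hypothesis a0 : 0 < a.
Hypothesis a1 : a < 1 / 2.

Notation F := (Fcurve a).
Notation Fh := (sheared a).
Notation s0 := (ps0 a).
Notation cc := (pc a).
Notation B := (pvel a).

(** The gain accumulated along the curve since time 0. Its derivative is psigma^2 - (pvel - pc)^2,
    where psigma^2 - pvel^2 equals -8 ps0^2 before a and 0 after it. *)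
Definition potential (t : R) : R :=
  - (8 * s0 ^+ 2) * Num.min t a + 2 * cc * Fh t - cc ^+ 2 * t.
Notation U := potential.

Let defect (t : R) : R := if t <= a then - (8 * s0 ^+ 2) else 0.

Let defect_sint s t : s <= t -> sintegrable s t defect /\
  sint s t defect = - (8 * s0 ^+ 2) * (Num.min t a - Num.min s a).
Proof.
have left u w : u <= w -> w <= a -> sintegrable u w defect /\
    sint u w defect = - (8 * s0 ^+ 2) * (w - u).
  move=> uw wa; have e x : u < x < w -> - (8 * s0 ^+ 2) = defect x.
    by move=> /andP[_ xw]; rewrite /defect ifT// ltW// (lt_le_trans xw).
  have i := sintegrable_cst u w (- (8 * s0 ^+ 2)).
  by split; [exact: sintegrable_eq e|rewrite -(sint_eq i e) sint_cst].
have right u w : u <= w -> a <= u -> sintegrable u w defect /\ sint u w defect = 0.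
  move=> uw au; have e x : u < x < w -> 0 = defect x.
    by move=> /andP[ux _]; rewrite /defect ifF//; apply/negbTE; rewrite -ltNge (le_lt_trans au).
  have i := sintegrable_cst u w 0.
  by split; [exact: sintegrable_eq e|rewrite -(sint_eq i e) sint_cst// mul0r].
move=> st; have [ta|at_] := leP t a.
  by rewrite (min_l (le_trans st ta)); exact: left.
have [as_|sa] := leP a s.
  by rewrite subrr mulr0; exact: right.
have [i1 e1] := left _ _ (ltW sa) (lexx a).
have [i2 e2] := right _ _ (ltW at_) (lexx a).
have md : mfun defect.
  by apply: measurable_fun_ifT => //; apply: measurable_fun_ler => //; exact: measurable_id.
have i := sintegrable_cat md i1 i2 (ltW sa) (ltW at_).
by split=> //; rewrite (sint_cat i (ltW sa) (ltW at_)) e1 e2 addr0.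
Qed.

Lemma gain_Fcurve s t : s <= t ->
  sint s t (prho a) - sint s t (fun x => (B x - cc) ^+ 2) = U t - U s.
Proof.
move=> st; have [di de] := defect_sint st.
have iB := pvel_integrable a0 a1 s t.
have i2 : sintegrable s t (fun x => 2 * cc * B x - cc ^+ 2).
  by apply: sintegrableB; [exact: sintegrableZ|exact: sintegrable_cst].
rewrite -sintB; [|exact: prho_integrable|exact: vel2_integrable].
have e x : s < x < t -> defect x + (2 * cc * B x - cc ^+ 2) = prho a x - (B x - cc) ^+ 2.
  move=> _; rewrite /defect /prho /pvel; case: leP => xa; last by ring.
  by rewrite psigma_le//; [ring|have h := a0; lra].
rewrite -(sint_eq (sintegrableD di i2) e) sintD// de sintB//;
  [|exact: sintegrableZ|exact: sintegrable_cst].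
rewrite sintZ// sint_cst// (sint_pvel a0 a1 st) /U; ring.
Qed.

Lemma plant_Fcurve s t : 0 <= s -> s <= t -> t <= 1 ->
  plant_metric 0 1 F (prho a) (F s) s (F t) t = (U t - U s)%:E.
Proof.
move=> s_0 st t1; rewrite /plant_metric s_0 t1 !eqxx/=.
rewrite (Fcurve_energy a0 a1 s_0 st) (sintE (prho_integrable a0 a1 s t)).
by rewrite -EFinB gain_Fcurve.
Qed.

(** After multiplication by t - s and shearing, the terms in [pc] cancel; what remains is a perfect
    square or a sum of nonnegative terms in each regime. This is why a competitor cannot profit from
    leaving the curve and rejoining it later. *)
Lemma potential_slope (s t : R) : 0 <= s -> s < t -> t <= 1 ->
  - ((F t - F s) ^+ 2 / (t - s)) <= U t - U s.
Proof.
move=> s_0 st t1; have ts : 0 < t - s by rewrite subr_gt0.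
suff H : 0 <= (- (8 * s0 ^+ 2) * (Num.min t a - Num.min s a)) * (t - s) + (Fh t - Fh s) ^+ 2.
  rewrite -subr_ge0 /U !Fcurve_sheared -(pmulr_lge0 _ ts).
  apply: le_trans H _; rewrite le_eqVlt; apply/orP; left; apply/eqP.
  by field; rewrite gt_eqF.
have z0 := ps0_gt0 a0 a1; have h := a0.
have [as_|sa] := leP a s.
  have at_ : a <= t by exact: le_trans (ltW st).
  by rewrite (min_r at_) subrr mulr0 mul0r add0r sqr_ge0.
have [ta|at_] := leP t a.
  rewrite !sheared_left// ?(ltW sa)//.
  suff -> : - (8 * s0 ^+ 2) * (t - s) * (t - s) + (3 * s0 * t - 3 * s0 * s) ^+ 2
     = (s0 * (t - s)) ^+ 2 by exact: sqr_ge0.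
  by ring.
rewrite (sheared_left a0 a1 (ltW sa)).
have [ta|at2] := leP t (2 * a).
  rewrite (sheared_mid a0 a1 (ltW at_) ta).
  suff -> : - (8 * s0 ^+ 2) * (a - s) * (t - s) + (s0 * (t + 2 * a) - 3 * s0 * s) ^+ 2
     = (s0 * ((t - a) - (a - s))) ^+ 2 by exact: sqr_ge0.
  by ring.
rewrite (sheared_right a0 a1 (ltW at2)) /pc.
have t0 : 0 <= t by lra.
have tE := sqr_sqrtr t0.
have qw : pq a <= Num.sqrt t by rewrite ler_sqrt// ltW.
have q0 := pq_gt0 a0; have q2 := pq2 a0.
move: (Num.sqrt t) tE qw => w tE qw.
have aE : a = (pq a) ^+ 2 / 2 by rewrite q2; field.
move: q0 qw aE; move: (pq a) => q q0 qw aE.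
suff -> : - (8 * s0 ^+ 2) * (a - s) * (t - s) + (2 * q * s0 * w - 3 * s0 * s) ^+ 2
  = s0 ^+ 2 * (s * (s + 4 * ((w - q) * (2 * w - q)))).
  rewrite mulr_ge0 ?sqr_ge0// mulr_ge0// addr_ge0// mulr_ge0// mulr_ge0//; lra.
move: (s0) => z; rewrite -tE aE; by field.
Qed.

Lemma potential0 : U 0 = 0.
Proof.
have h := a0; rewrite /U min_l ?sheared_left// ?(ltW h)//; ring.
Qed.

(** The identity pc^2 = 8 a ps0^2 makes the whole curve tie with the path resting at 0, of Dirichlet
    cost 0; the curve is a geodesic with nothing to spare. *)
Lemma potential1 : U 1 = 0.
Proof.
have h := a1; have h0 := a0; rewrite /U min_r ?sheared_right// ?sqrtr1; [|lra|lra].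
have := pc2 a0; move=> e; have : cc * cc = 8 * a * s0 ^+ 2 by rewrite -e; ring.
by move=> e'; rewrite e; lra.
Qed.

Lemma Fcurve0 : F 0 = 0.
Proof. by rewrite /Fcurve (ltW a0) mul0r. Qed.

Lemma Fcurve1 : F 1 = 0.
Proof.
have h := a1; rewrite /Fcurve /tB sqrtr1 subrr mulr0 mul0r ifF; last by apply/negbTE; lra.
by rewrite ifF//; apply/negbTE; lra.
Qed.

Lemma Fcurve_a : F a = 1.
Proof. by rewrite /Fcurve lexx divff// gt_eqF. Qed.

(* A single curve as a countable family: the others live on the empty interval [1, 0]. *)
Definition one_lo (i : nat) : R := if i == 0%N then 0 else 1.
Definition one_hi (i : nat) : R := if i == 0%N then 1 else 0.

Notation family := (optimal_gain one_lo one_hi (fun=> F) (fun=> prho a)).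
Definition optimal_metric : spacetime_fun R := fun x s y t => (family x s y t)%:E.

Lemma one_rhoD : forall i : nat, density ((fun=> prho a) i).
Proof. by move=> i; exact: prho_density. Qed.

Lemma one_mass : mass one_lo one_hi (fun=> prho a) = (2 * s0 ^+ 2)%:E.
Proof.
rewrite /mass (nneseries_split 0 1); last by move=> k _; apply: integral_ge0 => x _; rewrite lee_fin powR_ge0.
rewrite add0n big_nat1 eseries0; last first.
  move=> i i1 _; rewrite /one_lo /one_hi gtn_eqF// set_itv_ge ?integral_set0// bnd_simp.
  by rewrite -ltNge ltr01.
rewrite adde0 /one_lo /one_hi /=.
under eq_integral do rewrite prho32//.
by rewrite (sintE (psigma3_integrable a0 a1 0 1)) sint_psigma3.
Qed.

Lemma one_massK : (mass one_lo one_hi (fun=> prho a) <= (2 * s0 ^+ 2)%:E)%E.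
Proof. by rewrite one_mass. Qed.

Lemma optimal_metric_range : smallest_above optimal_metric
  (range (fun i => plant_metric (one_lo i) (one_hi i) F (prho a))).
Proof. exact (optimal_gain_smallest (fun=> F) one_rhoD one_massK). Qed.

Lemma optimal_metric_smallest : smallest_above optimal_metric [set plant_metric 0 1 F (prho a)].
Proof.
apply: smallest_above_eq_bounds optimal_metric_range => e' _; split=> H f.
  by move=> ->; apply: H; exists 0%N.
case=> -[|i] _ <-; first by apply: H.
move=> x s y t st; rewrite /plant_metric /one_lo /one_hi /= ifF ?leNye//.
by apply/negbTE/negP => /and4P[s1 t0 _ _]; lra.
Qed.

Lemma optimal_metric_directed : directed_metric optimal_metric.
Proof. by have [] := optimal_metric_range. Qed.

Lemma optimal_metric_Fcurve s t : 0 <= s -> s < t -> t <= 1 ->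
  U t - U s <= family (F s) s (F t) t.
Proof.
move=> s_0 st t1; rewrite -lee_fin -(plant_Fcurve s_0 (ltW st) t1).
by have [_ _ H _] := optimal_metric_smallest; exact: (H _ erefl).
Qed.

Let dt (tau x u : R) : R := if tau < u then - ((x - F tau) ^+ 2 / (u - tau)) else 0.

(* Time [tau] is the last one at which the competitor is assumed to touch [F]; it is
   credited with the straight segment from there. *)
Let reach (c v : R -> R) (lab : R -> nat) (u w : R) := forall tau, 0 <= tau -> tau <= u ->
  (tau = u -> c u = F u) -> exists tau', [/\ 0 <= tau', tau' <= w, (tau' = w -> c w = F w) &
    dt tau (c u) u + gain (fun=> prho a) u w v lab <= U tau' - U tau + dt tau' (c w) w].

(** On a free piece tau is kept and two segments merge by [sqr_div_convex]. On a piece along the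
    curve tau moves to the end w, and [potential_slope] bounds the segment credited so far. *)
Let traj_reach c v lab : traj one_lo one_hi (fun=> F) 0 1 c v lab -> reach c v lab 0 1.
Proof.
move=> T; have [l pl] := traj_nodes T.
apply: (@interval_property_of_nodes R (reach c v lab) 0 1 l); rewrite ?lexx ?ltr01//.
  move=> u r w u_0 ur rw w1 H1 H2 tau t0 tu tc.
  have [t1 [t1_0 t1r t1c h1]] := H1 tau t0 tu tc.
  have [t2 [t2_0 t2w t2c h2]] := H2 t1 t1_0 t1r t1c.
  exists t2; split => //.
  have T' := traj_sub T u_0 (lt_trans ur rw) w1.
  rewrite (gain_split one_rhoD one_massK T' (ltW ur) (ltW rw)).
  by move: h1 h2; rewrite -/(U tau) -/(U t1) -/(U t2); move: (gain _ _ _ _ _) (gain _ _ _ _ _); move: (dt _ _ _) (dt _ _ _) (dt _ _ _) (U tau) (U t1) (U t2) => *; lra.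
move=> u w u_0 uw w1 nf tau t0 tu tc; have T' := traj_sub T u_0 uw w1.
have [i2 e1 [z|[i [l1 l2 ci li en]]]] := pl _ _ u_0 uw w1 nf.
  exists tau; split => //; [exact: le_trans (ltW uw)|by move=> tw; move: tu; rewrite tw leNgt uw|].
  have -> : gain (fun=> prho a) u w v lab = - sint u w (fun x => v x ^+ 2).
    rewrite /gain -(sint_eq (sintegrable_cst u w 0)) ?sint_cst ?(ltW uw)// ?mul0r ?sub0r//.
    by move=> x ux; rewrite /label_density z.
  have := traj_dist T'; rewrite subrr add0r /dt (le_lt_trans tu uw) => h.
  have [tu'|ut] := ltP tau u; last first.
    have tuE : tau = u by apply/eqP; rewrite eq_le tu ut.
    by rewrite tuE -(tc tuE) add0r lerN2.
  have := @sqr_div_convex R (c u - F tau) (c w - c u) (u - tau) (w - u).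
  rewrite !subr_gt0 => /(_ tu' uw).
  have -> : c u - F tau + (c w - c u) = c w - F tau by ring.
  have -> : u - tau + (w - u) = w - tau by ring.
  by apply: le_trans; rewrite lerD2l lerN2.
have i_0 : i = 0%N.
  by apply/eqP/negPn/negP => i0; have := l1; have := l2; rewrite /one_lo /one_hi (negbTE i0); lra.
exists w; split => //; [exact: le_trans (ltW uw)|by move=> _; rewrite ci// lexx (ltW uw)|].
have -> : gain (fun=> prho a) u w v lab = U w - U u.
  rewrite -(gain_Fcurve (ltW uw)) /gain; congr (_ - _).
    rewrite -(sint_eq (prho_integrable a0 a1 u w))// => x ux.
    by rewrite /label_density li.
  by apply: EFin_inj; rewrite -en Fcurve_energy// ltW.
rewrite /dt ltxx addr0; have [tu'|ut] := ltP tau u; last first.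
  by rewrite (_ : tau = u) ?add0r//; apply/eqP; rewrite eq_le tu ut.
have := potential_slope t0 tu' (le_trans (ltW uw) w1).
rewrite (ci u) ?lexx ?(ltW uw)//; move: (_ / _) (U tau) (U u) (U w) => *; lra.
Qed.

Lemma optimal_metric_01 : family 0 0 0 1 = 0.
Proof.
apply/eqP; rewrite eq_le; apply/andP; split; last first.
  have := optimal_metric_Fcurve (lexx 0) ltr01 (lexx 1).
  by rewrite Fcurve0 Fcurve1 potential0 potential1 subrr.
apply: (optimal_gain_le one_rhoD one_massK ltr01) => c v lab T c0 c1.
have c0F : (0 : R) = 0 -> c 0 = F 0 by rewrite c0 Fcurve0.
have [tau [t0 t1 tc]] := traj_reach T (lexx 0) (lexx 0) c0F.
rewrite /dt ltxx add0r potential0 subr0 => h; apply: le_trans h _.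
have [t1'|t1'] := ltP tau 1; last first.
  by rewrite (_ : tau = 1) ?potential1 ?addr0//; apply/eqP; rewrite eq_le t1 t1'.
have := potential_slope t0 t1' (lexx 1).
by rewrite c1 Fcurve1 potential1; move: (_ / _) (U tau) => *; lra.
Qed.

Lemma psum_Fcurve (ts : seq R) (r : R) : 0 <= r -> path <%R r ts -> last r ts <= 1 ->
  ((U (last r ts) - U r)%:E <= psum optimal_metric F r ts)%E.
Proof.
elim: ts r => [|t ts ih] r r0 /=; first by rewrite subrr.
move=> /andP[rt pt] l1; have t0 : 0 <= t by exact: le_trans (ltW rt).
have tl : t <= last t ts.
  elim: ts t pt {ih l1 rt t0} => //= p ts ih t /andP[tp pp].
  exact: le_trans (ltW tp) (ih _ pp).
have := leeD _ (ih _ t0 pt l1) => /(_ (U t - U r)%:E (optimal_metric (F r) r (F t) t)).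
rewrite -EFinD (_ : U t - U r + (U (last t ts) - U t) = U (last t ts) - U r); last by ring.
by apply; rewrite lee_fin; apply: optimal_metric_Fcurve => //; exact: le_trans l1.
Qed.

Lemma optimal_metric_geodesic : geodesic optimal_metric F 0 0 0 1.
Proof.
split; [exact: ltr01|exact: Fcurve0|exact: Fcurve1| |].
  by apply: continuous_subspaceT; exact: Fcurve_continuous.
rewrite /optimal_metric optimal_metric_01; apply/eqP; rewrite eq_le; apply/andP; split.
  apply: ereal_inf_lbound; exists [:: 1]; first by split => //=; rewrite ltr01.
  by rewrite /= Fcurve0 Fcurve1 /optimal_metric optimal_metric_01 adde0.
apply: le_ereal_inf_tmp => _ [ts [pts l1] <-].
have := psum_Fcurve (lexx 0) pts; rewrite l1 lexx potential0 potential1 subrr; exact.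
Qed.

Lemma optimal_metric_admissible : admissible a optimal_metric.
Proof.
split; first exact: optimal_metric_directed.
by exists F; split; [exact: optimal_metric_geodesic|exact: Fcurve_a].
Qed.

End OptimalMetric.

(** * Stability of the variational problem *)

Lemma sintegrable_extend (R : realType) (s t : R) (f : R -> R) : sintegrable s t f ->
  exists2 f' : R -> R, measurable_fun [set: R] f' & forall x, s <= x <= t -> f' x = f x.
Proof.
move=> fi; exists (f \_ `[s, t]).
  apply/(measurable_restrictT f); first exact: measurable_itv.
  by have /measurable_int/measurable_EFinP := fi.
by move=> x xst; rewrite patchE mem_set.
Qed.

Section Stability.
Variable R : realType.
Notation mfun f := (measurable_fun [set: R] f).
Variable a : R.
Hypothesis a0 : 0 < a.
Hypothesis a1 : a < 1 / 2.

Notation F := (Fcurve a).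
Notation s0 := (ps0 a).
Notation cc := (pc a).
Notation sg := (psigma a).
Notation ka := (pkappa a).
Notation B := (pvel a).

(** Integration by parts, with psigma(u) = psigma(t) plus the integral of [pkappa] over [u, t]. Read
    for a general f, it averages lower bounds on the integrals of f over [0, u]; read for the
    deviation, it trades velocity for displacement. *)
Lemma sint_psigma_mul (f : R -> R) (t : R) : 0 <= t -> sintegrable 0 t f ->
  [/\ sintegrable 0 t (fun u => ka u * sint 0 u f),
      sintegrable 0 t (fun u => sg u * f u) &
      sint 0 t (fun u => sg u * f u) = sg t * sint 0 t f + sint 0 t (fun u => ka u * sint 0 u f)].
Proof.
move=> t0 fi; have [f' mf' ff'] := sintegrable_extend fi.
have ff x : 0 < x < t -> f' x = f x by move=> /andP[x0 xt]; apply: ff'; rewrite !ltW.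
have ff1 x : 0 < x < t -> f x = f' x by move=> /ff.
have fi' : sintegrable 0 t f' by exact: sintegrable_eq ff1.
pose C := pc a / (4 * (2 * a) * pq a).
have kC x : `|ka x| <= C by rewrite ger0_norm ?pkappa_ge0// pkappa_le.
have [i1 [i2 e]] := sint_mul_tail t0 mf' (measurable_pkappa a0) fi' kC.
have e1 u : 0 < u < t -> ka u * sint 0 u f' = ka u * sint 0 u f.
  move=> /andP[u0 ut]; congr (_ * _); apply: sint_eq.
    by apply: (sintegrable_sub fi'); rewrite ?lexx// ltW.
  by move=> x /andP[x0 xu]; apply: ff; rewrite x0 (lt_trans xu).
have e2 u : 0 < u < t -> f' u * sint u t ka = sg u * f u - sg t * f u.
  by move=> /[dup] ut /andP[_ /ltW ut']; rewrite sint_pkappa// ff//; ring.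
have j : sintegrable 0 t (fun u => sg u * f u - sg t * f u) by exact: sintegrable_eq e2.
have jt := sintegrableZ (sg t) fi.
have j2 : sintegrable 0 t (fun u => sg u * f u).
  by apply: sintegrable_eq (sintegrableD j jt) _ => x _; ring.
split=> //; first exact: sintegrable_eq e1.
move: e; rewrite (sint_eq i1 e2) (sint_eq i2 e1) sintB// sintZ// => <-; ring.
Qed.

Variables (v r : R -> R) (eps : R).
Hypothesis r0 : forall x, 0 <= r x.
Hypothesis mv : mfun v.
Hypothesis ri : sintegrable 0 1 r.
Hypothesis r32i : sintegrable 0 1 (fun x => r x `^ (3 / 2)).
Hypothesis v2i : sintegrable 0 1 (fun x => v x ^+ 2).
Hypothesis va : sint 0 a v = 1.
Hypothesis v1 : sint 0 1 v = 0.
Hypothesis near_optimal : forall t : R, 0 < t -> t <= 1 ->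
  - ((sint 0 t v) ^+ 2 / t) - eps <= sint 0 t r - sint 0 t (fun x => v x ^+ 2).

Definition deviation (x : R) : R := v x - (B x - cc).
Notation dv := deviation.
Notation D t := (sint 0 t dv).

Lemma v_integrable : sintegrable 0 1 v.
Proof. exact: sintegrable_of_sqr. Qed.

Lemma measurable_deviation : mfun dv.
Proof.
apply: measurable_funB => //; apply: measurable_funB => //; exact: measurable_pvel.
Qed.

Lemma deviation2_integrable : sintegrable 0 1 (fun x => dv x ^+ 2).
Proof.
apply: (@sintegrable_le _ 0 1 _ (fun x => 2 * v x ^+ 2 + 2 * (B x - cc) ^+ 2)).
- exact: sqr_measurable measurable_deviation.
- by apply: sintegrableD; apply: sintegrableZ => //; exact: vel2_integrable.
- move=> x _; rewrite ger0_norm ?sqr_ge0// /dv.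
  by have := sqr_ge0 (v x + (B x - cc)); lra.
Qed.

Lemma deviation_integrable : sintegrable 0 1 dv.
Proof. exact: (sintegrable_of_sqr measurable_deviation deviation2_integrable). Qed.

Lemma sint_deviation t : 0 <= t -> t <= 1 -> D t = sint 0 t v - F t.
Proof.
move=> t0 t1; rewrite sintB; last exact: vel_integrable.
  by rewrite -(Fcurve_sint a0 a1 t0) Fcurve0// subr0.
by apply: (sintegrable_sub v_integrable).
Qed.

Let Da : D a = 0.
Proof. rewrite sint_deviation ?va ?Fcurve_a ?subrr//; have := a0; have := a1; lra. Qed.
Let D1 : D 1 = 0.
Proof. by rewrite sint_deviation ?v1 ?Fcurve1 ?subrr. Qed.

Let sub01 (t : R) (f : R -> R) : sintegrable 0 1 f -> t <= 1 -> sintegrable 0 t f.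
Proof. by move=> fi t1; exact: (sintegrable_sub fi). Qed.

Let s (x : R) := r x - sg x ^+ 2.
(** Subtracting the tie of the optimal curve from near-optimality at t leaves 4 psigma(t) D(t) - 2
    int psigma dv besides s, because F/t = 2 psigma - pc. Integration by parts of psigma(t) D(t)
    turns this into the integral of the last two terms of f. *)
Let f (x : R) := s x + (2 * (sg x * dv x) - 4 * (ka x * D x)).

Let si : sintegrable 0 1 s.
Proof. by apply: sintegrableB => //; exact: prho_integrable. Qed.

Let fi : sintegrable 0 1 f.
Proof.
have [i1 i2 _] := sint_psigma_mul ler01 deviation_integrable.
by apply: sintegrableD => //; apply: sintegrableB; exact: sintegrableZ.
Qed.

(** On [0, a] both [pvel] and [psigma] are constant, and the deviation integrates to 0 there because
    both curves pass through (1, a). The jump of the velocity at a therefore costs nothing. *)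
Let sint_B_deviation t : a <= t -> t <= 1 ->
  sintegrable 0 t (fun x => B x * dv x) /\ sint 0 t (fun x => B x * dv x) = sint 0 t (fun x => sg x * dv x).
Proof.
move=> at_ t1; have aa := ltW a0.
have [_ i2 _] := sint_psigma_mul ler01 deviation_integrable.
have di := sub01 deviation_integrable t1.
have iB : sintegrable 0 1 (fun x => B x * dv x).
  apply: (@sintegrable_le _ 0 1 _ (fun x => 3 * s0 * `|dv x|)).
  - apply: measurable_funM; first exact: measurable_pvel.
    exact: measurable_deviation.
  - by apply: sintegrableZ; exact: (integrable_norm deviation_integrable).
  - by move=> x _; rewrite normrM ler_wpM2r// pvel_bound.
split; first exact: sub01.
have ale1 : a <= 1 by exact: le_trans t1.
have iBt := sub01 iB t1; have ist := sub01 i2 t1.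
rewrite (sint_cat iBt aa at_) (sint_cat ist aa at_); congr (_ + _).
  rewrite -(@sint_eq _ 0 a (fun x => 3 * s0 * dv x)); last 2 first.
  - by apply: sintegrableZ; exact: sub01 deviation_integrable _.
  - by move=> x /andP[_ xa]; rewrite /pvel ltW.
  rewrite -(@sint_eq _ 0 a (fun x => s0 * dv x) (fun x => sg x * dv x)); last 2 first.
  - by apply: sintegrableZ; exact: sub01 deviation_integrable _.
  - by move=> x /andP[_ xa]; rewrite psigma_le//; have := a0; lra.
  by rewrite !sintZ ?Da ?mulr0//; exact: sub01 deviation_integrable _.
apply: sint_eq; first by exact: (sintegrable_sub iBt).
by move=> x /andP[ax _]; rewrite /pvel leNgt ax.
Qed.

(** The constraints are active from 2a on, which is precisely where [pkappa] is carried. *)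
Lemma potential_right t : 2 * a <= t -> potential a t = - (F t ^+ 2 / t).
Proof.
move=> at_; have t0 : 0 < t by have := a0; lra.
rewrite /potential min_r ?Fcurve_sheared ?sheared_right//; last by have := a0; lra.
have e := pc2 a0; have tE := sqr_sqrtr (ltW t0).
have w0 : 0 < Num.sqrt t by rewrite sqrtr_gt0.
move: (Num.sqrt t) tE w0 => w <- w0.
have -> : - (8 * s0 ^+ 2) * a = - cc ^+ 2 by rewrite e; ring.
by field; rewrite gt_eqF.
Qed.

Let f_lower t : 2 * a <= t -> t <= 1 -> - eps - D t ^+ 2 / t + sint 0 t (fun x => dv x ^+ 2) <= sint 0 t f.
Proof.
move=> at_ t1; have t0 : 0 < t by have := a0; lra.
have [i1 i2 _] := sint_psigma_mul ler01 deviation_integrable.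
have [_ _ e1] := sint_psigma_mul (ltW t0) (sub01 deviation_integrable t1).
have ale : a <= t by have := a0; lra.
have [iB eB] := sint_B_deviation ale t1.
have it1 := sub01 i1 t1; have it2 := sub01 i2 t1; have ist := sub01 si t1.
have dt := sub01 deviation_integrable t1; have d2t := sub01 deviation2_integrable t1.
have ef : sint 0 t f = sint 0 t s + (2 * sint 0 t (fun x => sg x * dv x) - 4 * sint 0 t (fun x => ka x * D x)).
  rewrite sintD//; last by apply: sintegrableB; exact: sintegrableZ.
  by congr (_ + _); rewrite sintB ?sintZ//; exact: sintegrableZ.
have es : sint 0 t s = sint 0 t r - sint 0 t (prho a).
  by rewrite sintB//; [exact: sub01|exact: prho_integrable].
have ev : sint 0 t (fun x => v x ^+ 2) = sint 0 t (fun x => (B x - cc) ^+ 2)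
   + (2 * sint 0 t (fun x => B x * dv x) - 2 * cc * D t + sint 0 t (fun x => dv x ^+ 2)).
  rewrite -sintZ// -sintZ// -sintB; [|exact: sintegrableZ|exact: sintegrableZ].
  rewrite -sintD//; last by apply: sintegrableB; exact: sintegrableZ.
  rewrite -sintD; [|exact: vel2_integrable|].
    apply: sint_eq; first exact: sub01.
    by move=> x _; rewrite /dv; ring.
  by apply: sintegrableD => //; apply: sintegrableB; exact: sintegrableZ.
have eU := gain_Fcurve a0 a1 (ltW t0); rewrite potential0// subr0 (potential_right at_) in eU.
have eD := sint_deviation (ltW t0) t1.
have := near_optimal t0 t1.
have -> : sint 0 t v = F t + D t by rewrite eD; ring.
have eF : F t / t = 2 * sg t - cc.
  rewrite psigma_ge// Fcurve_sheared sheared_right//.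
  have tE := sqr_sqrtr (ltW t0); have w0 : 0 < Num.sqrt t by rewrite sqrtr_gt0.
  move: (Num.sqrt t) tE w0 => w <- w0.
  by field; rewrite gt_eqF.
have -> : (F t + D t) ^+ 2 / t = F t ^+ 2 / t + 2 * (F t / t) * D t + D t ^+ 2 / t.
  by field; rewrite gt_eqF.
rewrite eF; move: ef es ev eU e1 eB.
move: (sint 0 t f) (sint 0 t s) (sint 0 t r) (sint 0 t (prho a)) => X1 X2 X3 X4.
move: (sint 0 t (fun x => v x ^+ 2)) (sint 0 t (fun x => (B x - cc) ^+ 2)) => X5 X6.
move: (sint 0 t (fun x => B x * dv x)) (sint 0 t (fun x => sg x * dv x)) (sint 0 t (fun x => ka x * D x)) => X7 X8 X9.
move: (sint 0 t (fun x => dv x ^+ 2)) (_ ^+ 2 / t) (_ ^+ 2 / t) => X10 X11 X12.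
move: (D t) (sg t) => d z -> -> -> e -> ->.
have -> : X4 = X6 - X12 by lra.
lra.
Qed.

(** [pkappa] vanishes up to 2a, where [f_lower] says nothing. Beyond, Cauchy-Schwarz bounds D(u)^2 /
    u by the integral of dv^2; at time 1 that integral survives because D(1) = 0. The errors add up
    to eps times psigma(1) + (ps0 - psigma(1)). *)
Let weighted_lower : sg 1 * sint 0 1 (fun x => dv x ^+ 2) - eps * s0 <= sint 0 1 (fun x => sg x * f x).
Proof.
have [i1 i2 e] := sint_psigma_mul ler01 fi; rewrite e.
have a2 : 2 * a <= 1 by have := a1; lra.
have h1 := f_lower a2 (lexx 1); rewrite D1 expr0n/= mul0r subr0 in h1.
have g1 := psigma_gt0 a0 a1 1.
have h2 : sint 0 1 (fun u => - eps * ka u) <= sint 0 1 (fun u => ka u * sint 0 u f).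
  apply: sint_le => //; first by apply: sintegrableZ; exact: pkappa_integrable.
  move=> u /andP[u0 u1]; have [ua|au] := leP u (2 * a).
    by rewrite /pkappa ua mulr0 mul0r.
  rewrite mulrC ler_wpM2l ?pkappa_ge0//.
  apply: le_trans (f_lower (ltW au) (ltW u1)).
  have := sint_sqr_div_le u0 (sub01 deviation_integrable (ltW u1)) (sub01 deviation2_integrable (ltW u1)).
  rewrite subr0; move: (D u ^+ 2 / u) (sint 0 u (fun x => dv x ^+ 2)) => *; lra.
rewrite sintZ ?(sint_pkappa a0 a1 ler01) in h2; last exact: pkappa_integrable.
rewrite (psigma_le a0) in h2; last by rewrite mulr_ge0// ltW.
have : sg 1 * (- eps + sint 0 1 (fun x => dv x ^+ 2)) <= sg 1 * sint 0 1 f by rewrite ler_wpM2l// ltW.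
move: h2; move: (sint _ _ _) (sint _ _ _) (sint _ _ _) (sg 1) s0 => X1 X2 X3 z w *; lra.
Qed.

(* The terms linear in [dv] cancel: integrating [sg * dv - ka * D] by parts against
   [sg] shows that [sg ^+ 2 * dv] and [2 * sg * ka * D] have the same integral. *)
Let weighted_eq : sintegrable 0 1 (fun x => sg x * s x) /\
  sint 0 1 (fun x => sg x * f x) = sint 0 1 (fun x => sg x * s x).
Proof.
have [k1 i2 _] := sint_psigma_mul ler01 deviation_integrable.
pose g (x : R) := sg x * dv x - ka x * D x.
have gi t : t <= 1 -> sintegrable 0 t g.
  by move=> t1; apply: sub01 => //; exact: sintegrableB.
have gE t : 0 <= t -> t <= 1 -> sint 0 t g = sg t * D t.
  move=> t0 t1; have [j1 j2 e] := sint_psigma_mul t0 (sub01 deviation_integrable t1).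
  by rewrite sintB// e addrK.
have [_ is_ _] := sint_psigma_mul ler01 si.
have [j1 j2 e] := sint_psigma_mul ler01 (gi 1 (lexx 1)).
rewrite gE ?ler01// D1 !mulr0 add0r in e.
have [_ l2 _] := sint_psigma_mul ler01 i2.
have [_ l3 _] := sint_psigma_mul ler01 k1.
have e3 : sint 0 1 (fun u => ka u * sint 0 u g) = sint 0 1 (fun u => sg u * (ka u * D u)).
  apply: sint_eq => // x /andP[x0 x1]; rewrite gE ?(ltW x0) ?(ltW x1)//; ring.
have e4 : sint 0 1 (fun u => sg u * g u) =
    sint 0 1 (fun u => sg u * (sg u * dv u)) - sint 0 1 (fun u => sg u * (ka u * D u)).
  by rewrite -sintB//; apply: sint_eq => // x _; rewrite /g mulrBr.
split=> //.
have l4 : sintegrable 0 1 (fun x => 2 * (sg x * (sg x * dv x)) - 4 * (sg x * (ka x * D x))).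
  by apply: sintegrableB; exact: sintegrableZ.
have -> : sint 0 1 (fun x => sg x * f x) = sint 0 1 (fun x => sg x * s x +
    (2 * (sg x * (sg x * dv x)) - 4 * (sg x * (ka x * D x)))).
  have [_ if_ _] := sint_psigma_mul ler01 fi.
  by apply: sint_eq => // x _; rewrite /f; ring.
rewrite sintD// sintB; [|exact: sintegrableZ|exact: sintegrableZ].
rewrite !sintZ//; move: e3 e4 e; move: (sint _ _ _) (sint _ _ _) (sint _ _ _) (sint _ _ _) (sint _ _ _) => *; lra.
Qed.

Definition excess : R := sint 0 1 (fun x => r x `^ (3 / 2)) - 2 * s0 ^+ 2 + 3 / 2 * (eps * s0).

Let x32 (x : R) : r x `^ (3 / 2) = Num.sqrt (r x) ^+ 3.
Proof. by rewrite powR32E. Qed.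

(** Expanded, this is r^(3/2) - psigma^3 - 3/2 psigma (r - psigma^2): the remainder of the convex
    function x^(3/2) over its tangent at psigma^2. *)
Let gap (x : R) := (Num.sqrt (r x) - sg x) ^+ 2 * (Num.sqrt (r x) + sg x / 2).

Let gap_eq : sintegrable 0 1 gap /\ sint 0 1 gap + 3 / 2 * sg 1 * sint 0 1 (fun x => dv x ^+ 2) <= excess.
Proof.
have [is_ es] := weighted_eq; have w := weighted_lower.
have i3 := psigma3_integrable a0 a1 0 1.
have i4 := sintegrableZ (3 / 2) is_.
have e x : 0 < x < 1 -> (r x `^ (3 / 2) - sg x ^+ 3) - 3 / 2 * (sg x * s x) = gap x.
  move=> _; rewrite x32 /gap /s -[X in sg x * (X - _)](sqr_sqrtr (r0 x)).
  by move: (Num.sqrt _) (sg x) => y z; field.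
have i5 := sintegrableB r32i i3; have i6 := sintegrableB i5 i4.
split; first exact: sintegrable_eq e.
rewrite -(sint_eq i6 e) sintB// sintB// sintZ// sint_psigma3// -es /excess.
move: w; move: (sint _ _ _) (sint _ _ _) (sint _ _ _) (sg 1) s0 => X1 X2 X3 z y; lra.
Qed.

Let gap_ge0 : 0 <= sint 0 1 gap.
Proof.
have [gi _] := gap_eq; apply: sint_ge0 => // x _; rewrite mulr_ge0 ?sqr_ge0//.
by rewrite addr_ge0 ?sqrtr_ge0// divr_ge0// ltW// psigma_gt0.
Qed.

Lemma deviation_small : 3 / 2 * sg 1 * sint 0 1 (fun x => dv x ^+ 2) <= excess.
Proof. have [_] := gap_eq; have := gap_ge0; lra. Qed.

Lemma excess_ge0 : 0 <= excess.
Proof.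
apply: le_trans deviation_small; apply: mulr_ge0.
  by rewrite mulr_ge0// ltW// psigma_gt0.
by apply: sint_ge0 => [|x _]; [exact: deviation2_integrable|exact: sqr_ge0].
Qed.

(** The gap is quadratic in sqrt r - psigma while the L1 distance is linear in it: AM-GM with weight
    theta links them. The factor sqrt r + psigma / 2 is kept, its integral being bounded through
    sqrt r <= 1 + r^(3/2). *)
Lemma density_close theta : 0 < theta ->
  sintegrable 0 1 (fun x => `|r x - prho a x|) /\
  sint 0 1 (fun x => `|r x - prho a x|)
    <= excess / theta + theta * (1 + s0 / 2 + sint 0 1 (fun x => r x `^ (3 / 2))).
Proof.
move=> th0; have [gi ge] := gap_eq.
have ai : sintegrable 0 1 (fun x => `|r x - prho a x|) by exact: (integrable_norm si).
split=> //; have ci := sintegrable_cst 0 1 (1 + s0 / 2).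
have i1 : sintegrable 0 1 (fun x => theta^-1 * gap x + theta * (1 + s0 / 2 + r x `^ (3 / 2))).
  by apply: sintegrableD; [exact: sintegrableZ|apply: sintegrableZ; exact: sintegrableD].
have le1 : sint 0 1 (fun x => `|r x - prho a x|) <=
    sint 0 1 (fun x => theta^-1 * gap x + theta * (1 + s0 / 2 + r x `^ (3 / 2))).
  apply: sint_le => // x _; rewrite x32 /prho /gap -{1}[r x](sqr_sqrtr (r0 x)).
  have z0 := psigma_gt0 a0 a1 x; have zs := psigma_le_s0 a0 a1 x; have y0 := sqrtr_ge0 (r x).
  move: z0 zs y0; move: (Num.sqrt _) (sg x) s0 => y z w z0 zs y0.
  have y3 : y <= 1 + y ^+ 3.
    have [y1|y1] := leP y 1; first by rewrite (le_trans y1)// lerDl exprn_ge0.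
    rewrite (@le_trans _ _ (y ^+ 3))//; last by rewrite lerDr.
    by rewrite -[leLHS]expr1 ler_eXn2l.
  apply: (@le_trans _ _ ((y + z / 2) * (theta^-1 * (y - z) ^+ 2 + theta))).
    have -> : y ^+ 2 - z ^+ 2 = (y - z) * (y + z) by ring.
    rewrite normrM (ger0_norm (_ : 0 <= y + z)); last by rewrite addr_ge0// ltW.
    have h : 2 * `|y - z| <= theta^-1 * (y - z) ^+ 2 + theta.
      rewrite -(real_normK (num_real (y - z))); move: `|y - z| => p.
      rewrite -subr_ge0; have -> : theta^-1 * p ^+ 2 + theta - 2 * p = theta^-1 * (p - theta) ^+ 2.
        by field; rewrite gt_eqF.
      by rewrite mulr_ge0 ?sqr_ge0// invr_ge0 ltW.
    apply: (@le_trans _ _ ((y + z / 2) * (2 * `|y - z|))); last by rewrite ler_wpM2l//; lra.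
    by have := normr_ge0 (y - z); nra.
  rewrite mulrDr lerD//; first by rewrite mulrC -mulrA.
  by rewrite mulrC; apply: ler_wpM2l; [exact: ltW|move: y3; move: (y ^+ 3) => *; lra].
apply: le_trans le1 _.
rewrite sintD; [|exact: sintegrableZ|by apply: sintegrableZ; exact: sintegrableD].
rewrite !sintZ//; last exact: sintegrableD.
rewrite sintD// sint_cst// subr0 mulr1 lerD2r mulrC ler_pM2r ?invr_gt0//.
apply: le_trans ge; rewrite lerDl; apply: mulr_ge0.
  by rewrite mulr_ge0// ltW// psigma_gt0.
by apply: sint_ge0 => [|x _]; [exact: deviation2_integrable|exact: sqr_ge0].
Qed.

End Stability.

(** * Rate and uniqueness *)

Section LowerBound.
Variable R : realType.
Variable a : R.
Hypothesis a0 : 0 < a.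
Hypothesis a1 : a < 1 / 2.
Notation s0 := (ps0 a).

Section Representation.
Variables (lo hi : nat -> R) (g rho : nat -> R -> R).
Hypothesis rhoD : forall i, density (rho i).
Variable K : R.
Hypothesis massK : (mass lo hi rho <= K%:E)%E.
Variable e : spacetime_fun R.
Hypothesis eE : smallest_above e (range (fun i => plant_metric (lo i) (hi i) (g i) (rho i))).
Hypothesis ea : admissible a e.

Notation OG := (optimal_gain lo hi g rho).
Notation tr := (traj lo hi g).
Notation gn := (gain rho).

Lemma optimal_gain_through : OG 0 0 0 1 <= OG 0 0 1 a + OG 1 a 0 1.
Proof.
have a11 : a < 1 by have := a1; lra.
have [_ [pi [[_ pi0 pi1 _ pl] pia]]] := ea.
have eO := smallest_above_optimal_gain rhoD massK eE.
rewrite -lee_fin EFinD -!eO// -pl; apply: ereal_inf_lbound.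
exists [:: a; 1]; first by split; rewrite //= a0 a11.
by rewrite /= pi0 pia pi1 adde0.
Qed.

Lemma near_optimal_traj (eps : R) : 0 < eps -> exists c v lab,
  [/\ tr 0 1 c v lab, c 0 = 0, c a = 1, c 1 = 0 &
      forall t, 0 < t -> t <= 1 -> - (c t ^+ 2 / t) - eps <= gn 0 t v lab].
Proof.
move=> e0; have e2 : 0 < eps / 2 by lra.
have a11 : a < 1 by have := a1; lra.
have [c1 [v1 [lab1 [T1 c1s c1t h1]]]] := optimal_gain_approx g rhoD massK 0 1 a0 e2.
have [c2 [v2 [lab2 [T2 c2t c2u h2]]]] := optimal_gain_approx g rhoD massK 1 0 a11 e2.
have c12 : c1 a = c2 a by rewrite c1t c2t.
have T := traj_cat T1 T2 c12.
have gc := gain_glue rhoD massK T1 T2 c12.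
exists (glue a c1 c2), (glue a v1 v2), (glue a lab1 lab2).
have g0 : glue a c1 c2 0 = 0 by rewrite /glue (ltW a0).
have g1 : glue a c1 c2 1 = 0 by rewrite /glue leNgt a11.
have near : OG 0 0 0 1 - eps <= gn 0 1 (glue a v1 v2) (glue a lab1 lab2).
  rewrite gc; have := optimal_gain_through; move: h1 h2.
  move: (OG _ _ _ _) (OG _ _ _ _) (OG _ _ _ _) (gn _ _ _ _) (gn _ _ _ _) => *; lra.
split=> //; first by rewrite /glue lexx.
move=> t t0 t1; have := near; move: t1; rewrite le_eqVlt => /predU1P[->|t1].
  rewrite g1 expr0n/= mul0r oppr0.
  have := optimal_gain_dirichlet g rhoD massK 0 0 ltr01.
  rewrite subr0 expr0n/= mul0r oppr0.
  by move: (OG _ _ _ _) (gn _ _ _ _) => *; lra.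
rewrite (gain_split rhoD massK T (ltW t0) (ltW t1)).
have := gain_le_optimal rhoD massK (traj_sub T (ltW t0) t1 (lexx 1)); rewrite g1.
have := optimal_gain_triangle g rhoD massK 0 (glue a c1 c2 t) 0 t0 t1.
have := optimal_gain_dirichlet g rhoD massK 0 (glue a c1 c2 t) t0.
rewrite !subr0.
move: (OG _ _ _ _) (OG _ _ _ _) (OG _ _ _ _) (gn _ _ _ _) (gn _ _ _ _) (_ / t) => *; lra.
Qed.

Section NearOptimal.
Variables (eps : R) (c v : R -> R) (lab : R -> nat).
Hypothesis T : tr 0 1 c v lab.
Hypotheses (c0 : c 0 = 0) (ca : c a = 1) (c1 : c 1 = 0).
Hypothesis near : forall t, 0 < t -> t <= 1 -> - (c t ^+ 2 / t) - eps <= gn 0 t v lab.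

Lemma near_sint t : 0 <= t -> t <= 1 -> sint 0 t v = c t.
Proof. by move=> t0 t1; rewrite -(traj_c T (lexx 0) t0 t1) c0 subr0. Qed.

Let r := label_density rho lab.
Let r0 x : 0 <= r x := label_density_ge0 rhoD lab x.
Let ri : sintegrable 0 1 r := traj_dens rhoD massK T 0 1.

Let mass_r := mass_integrable rhoD massK 0 1 (traj_mlab T) (@traj_dom _ _ _ _ _ _ _ _ _ T).

Let va : sint 0 a v = 1.
Proof. by rewrite near_sint ?ca//; [exact: ltW|have := a1; lra]. Qed.
Let v1 : sint 0 1 v = 0.
Proof. by rewrite near_sint ?c1. Qed.
Let nearv t : 0 < t -> t <= 1 -> - ((sint 0 t v) ^+ 2 / t) - eps <= sint 0 t r - sint 0 t (fun x => v x ^+ 2).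
Proof. by move=> t0 t1; rewrite near_sint ?(ltW t0)//; exact: near. Qed.

Let r32i : sintegrable 0 1 (fun x => r x `^ (3 / 2)). Proof. by case: mass_r. Qed.

Lemma near_deviation :
  3 / 2 * psigma a 1 * sint 0 1 (fun x => deviation a v x ^+ 2)
    <= sint 0 1 (mass_density rho lab) - 2 * s0 ^+ 2 + 3 / 2 * (eps * s0).
Proof. exact (deviation_small a0 a1 r0 (traj_mv T) ri r32i (traj_sqr T) va v1 nearv). Qed.

Lemma near_excess : 0 <= sint 0 1 (mass_density rho lab) - 2 * s0 ^+ 2 + 3 / 2 * (eps * s0).
Proof. exact (excess_ge0 a0 a1 r0 (traj_mv T) ri r32i (traj_sqr T) va v1 nearv). Qed.

Lemma near_density theta : 0 < theta ->
  sintegrable 0 1 (fun x => `|r x - prho a x|) /\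
  sint 0 1 (fun x => `|r x - prho a x|)
    <= (sint 0 1 (mass_density rho lab) - 2 * s0 ^+ 2 + 3 / 2 * (eps * s0)) / theta
       + theta * (1 + s0 / 2 + sint 0 1 (mass_density rho lab)).
Proof. exact (@density_close _ _ a0 a1 _ _ _ r0 (traj_mv T) ri r32i (traj_sqr T) va v1 nearv theta). Qed.

Lemma near_mass : sint 0 1 (mass_density rho lab) <= K.
Proof. by case: mass_r. Qed.

End NearOptimal.

Lemma mass_lower : 2 * s0 ^+ 2 <= K.
Proof.
apply/ler_addgt0Pr => eta eta0; have z0 := ps0_gt0 a0 a1.
(* With this tolerance the error term of [near_excess] is exactly eta. *)
have e0 : 0 < eta / (3 / 2 * s0) by rewrite divr_gt0// mulr_gt0//; lra.
have [c [v [lab [T c0 ca c1 near]]]] := near_optimal_traj e0.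
have := near_excess T c0 ca c1 near; have := near_mass T.
have -> : 3 / 2 * (eta / (3 / 2 * s0) * s0) = eta by field; rewrite gt_eqF.
by move: (sint _ _ _) => *; lra.
Qed.

End Representation.

Lemma plant_rate_mass lo hi (rho : nat -> R -> R) : (forall i, density (rho i)) ->
  (\sum_(i <oo) plant_rate (lo i) (hi i) (rho i) = (4 / 3)%:E * mass lo hi rho)%E.
Proof.
move=> rhoD; rewrite /mass -nneseriesZl//.
by move=> i _; apply: integral_ge0 => x _; rewrite lee_fin powR_ge0.
Qed.

Lemma mass_ge0 lo hi (rho : nat -> R -> R) : (0 <= mass lo hi rho)%E.
Proof.
by apply: nneseries_ge0 => i _ _; apply: integral_ge0 => x _; rewrite lee_fin powR_ge0.
Qed.

Lemma rate_lower e : admissible a e -> ((Imin a)%:E <= rate e)%E.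
Proof.
move=> ea; apply: le_ereal_inf_tmp => _ [lo [hi [g [rho [rhoD [eE ->]]]]]].
rewrite (plant_rate_mass _ _ rhoD) (Imin_s0 a0 a1).
have := mass_ge0 lo hi rho; case E : (mass lo hi rho) => [K| |]// _.
  have massK : (mass lo hi rho <= K%:E)%E by rewrite E.
  by rewrite -EFinM lee_fin; have := mass_lower rhoD massK eE ea; move: (_ ^+ 2) => *; lra.
by rewrite gt0_muley ?leey// lte_fin.
Qed.

Lemma rate_optimal : rate (optimal_metric a) = (Imin a)%:E.
Proof.
apply/eqP; rewrite eq_le; apply/andP; split; last exact: rate_lower (optimal_metric_admissible a0 a1).
apply: ereal_inf_lbound; exists (@one_lo R), (@one_hi R), (fun=> Fcurve a), (fun=> prho a).
split; first exact: one_rhoD.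
split; first exact: optimal_metric_range.
rewrite (plant_rate_mass _ _ (one_rhoD a0)) one_mass// -EFinM (Imin_s0 a0 a1); congr EFin; by field.
Qed.

(* Almost all the mass is collected by a single trajectory [c] close to [Fcurve a]. *)
Definition nearly_optimal (e : spacetime_fun R) (kappa : R) : Prop :=
  exists lo hi g (rho : nat -> R -> R) K c v lab,
  [/\ [/\ forall i, density (rho i), (mass lo hi rho <= K%:E)%E &
          smallest_above e (range (fun i => plant_metric (lo i) (hi i) (g i) (rho i)))],
      [/\ traj lo hi g 0 1 c v lab, c 0 = 0, c a = 1 & c 1 = 0],
      sint 0 1 (fun x => deviation a v x ^+ 2) <= kappa,
      sintegrable 0 1 (fun x => `|label_density rho lab x - prho a x|) /\
      sint 0 1 (fun x => `|label_density rho lab x - prho a x|) <= kappa &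
      K - sint 0 1 (mass_density rho lab) <= kappa].

Lemma rate_nearly_optimal (e : spacetime_fun R) (kappa : R) : admissible a e -> rate e = (Imin a)%:E -> 0 < kappa ->
  nearly_optimal e kappa.
Proof.
move=> ea re k0; have z0 := ps0_gt0 a0 a1; have g0 := psigma_gt0 a0 a1 1.
(* C bounds the factor of theta in [near_density] as soon as the collected mass is at most 2 ps0^2 +
   1. Then [th * C] is half of kappa, and the choice of b leaves the other half for the excess
   divided by th. *)
pose C := 2 + s0 / 2 + 2 * s0 ^+ 2; have C0 : 0 < C by rewrite /C; have := sqr_ge0 s0; lra.
pose th := kappa / (2 * C); have th0 : 0 < th by rewrite divr_gt0// mulr_gt0.
pose b := Num.min (Num.min (th * (kappa / 2)) (3 / 2 * psigma a 1 * kappa)) kappa.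
have b0 : 0 < b.
  rewrite !lt_min k0 (mulr_gt0 th0) ?divr_gt0// mulr_gt0 ?(mulr_gt0 _ g0)//; exact: divr_gt0.
(* [d * W] gathers both contributions of d to the excess: d from the surplus of mass, and 3/2 d ps0
   from taking eps = d. *)
pose W := 1 + 3 / 2 * s0; have W0 : 0 < W by rewrite /W; lra.
pose d := Num.min 1 (b / W); have d0 : 0 < d by rewrite lt_min ltr01 divr_gt0.
have dW : d * W <= b by rewrite -ler_pdivlMr// /d ge_min lexx orbT.
have d1 : d <= 1 by rewrite /d ge_min lexx.
have d43 : 0 < 4 / 3 * d by rewrite mulr_gt0// divr_gt0.
have rf : rate e \is a fin_num by rewrite re.
have [_ [lo [hi [g [rho [rhoD [eE ->]]]]]] h] := lb_ereal_inf_adherent d43 rf.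
move: h; rewrite -/(rate e) re (plant_rate_mass _ _ rhoD) (Imin_s0 a0 a1) => h.
pose K := 2 * s0 ^+ 2 + d.
have massK : (mass lo hi rho <= K%:E)%E.
  have := mass_ge0 lo hi rho; move: h; case: (mass lo hi rho) => [k| |]//.
    rewrite -EFinM -EFinD lte_fin !lee_fin /K => h _; move: h; move: (_ ^+ 2) => *; lra.
  by rewrite gt0_muley ?lte_fin//; lra.
have [c [v [lab [T c0 ca c1 near]]]] := near_optimal_traj rhoD massK eE ea d0.
exists lo, hi, g, rho, K, c, v, lab.
have E1 := near_mass rhoD massK T.
have E2 := near_deviation rhoD massK T c0 ca c1 near.
have E3 := near_excess rhoD massK T c0 ca c1 near.
have [i4 E4] := near_density rhoD massK T c0 ca c1 near th0.
have X : sint 0 1 (mass_density rho lab) - 2 * s0 ^+ 2 + 3 / 2 * (d * s0) <= b.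
  by apply: le_trans dW; move: E1; rewrite /K /W; move: (sint _ _ _) => *; lra.
have bk : b <= kappa by rewrite /b ge_min lexx orbT.
have bs : b <= 3 / 2 * psigma a 1 * kappa by rewrite /b !ge_min lexx !orbT.
have bt : b <= th * (kappa / 2) by rewrite /b !ge_min lexx.
split=> //.
- have g3 : 0 < 3 / 2 * psigma a 1 by rewrite mulr_gt0.
  by rewrite -(ler_pM2l g3); apply: le_trans E2 (le_trans X bs).
- split=> //; apply: le_trans E4 _.
  have -> : kappa = kappa / 2 + th * C by rewrite /th; field; rewrite gt_eqF.
  apply: lerD; first by rewrite ler_pdivrMr// [leRHS]mulrC; exact: (le_trans X).
  rewrite ler_pM2l//; move: E1; rewrite /C /K; move: (sint _ _ _) => *; lra.
- apply: le_trans bk; apply: le_trans dW; move: E3; rewrite /K /W; move: (sint _ _ _) => *; lra.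
Qed.

End LowerBound.

(** The difference of the two sides is k / (1 + k) times a square. In this form a velocity can be
    shifted by d at the price of a factor close to 1 on its energy. *)
Lemma shrink_sqr (R : realType) (k b d : R) : 0 < k ->
  (1 + k)^-1 * b ^+ 2 <= (b + d) ^+ 2 + k^-1 * d ^+ 2.
Proof.
move=> k0; have k1 : 0 < 1 + k by lra.
rewrite -subr_ge0.
have -> : (b + d) ^+ 2 + k^-1 * d ^+ 2 - (1 + k)^-1 * b ^+ 2
  = (k / (1 + k)) * (b + (1 + k) / k * d) ^+ 2 by field; rewrite !gt_eqF.
by rewrite mulr_ge0 ?sqr_ge0// divr_ge0// ltW.
Qed.

(** * Competitors shifted onto the optimal curve *)

Section Comparison.
Variable R : realType.
Notation mfun f := (measurable_fun [set: R] f).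
Variable a : R.
Hypothesis a0 : 0 < a.
Hypothesis a1 : a < 1 / 2.
Notation F := (Fcurve a).
Notation s0 := (ps0 a).
Notation cc := (pc a).
Notation B := (pvel a).
Notation U := (potential a).
Notation EF := (optimal_gain (@one_lo R) (@one_hi R) (fun=> F) (fun=> prho a)).

Variables (lo hi : nat -> R) (g rho : nat -> R -> R).
Hypothesis rhoD : forall i, density (rho i).
Variable K : R.
Hypothesis massK : (mass lo hi rho <= K%:E)%E.
Variables (c v : R -> R) (lab : R -> nat) (kappa : R).
Hypothesis T : traj lo hi g 0 1 c v lab.
Hypothesis c0 : c 0 = 0.
Hypothesis small_deviation : sint 0 1 (fun x => deviation a v x ^+ 2) <= kappa.
Hypothesis close_densityi : sintegrable 0 1 (fun x => `|label_density rho lab x - prho a x|).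
Hypothesis close_density : sint 0 1 (fun x => `|label_density rho lab x - prho a x|) <= kappa.
Hypothesis small_rest : K - sint 0 1 (mass_density rho lab) <= kappa.

Notation dv := (deviation a v).
Notation gn := (gain rho).
Notation r := (label_density rho lab).
Notation D t := (sint 0 t dv).

Let mv : mfun v := traj_mv T.
Let v2i : sintegrable 0 1 (fun x => v x ^+ 2) := traj_sqr T.
Let d2i : sintegrable 0 1 (fun x => dv x ^+ 2) := deviation2_integrable a0 a1 mv v2i.
Let di : sintegrable 0 1 dv := deviation_integrable a0 a1 mv v2i.
Let sub01 (u w : R) (f : R -> R) : sintegrable 0 1 f -> 0 <= u -> w <= 1 -> sintegrable u w f.
Proof. by move=> fi u0 w1; exact: (sintegrable_sub fi). Qed.

Lemma traj_deviation t : 0 <= t -> t <= 1 -> c t = F t + D t.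
Proof.
move=> t0 t1; rewrite (sint_deviation a0 a1 mv v2i t0 t1).
by rewrite -(traj_c T (lexx 0) t0 t1) c0; ring.
Qed.

Let le01 (u w : R) (f : R -> R) : (forall x, 0 <= f x) -> sintegrable 0 1 f ->
  0 <= u -> u <= w -> w <= 1 -> sint u w f <= sint 0 1 f.
Proof.
move=> f0 fi u0 uw w1.
have i1 : sintegrable 0 w f by exact: sub01.
have i2 : sintegrable 0 u f by apply: sub01 => //; exact: le_trans w1.
have i3 : sintegrable w 1 f by apply: sub01 => //; exact: le_trans uw.
rewrite (sint_cat fi (le_trans u0 uw) w1) (sint_cat i1 u0 uw).
have := sint_ge0 i2 (fun x _ => f0 x); have := sint_ge0 i3 (fun x _ => f0 x); lra.
Qed.

Let d20 x : 0 <= dv x ^+ 2. Proof. exact: sqr_ge0. Qed.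

Lemma deviation_sqr_le t : 0 <= t -> t <= 1 -> D t ^+ 2 <= kappa.
Proof.
move=> t0 t1; apply: le_trans small_deviation.
move: t0; rewrite le_eqVlt => /predU1P[<-|t0].
  by rewrite sint_pt expr0n/=; exact: sint_ge0.
apply: le_trans (sint_sqr_le t0 (sub01 di (lexx 0) t1) (sub01 d2i (lexx 0) t1)) _.
rewrite subr0; apply: le_trans (le01 d20 d2i (lexx 0) (ltW t0) t1).
by rewrite ler_piMl//; apply: sint_ge0 => //; exact: sub01.
Qed.

(** Exchanging the density costs kappa, and exchanging the velocity costs k (3 ps0 + pc)^2 + (1 +
    1/k) kappa by Young. The parameter k is to be fixed before kappa. *)
Lemma gain_close s t k : 0 <= s -> s < t -> t <= 1 -> 0 < k ->
  U t - U s - (k * (3 * s0 + cc) ^+ 2 + (2 + k^-1) * kappa) <= gn s t v lab.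
Proof.
move=> s_0 st t1 k0; have st' := ltW st; pose L := (3 * s0 + cc) ^+ 2.
have kk : 0 < k^-1 by rewrite invr_gt0.
have ri := traj_dens rhoD massK T s t; have ci := sub01 close_densityi s_0 t1.
have pi_ := prho_integrable a0 a1 s t; have d2 := sub01 d2i s_0 t1.
have vi := vel2_integrable a0 a1 s t; have v2 := sub01 v2i s_0 t1.
have h1 : sint s t (prho a) - kappa <= sint s t r.
  have : sint s t (fun x => prho a x - r x) <= sint s t (fun x => `|r x - prho a x|).
    apply: sint_le => //; first exact: sintegrableB.
    by move=> x _; rewrite distrC ler_norm.
  rewrite sintB//.
  have := le01 (fun x => normr_ge0 _) close_densityi s_0 st' t1.
  have := close_density; move: (sint _ _ _) (sint _ _ _) (sint _ _ _) (sint _ _ _) => *; lra.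
have iL := sintegrable_cst s t L.
have i2 : sintegrable s t (fun x => k * L + (1 + k^-1) * dv x ^+ 2).
  by apply: sintegrableD; [exact: sintegrable_cst|exact: sintegrableZ].
have h2 : sint s t (fun x => v x ^+ 2) <= sint s t (fun x => (B x - cc) ^+ 2) + (k * L + (1 + k^-1) * kappa).
  apply: (@le_trans _ _ (sint s t (fun x => (B x - cc) ^+ 2 + (k * L + (1 + k^-1) * dv x ^+ 2)))).
    apply: sint_le => //; first exact: sintegrableD.
    move=> x _; have -> : v x = (B x - cc) + dv x by rewrite /deviation; ring.
    have bL : (B x - cc) ^+ 2 <= L.
      rewrite /L -(real_normK (num_real (B x - cc))); apply: lerXn2r; rewrite ?nnegrE//.
        by have := pc_gt0 a0 a1; have := ps0_gt0 a0 a1; lra.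
      rewrite (le_trans (ler_normB _ _))// lerD ?pvel_bound// gtr0_norm//; exact: pc_gt0.
    move: bL; move: (B x - cc) (dv x) => b d bL.
    have := shrink_sqr b (- b - d) k0; have -> : b + (- b - d) = - d by ring.
    have := sqr_ge0 (k * b - d).
    have -> : (k * b - d) ^+ 2 = k * (k * b ^+ 2 - 2 * (b * d) + k^-1 * d ^+ 2) by field; rewrite gt_eqF.
    rewrite pmulr_rge0// => h _.
    have : k * b ^+ 2 <= k * L by rewrite ler_pM2l.
    rewrite sqrrD mulrDl mul1r => h'.
    by rewrite -mulr_natl; move: h h'; lra.
  rewrite sintD// lerD2l sintD//; [|exact: sintegrable_cst|exact: sintegrableZ].
  rewrite sint_cst// sintZ// lerD//.
    by rewrite ler_piMr//; [rewrite mulr_ge0 ?sqr_ge0// ltW|lra].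
  rewrite ler_pM2l ?addr_gt0//; apply: le_trans small_deviation; exact: le01.
have := gain_Fcurve a0 a1 st'; rewrite /gain -/L; move: h1 h2.
move: (sint _ _ _) (sint _ _ _) (sint _ _ _) (sint _ _ _) (k * L) (U s) (U t) (k^-1) => *; lra.
Qed.

Section Competitor.
Variables (p q : R) (c' v' : R -> R) (lab' : R -> nat) (k : R).
Hypothesis T' : traj lo hi g p q c' v' lab'.
Hypothesis k0 : 0 < k.

(** A competitor may live at times outside [0, 1]; clamping freezes the shift there, so that it is
    translated rigidly. *)
Let cl (t : R) : R := Num.max 0 (Num.min t 1).

Let cl_id t : 0 <= t -> t <= 1 -> cl t = t.
Proof. by move=> t0 t1; rewrite /cl min_l// max_r. Qed.
Let cl_ge0 t : 0 <= cl t. Proof. by rewrite /cl le_max lexx. Qed.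
Let cl_le1 t : cl t <= 1. Proof. by rewrite /cl ge_max ler01 ge_min lexx orbT. Qed.
Let cl_le u w : u <= w -> cl u <= cl w.
Proof.
move=> uw; rewrite /cl ge_max !le_max lexx /=; apply/orP.
by right; rewrite le_min !ge_min uw lexx orbT.
Qed.
Let cl_dist u w : u <= w -> cl w - cl u <= w - u.
Proof.
move=> uw; rewrite /cl; have [u1|u1] := leP u 1; have [w1|w1] := leP w 1.
- by have [?|?] := leP 0 u; have [?|?] := leP 0 w; lra.
- by have [?|?] := leP 0 u; rewrite max_r//; lra.
- by lra.
- by rewrite subrr; lra.
Qed.

(* [lab3] labels the mass that the competitor takes from other curves than [c] does;
   being disjoint from [lab4], it is bounded by the mass left over by [c]. *)
Let lab4 (t : R) : nat := if 0 <= t <= 1 then lab t else 0%N.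
Let lab3 (t : R) : nat := if lab4 t == lab' t then 0%N else lab' t.

Let mlab4 i : measurable (lab4 @^-1` [set i]).
Proof.
rewrite (_ : _ @^-1` _ = (`[0, 1] `&` lab @^-1` [set i]) `|` (~` `[0, 1] `&` [set _ | 0%N = i])).
  have mP (P : Prop) : measurable ([set _ | P] : set R).
    have [h|nh] := pselect P.
      by rewrite (_ : mkset _ = setT)//; apply/seteqP; split.
    by rewrite (_ : mkset _ = set0)//; apply/seteqP; split.
  apply: measurableU; apply: measurableI => //; first exact: traj_mlab T i.
  exact: measurableC.
apply/seteqP; split=> x /=; rewrite /lab4 in_itv/=; case: ifP => h.
- by move=> <-; left.
- by move=> <-; right; split=> //.
- by case=> [[_ ->]|[]].
- by case=> [[]|[_ ->]].
Qed.

Let mlab3 i : measurable (lab3 @^-1` [set i]).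
Proof.
have m' := traj_mlab T'.
have mE j : measurable ((fun t => lab4 t == lab' t) @^-1` [set true] `&` lab' @^-1` [set j]).
  rewrite (_ : _ `&` _ = lab4 @^-1` [set j] `&` lab' @^-1` [set j]).
    exact: measurableI.
  by apply/seteqP; split=> x /= [h e]; split=> //; move: h; rewrite e => /eqP.
case: i => [|i].
  rewrite (_ : _ @^-1` _ = \bigcup_j ((fun t => lab4 t == lab' t) @^-1` [set true] `&` lab' @^-1` [set j])
     `|` lab' @^-1` [set 0%N]).
    by apply: measurableU => //; exact: bigcupT_measurable.
  apply/seteqP; split=> x /=; rewrite /lab3; case: ifP => h //=.
  - by move=> _; left; exists (lab' x).
  - by move=> ->; right.
  - by case=> // -[j _ /= []]; rewrite h.
rewrite (_ : _ @^-1` _ = lab' @^-1` [set i.+1] `\` ((fun t => lab4 t == lab' t) @^-1` [set true] `&` lab' @^-1` [set i.+1])).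
  exact: measurableD.
apply/seteqP; split=> x /=; rewrite /lab3; case: ifP => h //=.
- by move=> e; split=> // -[].
- by case=> e; case.
- by case.
Qed.

Let dlab4 x i : lab4 x = i.+1 -> lo i <= x <= hi i.
Proof. by rewrite /lab4; case: ifP => // _; move=> e; exact: (traj_dom T e). Qed.
Let dlab3 x i : lab3 x = i.+1 -> lo i <= x <= hi i.
Proof. by rewrite /lab3; case: ifP => // _; move=> e; exact: (traj_dom T' e). Qed.
Let lab43 x i : lab4 x = i.+1 -> lab3 x <> i.+1.
Proof. by move=> e; rewrite /lab3; case: ifP => // /eqP; rewrite e => n e'; apply: n. Qed.

Let rest m : 0 < m -> sint p q (label_density rho lab3) <= m * (q - p) + kappa / Num.sqrt m.
Proof.
move=> m0; have pq := ltW (traj_lt T').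
apply: le_trans (label_density_bound rhoD massK m0 pq mlab3 dlab3) _.
have [i4 i3 b] := mass_integrable2 rhoD massK 0 1 p q mlab4 mlab3 dlab4 dlab3 lab43.
rewrite lerD2l ler_pM2r ?invr_gt0 ?sqrtr_gt0//.
have e : sint 0 1 (mass_density rho lab4) = sint 0 1 (mass_density rho lab).
  apply: sint_eq => // x /andP[x0 x1].
  by rewrite /mass_density /label_density /lab4 !ltW.
by have := small_rest; rewrite e in b; move: b; move: (sint _ _ _) (sint _ _ _) => *; lra.
Qed.

(** An error density: the first term pays for shifting a velocity by dv, the others for passing from
    r to the optimal density and scaling that by (1 + k)^-1. *)
Let h (x : R) : R := k^-1 * dv x ^+ 2 + (`|r x - prho a x| + k * prho a x).
Let h0 x : 0 <= h x.
Proof.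
have kk : 0 <= k^-1 by rewrite invr_ge0 ltW.
by rewrite /h !addr_ge0// mulr_ge0// ?sqr_ge0// ltW.
Qed.
Let hi01 : sintegrable 0 1 h.
Proof.
apply: sintegrableD; first exact: sintegrableZ.
by apply: sintegrableD => //; apply: sintegrableZ; exact: prho_integrable.
Qed.

Let h_le : sint 0 1 h <= k^-1 * kappa + (kappa + k * s0 ^+ 2).
Proof.
have pi_ := prho_integrable a0 a1 0 1.
rewrite sintD; [|exact: sintegrableZ|by apply: sintegrableD => //; exact: sintegrableZ].
rewrite sintD//; last exact: sintegrableZ.
rewrite !sintZ// lerD//; first by rewrite ler_pM2l// invr_gt0.
rewrite lerD// ler_pM2l// -[leRHS]mulr1 -[X in _ * X](subr0 1) -sint_cst//.
by apply: sint_le => //; [exact: sintegrable_cst|move=> x _; exact: prho_le].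
Qed.

(** The competitor is translated by minus the displacement of c, so wherever it follows c its
    translate follows [Fcurve a]. The factor (1 + k)^-1 absorbs the change of energy caused by the
    shift. *)
Let Q (u w : R) : Prop := gn u w v' lab' <=
  (1 + k)^-1 * EF (c' u - D (cl u)) u (c' w - D (cl w)) w
   + sint (cl u) (cl w) h + sint u w (label_density rho lab3).

Let k1 : 0 < (1 + k)^-1. Proof. by rewrite invr_gt0 addr_gt0. Qed.

Let dens_int lb (ml : forall i, measurable (lb @^-1` [set i])) (dl : forall x i, lb x = i.+1 -> lo i <= x <= hi i) u w :
  sintegrable u w (label_density rho lb) := label_density_integrable rhoD massK u w ml dl.

Let Qcat u s w : p <= u -> u < s -> s < w -> w <= q -> Q u s -> Q s w -> Q u w.
Proof.
move=> pu us sw wq; rewrite /Q.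
rewrite (gain_split rhoD massK (traj_sub T' pu (lt_trans us sw) wq) (ltW us) (ltW sw)).
have ih : sintegrable (cl u) (cl w) h by exact: sub01.
rewrite (sint_cat ih (cl_le (ltW us)) (cl_le (ltW sw))).
rewrite (sint_cat (dens_int mlab3 dlab3 u w) (ltW us) (ltW sw)).
have := optimal_gain_triangle (fun=> F) (one_rhoD a0) (one_massK a0 a1)
  (c' u - D (cl u)) (c' s - D (cl s)) (c' w - D (cl w)) us sw.
rewrite -(ler_pM2l k1) mulrDr.
move: (_^-1 * _) (_^-1 * _) (_^-1 * _) => X1 X2 X3.
move: (gn _ _ _ _) (gn _ _ _ _) (sint _ _ h) (sint _ _ h) => X4 X5 X6 X7.
move: (sint u s _) (sint s w _) => *; lra.
Qed.

(** Where the competitor shares no mass with c, all its density is counted by [lab3] and only a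
    straight displacement has to be shifted. Cauchy-Schwarz bounds the cost of the shift by the
    integral of dv^2. *)
Let Qfree u w : p <= u -> u < w -> w <= q ->
  (forall x, u < x < w -> lab' x = 0%N \/ lab3 x = lab' x) -> Q u w.
Proof.
move=> pu uw wq hl; have uw' := ltW uw; have Tu := traj_sub T' pu uw wq.
have wu : 0 < w - u by rewrite subr_gt0.
have g1 : gn u w v' lab' <= sint u w (label_density rho lab3) - (c' w - c' u) ^+ 2 / (w - u).
  rewrite /gain; apply: lerB; last exact: traj_dist Tu.
  apply: sint_le; [exact (traj_dens rhoD massK T' u w)|exact: dens_int|].
  move=> x /hl; rewrite /label_density => -[->|->//].
  exact: (label_density_ge0 rhoD lab3 x).
pose d := D (cl w) - D (cl u).
have dE : d = sint (cl u) (cl w) dv.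
  rewrite /d (sint_cat (sub01 di (lexx 0) (cl_le1 w)) (cl_ge0 u) (cl_le uw')); ring.
have d2 := sub01 d2i (cl_ge0 u) (cl_le1 w).
have g2 : d ^+ 2 / (w - u) <= sint (cl u) (cl w) (fun x => dv x ^+ 2).
  rewrite ler_pdivrMr// mulrC; have := cl_le uw'; rewrite le_eqVlt => /predU1P[e|cuw].
    by rewrite dE e !sint_pt expr0n/= mulr0.
  rewrite dE; apply: le_trans (sint_sqr_le cuw (sub01 di (cl_ge0 u) (cl_le1 w)) d2) _.
  by rewrite ler_wpM2r ?cl_dist//; exact: sint_ge0.
have g3 : k^-1 * sint (cl u) (cl w) (fun x => dv x ^+ 2) <= sint (cl u) (cl w) h.
  rewrite -sintZ//; apply: sint_le; [exact: sintegrableZ|exact: sub01|].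
  by move=> x _; rewrite /h lerDl; apply: addr_ge0 => //; apply: mulr_ge0; [exact: ltW|exact: sqr_ge0].
have g4 := optimal_gain_dirichlet (fun=> F) (one_rhoD a0) (one_massK a0 a1) (c' u - D (cl u)) (c' w - D (cl w)) uw.
have e4 : c' w - D (cl w) - (c' u - D (cl u)) = c' w - c' u - d by rewrite /d; ring.
rewrite e4 -(ler_pM2l k1) mulrN mulrA in g4.
have g5 := shrink_sqr (c' w - c' u - d) d k0; rewrite subrK in g5.
have g6 : (1 + k)^-1 * (c' w - c' u - d) ^+ 2 / (w - u) <= (c' w - c' u) ^+ 2 / (w - u) + k^-1 * (d ^+ 2 / (w - u)).
  by rewrite [X in _ <= _ + X]mulrA -mulrDl ler_pM2r// invr_gt0.
have kk : 0 < k^-1 by rewrite invr_gt0.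
rewrite -(ler_pM2l kk) in g2.
rewrite /Q; move: g1 g2 g3 g4 g6.
move: (gn _ _ _ _) (_^-1 * EF _ _ _ _) (sint _ _ h) (sint u w _) (k^-1 * _) (k^-1 * _) (_ / (w - u)) (_ / (w - u)) => *; lra.
Qed.

(** The competitor coincides with c here, so its translate is exactly [Fcurve a] and the optimal
    metric is worth at least the potential difference; h pays for the discrepancies of r and v. *)
Let Qcommon u w i : p <= u -> u < w -> w <= q -> 0 <= u -> w <= 1 ->
  (forall x, u <= x <= w -> c' x = g i x) -> (forall x, u < x < w -> lab' x = i.+1) ->
  (forall x, u <= x <= w -> c x = g i x) -> (forall x, u < x < w -> lab x = i.+1) ->
  sint u w (fun x => v' x ^+ 2) = sint u w (fun x => v x ^+ 2) -> Q u w.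
Proof.
move=> pu uw wq u_0 w1 c'g l'i cg li ev; have uw' := ltW uw.
have u1 := le_trans uw' w1; have w0 := le_trans u_0 uw'.
rewrite /Q !cl_id//.
have cF t : u <= t <= w -> c' t - D t = F t.
  move=> /[dup] utw /andP[ut tw]; rewrite c'g// -cg// traj_deviation ?addrK//.
    exact: le_trans ut.
  exact: le_trans w1.
rewrite !cF ?lexx ?uw'//.
have v2 := sub01 v2i u_0 w1; have ri := traj_dens rhoD massK T u w.
have -> : gn u w v' lab' = sint u w (fun x => r x - v x ^+ 2).
  rewrite sintB// /gain ev; congr (_ - _); apply: sint_eq; first exact (traj_dens rhoD massK T' u w).
  by move=> x ux; rewrite /label_density l'i// li.
have pI := prho_integrable a0 a1 u w; have vI := vel2_integrable a0 a1 u w.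
have hI := sub01 hi01 u_0 w1.
have g1 : sint u w (fun x => r x - v x ^+ 2) <= (1 + k)^-1 * (U w - U u) + sint u w h.
  rewrite -(gain_Fcurve a0 a1 uw') -sintB// -sintZ; last exact: sintegrableB.
  rewrite -sintD//; last by apply: sintegrableZ; exact: sintegrableB.
  apply: sint_le; [exact: sintegrableB|by apply: sintegrableD => //; apply: sintegrableZ; exact: sintegrableB|].
  move=> x _; rewrite /h.
  have -> : v x = (B x - cc) + dv x by rewrite /deviation; ring.
  have := shrink_sqr (B x - cc) (dv x) k0.
  have := ler_norm (r x - prho a x).
  have p0 : 0 <= prho a x by exact: sqr_ge0.
  have : prho a x - (1 + k)^-1 * prho a x <= k * prho a x.
    rewrite -[X in X - _]mul1r -mulrBl ler_wpM2r//.
    have -> : 1 - (1 + k)^-1 = k * (1 + k)^-1 by field; rewrite gt_eqF// addr_gt0.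
    by rewrite ler_piMr ?ltW// invf_lt1 ?addr_gt0//; have := k0; lra.
  rewrite mulrBr; move: ((1 + k)^-1) (k^-1) `|r x - prho a x| (B x - cc) (dv x) => i1 i2 n b d *; lra.
have g2 := optimal_metric_Fcurve a0 a1 u_0 uw w1.
rewrite -(ler_pM2l k1) in g2.
have g3 : 0 <= sint u w (label_density rho lab3).
  by apply: sint_ge0 => [|x _]; [exact: dens_int|exact: label_density_ge0].
move: g1 g2 g3; move: (sint _ _ _) (sint _ _ _) (sint _ _ _) (_^-1 * _) (_^-1 * _) => *; lra.
Qed.

Lemma competitor_gain m : 0 < m -> gn p q v' lab' <=
  (1 + k)^-1 * EF (c' p - D (cl p)) p (c' q - D (cl q)) q
   + (k^-1 * kappa + (kappa + k * s0 ^+ 2)) + (m * (q - p) + kappa / Num.sqrt m).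
Proof.
move=> m0; have pq := traj_lt T'.
have [l' pl'] := traj_nodes T'; have [l pl] := traj_nodes T.
have : Q p q.
  (* The nodes 0 and 1 make each piece lie inside [0, 1], where c is controlled, or outside, where
     [lab4] is 0. *)
  apply: (@interval_property_of_nodes R Q p q (l' ++ l ++ [:: 0; 1])); rewrite ?lexx//.
  move=> u w pu uw wq nf.
  have nf' : nodefree l' u w by move=> z zl; apply: nf; rewrite mem_cat zl.
  have nfl : nodefree l u w by move=> z zl; apply: nf; rewrite !mem_cat zl orbT.
  have n0 : ~~ (u < 0 < w) by apply: nf; rewrite !mem_cat !inE eqxx !orbT.
  have n1 : ~~ (u < 1 < w) by apply: nf; rewrite !mem_cat !inE eqxx !orbT.
  have [_ _ [z|[i [l1 l2 ci li en]]]] := pl' _ _ pu uw wq nf'.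
    by apply: Qfree => // x /z; left.
  have [/andP[u_0 w1]|out] := boolP ((0 <= u) && (w <= 1)); last first.
    apply: Qfree => // x ux; right; rewrite /lab3 ifF//; apply/negbTE.
    rewrite /lab4 li// ifF//; apply/negP => /andP[x0 x1]; move/andP: ux => [ux xw].
    move: out; rewrite negb_and -!ltNge => /orP[u0|w1].
      by move: n0; rewrite u0 /= -leNgt => w0; move: (lt_le_trans xw w0); rewrite ltNge x0.
    by move: n1; rewrite w1 andbT -leNgt => u1; move: (le_lt_trans u1 ux); rewrite ltNge x1.
  have [_ _ [z|[j [j1 j2 cj lj enj]]]] := pl _ _ u_0 uw w1 nfl.
    apply: Qfree => // x ux; right; rewrite /lab3 ifF//; apply/negbTE.
    by rewrite /lab4 li// z//; case: ifP.
  have [eij|nij] := eqVneq i j; last first.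
    apply: Qfree => // x ux; right; rewrite /lab3 ifF//; apply/negbTE.
    by rewrite /lab4 li// lj//; case: ifP => // _; rewrite eqSS eq_sym.
  rewrite -eij in cj lj enj.
  (* The velocities of c and of the competitor need not agree pointwise, but their energies do: both
     equal [energy (g i)]. *)
  by apply: (Qcommon (i := i)) => //; apply: EFin_inj; rewrite -en -enj.
have := rest m0; have := h_le.
have := le01 h0 hi01 (cl_ge0 p) (cl_le (ltW pq)) (cl_le1 q).
rewrite /Q; move: (gn p q v' lab') ((1 + k)^-1 * EF _ _ _ _) (sint (cl p) (cl q) h) (sint 0 1 h) (sint p q (label_density rho lab3)) (m * (q - p)) (kappa / Num.sqrt m) => *; lra.
Qed.

Lemma competitor_gain_shift m : 0 < m -> exists d1 d2, [/\ d1 ^+ 2 <= kappa, d2 ^+ 2 <= kappa &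
  gn p q v' lab' <= (1 + k)^-1 * EF (c' p - d1) p (c' q - d2) q
   + (k^-1 * kappa + (kappa + k * s0 ^+ 2)) + (m * (q - p) + kappa / Num.sqrt m)].
Proof.
move=> m0; exists (D (cl p)), (D (cl q)).
by split; [exact: deviation_sqr_le|exact: deviation_sqr_le|exact: competitor_gain].
Qed.

End Competitor.
End Comparison.

Lemma norm_lt_of_sqr (R : realType) (d eta : R) : 0 < eta -> d ^+ 2 <= eta ^+ 2 / 4 -> `|d| < eta.
Proof.
move=> e0; rewrite -(real_normK (num_real d)) => h; rewrite ltNge; apply/negP => ed.
have : eta ^+ 2 <= `|d| ^+ 2 by rewrite ler_sqr ?nnegrE// ltW.
have : 0 < eta ^+ 2 by rewrite exprn_gt0.
lra.
Qed.

(** * Uniqueness of the minimal metric *)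

Section Uniqueness.
Variable R : realType.
Variable a : R.
Hypothesis a0 : 0 < a.
Hypothesis a1 : a < 1 / 2.
Notation F := (Fcurve a).
Notation s0 := (ps0 a).
Notation U := (potential a).
Notation EF := (optimal_gain (@one_lo R) (@one_hi R) (fun=> F) (fun=> prho a)).

Variable e : spacetime_fun R.
Hypothesis ea : admissible a e.
Hypothesis ne : forall kappa, 0 < kappa -> nearly_optimal a e kappa.

(** All representations give the same values, so a single one provides a finite, jointly continuous
    version of e. Its modulus of continuity is then available before kappa is chosen. *)
Let joint : exists2 E : R -> R -> R -> R -> R, jointly_continuous E &
  forall x s y t, s < t -> e x s y t = (E x s y t)%:E.
Proof.
have [lo [hi [g [rho [K [c [v [lab [[rhoD massK eE] _ _ _ _]]]]]]]]] := ne ltr01.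
exists (optimal_gain lo hi g rho); first exact: optimal_gain_continuous massK.
by move=> x s y t st; exact (smallest_above_optimal_gain rhoD massK eE x y st).
Qed.

(** The trajectory c gains almost [U t - U s] but only passes near the points of the curve;
    continuity of e absorbs a displacement of at most sqrt kappa. *)
Lemma nearly_optimal_lower s t : 0 <= s -> s < t -> t <= 1 ->
  ((U t - U s)%:E <= e (F s) s (F t) t)%E.
Proof.
move=> s_0 st t1; have [E cE eE] := joint.
rewrite eE// lee_fin; apply/ler_addgt0Pr => z z0.
pose L := (3 * s0 + pc a) ^+ 2; have L0 : 0 <= L by exact: sqr_ge0.
have z4 : 0 < z / 4 by rewrite divr_gt0.
pose k := z / 4 / (L + 1); have k0 : 0 < k by rewrite divr_gt0// ltr_wpDl.
have kL : k * L <= z / 4.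
  by rewrite /k mulrAC ler_pdivrMr ?ltr_wpDl// ler_pM2l//; lra.
have [eta eta0 ceta] := cE (F s) s (F t) t (z / 4) st z4.
have W0 : 0 < 2 + k^-1 by rewrite addr_gt0// invr_gt0.
pose kap := Num.min (eta ^+ 2 / 4) (z / 4 / (2 + k^-1)).
have kap0 : 0 < kap by rewrite lt_min !divr_gt0// exprn_gt0.
have kW : (2 + k^-1) * kap <= z / 4.
  by rewrite mulrC -ler_pdivlMr// ge_min lexx orbT.
have kE : kap <= eta ^+ 2 / 4 by rewrite ge_min lexx.
have [lo [hi [g [rho [K [c [v [lab [[rhoD massK eO] [T c0 _ _] dk [ri rk] mk]]]]]]]]] := ne kap0.
have G := gain_close a0 a1 rhoD massK T dk ri rk s_0 st t1 k0.
have := gain_le_optimal rhoD massK (traj_sub T s_0 st t1).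
have := smallest_above_optimal_gain rhoD massK eO (c s) (c t) st.
rewrite eE// => -[<-] G2.
have close u : 0 <= u -> u <= 1 -> `|c u - F u| < eta.
  move=> u0 u1; apply: norm_lt_of_sqr => //; apply: le_trans kE.
  rewrite (traj_deviation a0 a1 T c0 u0 u1) addrC addKr.
  exact: (deviation_sqr_le a0 a1 T dk u0 u1).
have := ceta (c s) s (c t) t (close s s_0 (le_trans (ltW st) t1)).
rewrite !subrr normr0 => /(_ eta0 (close t (le_trans s_0 (ltW st)) t1) eta0).
rewrite ltr_norml => /andP[_]; move: G G2 kL kW; rewrite -/L.
move: (gain _ _ _ _ _) (E _ _ _ _) (E _ _ _ _) (k * L) ((2 + _) * kap) (U s) (U t) => *; lra.
Qed.

(** Every competitor is bounded by the optimal metric between endpoints displaced by at most sqrt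
    kappa, and joint continuity of that metric moves them back. *)
Lemma nearly_optimal_upper x s y t : s < t -> (e x s y t <= optimal_metric a x s y t)%E.
Proof.
move=> st; rewrite /optimal_metric.
apply/lee_addgt0Pr => z z0; rewrite -EFinD.
have z8 : 0 < z / 8 by rewrite divr_gt0.
have [eta eta0 ceta] := optimal_gain_continuous (fun=> F) (one_rhoD a0) (one_massK a0 a1) x y st z8.
(* [k * W] covers both errors proportional to k: the factor (1 + k)^-1 on a value of modulus at most
   [|EF x s y t| + z / 8], and [k * s0 ^+ 2]. *)
pose W : R := `|EF x s y t| + z / 8 + s0 ^+ 2 + 1.
have W0 : 0 < W.
  rewrite /W; have := normr_ge0 (EF x s y t); have := sqr_ge0 s0.
  by move: (`|EF x s y t|) (s0 ^+ 2) => *; lra.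
pose k := z / 8 / W; have k0 : 0 < k by rewrite divr_gt0.
have kW : k * W = z / 8 by rewrite /k divfK// gt_eqF.
have ts : 0 < t - s by rewrite subr_gt0.
pose m := z / 8 / (t - s); have m0 : 0 < m by rewrite divr_gt0.
have mE : m * (t - s) = z / 8 by rewrite /m divfK// gt_eqF.
have sm : 0 < Num.sqrt m by rewrite sqrtr_gt0.
pose kap := Num.min (Num.min (eta ^+ 2 / 4) (k * (z / 8))) (Num.min (z / 8) (z / 8 * Num.sqrt m)).
have kap0 : 0 < kap.
  by rewrite !lt_min z8 (mulr_gt0 k0 z8) (mulr_gt0 z8 sm) divr_gt0// exprn_gt0.
have kE : kap <= eta ^+ 2 / 4 by rewrite !ge_min lexx.
have k1 : k^-1 * kap <= z / 8 by rewrite mulrC ler_pdivrMr// mulrC !ge_min lexx !orbT.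
have k2 : kap <= z / 8 by rewrite !ge_min lexx !orbT.
have k3 : kap / Num.sqrt m <= z / 8 by rewrite ler_pdivrMr// !ge_min lexx !orbT.
have [lo [hi [g [rho [K [c [v [lab [[rhoD massK eO] [T c0 _ _] dk [ri rk] mk]]]]]]]]] := ne kap0.
rewrite (smallest_above_optimal_gain rhoD massK eO x y st) lee_fin.
apply: (optimal_gain_le rhoD massK st) => c' v' lab' T' c's c't.
have [d1 [d2 [h1 h2]]] := competitor_gain_shift a0 a1 rhoD massK T c0 dk ri rk mk T' k0 m0.
rewrite c's c't mE => G; apply: le_trans G _.
have close d : d ^+ 2 <= kap -> forall u, `|u - d - u| < eta.
  move=> dk' u; rewrite addrAC subrr add0r normrN; apply: norm_lt_of_sqr => //; exact: le_trans kE.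
have := ceta (x - d1) s (y - d2) t (close d1 h1 x).
rewrite !subrr normr0 => /(_ eta0 (close d2 h2 y) eta0).
move: kW k1 k2 k3; rewrite /W.
move: (EF (x - d1) s (y - d2) t) (EF x s y t) => X Y kW k1 k2 k3 XY.
have kk : 0 < 1 + k by rewrite addr_gt0.
have hX : (1 + k)^-1 * X <= X + k * `|X|.
  have -> : (1 + k)^-1 * X = X - (k * (1 + k)^-1) * X by field; rewrite gt_eqF.
  rewrite lerD2l -mulNr; apply: le_trans (ler_norm _) _.
  rewrite normrM normrN ler_wpM2r// ger0_norm ?divr_ge0 1?ltW//.
  by rewrite ltr_pdivrMr// ltr_pMr// ltrDl.
have hXY : k * `|X| <= k * (`|Y| + z / 8).
  rewrite ler_pM2l//; have -> : X = Y + (X - Y) by ring.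
  by rewrite (le_trans (ler_normD _ _))// lerD2l ltW.
have : X <= Y + z / 8 by move: XY; rewrite ltr_norml => /andP[_]; lra.
move: hX hXY kW k1 k2 k3; rewrite !mulrDr mulr1.
move: ((1 + k)^-1 * X) (k * `|X|) (k * `|Y|) (k^-1 * kap) (kap / Num.sqrt m) (k * (z / 8)) (k * s0 ^+ 2) => *; lra.
Qed.

(** The lower bound along the curve says that e dominates the planted curve, so minimality of
    [optimal_metric] yields the inequality opposite to [nearly_optimal_upper]. *)
Lemma nearly_optimal_unique : eq_on e (optimal_metric a).
Proof.
move=> x s y t st; apply/eqP; rewrite eq_le nearly_optimal_upper//=.
have [_ _ _ smallest] := optimal_metric_smallest a0 a1.
apply: smallest => //; first by case: ea.
  have [lo [hi [g [rho [K [c [v [lab [[_ _ [_ eD _ _]] _ _ _ _]]]]]]]]] := ne ltr01.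
  exact: eD.
move=> _ -> {x s y t st} x s y t st; rewrite /plant_metric; case: ifP; last by rewrite leNye.
move=> h; have /and4P[s_0 t1 /eqP xs /eqP yt] := h; rewrite xs yt.
have := plant_Fcurve a0 a1 s_0 (ltW st) t1; rewrite /plant_metric s_0 t1 !eqxx /= => ->.
exact: nearly_optimal_lower.
Qed.

End Uniqueness.

(** * Limits as a tends to 0 *)

Lemma theorem5_limits (R : realType) :
  (xB (R:=R) x @[x --> 0^'+] --> (4 / 3 : R)) /\
  (x ^+ 2 * Imin (R:=R) x @[x --> 0^'+] --> (8 / 27 : R)).
Proof.
have c2 : (2 * x @[x --> (0 : R)^'+] --> 0).
  by rewrite -[X in _ --> X](mulr0 2); apply: cvgMr; exact: cvg_at_right_filter cvg_id.
have cs : (Num.sqrt (2 * x) @[x --> (0 : R)^'+] --> 0).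
  rewrite -[X in _ --> X](sqrtr0 R).
  by apply: continuous_cvg c2; exact: sqrt_continuous.
have cd : (3 - 2 * Num.sqrt (2 * x) @[x --> (0 : R)^'+] --> (3 : R)).
  rewrite -[X in _ --> X]subr0 -[X in _ --> _ - X](mulr0 2).
  by apply: cvgB; [exact: cvg_cst|exact: cvgMr].
split.
  rewrite /xB; have -> : 4 / 3 = 4 * (1 - 0) / 3 :> R by rewrite subr0 mulr1.
  apply: cvgM; last by apply: cvgV.
  by apply: cvgMr; apply: cvgB => //; exact: cvg_cst.
have -> : 8 / 27 = 8 / (3 * 3 ^+ 2) :> R by field.
have c : (8 / (3 * (3 - 2 * Num.sqrt (2 * x)) ^+ 2) @[x --> (0 : R)^'+] --> (8 / (3 * 3 ^+ 2) : R)).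
  apply: cvgMr; apply: cvgV; first by rewrite gt_eqF.
  by apply: cvgMr; apply: cvgM.
apply: cvg_trans c; apply: near_eq_cvg; near=> x.
have x0 : 0 < x by near: x; exact: nbhs_right_gt.
rewrite /Imin.
have [->|d0] := eqVneq (3 - 2 * Num.sqrt (2 * x)) 0.
  by rewrite expr0n/= !mulr0 invr0 !mulr0.
by field; rewrite d0 gt_eqF.
Unshelve. all: by end_near. Qed.

Theorem theorem5 (R : realType) :
  (forall a : R, 0 < a < 1 / 2 ->
    exists (rho : R -> R) (eF : spacetime_fun R),
      [/\ density rho,
          smallest_above eF [set plant_metric 0 1 (Fcurve a) rho],
          admissible a eF,
          rate eF = (Imin a)%:E &
          forall e, admissible a e ->
            ((Imin a)%:E <= rate e)%E /\
            (rate e = (Imin a)%:E -> eq_on e eF)]) /\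
  (xB (R:=R) x @[x --> 0^'+] --> (4 / 3 : R)) /\
  (x ^+ 2 * Imin (R:=R) x @[x --> 0^'+] --> (8 / 27 : R)).
Proof.
split; last exact: theorem5_limits.
move=> a /andP[a0 a1]; exists (prho a), (optimal_metric a); split.
- exact: prho_density.
- exact: optimal_metric_smallest.
- exact: optimal_metric_admissible.
- exact: rate_optimal.
- move=> e ea; split=> [|re]; first exact: rate_lower.
  by apply: nearly_optimal_unique => // kappa; exact: rate_nearly_optimal.
Qed.
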